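(* Let $Q$ be any type A quiver (arbitrary orientation) and $\mathbf d$ a dimension vector of $Q$. The Zelevinsky map $$\zeta_Q: rep_Q(\mathbf d)\to B^-v_QP_Q/P_Q$$ (where the permutation $v_Q\in S_N$ and the block upper triangular parabolic subgroup $P_Q\supset B$ of $G$ depend only on $Q$ and $\mathbf d$) has the following property: for every $V\in rep_Q(\mathbf d)$ with rank parameter $\mathbf r$, the restriction of $\zeta_Q$ to the quiver locus $\overline{\mathcal O_V}$ is a scheme-theoretical isomorphism onto the Kazhdan-Lusztig variety $$\overline{BwP_Q/P_Q}\cap B^-v_QP_Q/P_Q,$$ where $w=w_Q(\mathbf r)$ is the Zelevinsky permutation of $\mathbf r$.
   Context: Quivers and representations. Let $k$ be an algebraically closed field. A type A quiver $Q$ has vertex set $Q_0=\{1,\dots,n\}$ and exactly one arrow between $x$ and $x+1$ for each $1\le x<n$ (and no others); an arrow $x\to x+1$ is a right arrow, an arrow $x+1\to x$ a left arrow. Left arrows are denoted $\alpha_1,\alpha_2,\dots$ and right arrows $\beta_1,\beta_2,\dots$, indices increasing from left to right. Write $s(\gamma),t(\gamma)$ for source and target of an arrow. Fix a dimension vector $\mathbf d=(d_x)_{x\in Q_0}$ with all $d_x\ge 1$. The affine space $rep_Q(\mathbf d)$ is the set of tuples $V=(V_\gamma)_\gamma$ of matrices over $k$, $V_\gamma$ of size $d_{t(\gamma)}\times d_{s(\gamma)}$; write $A_i=V_{\alpha_i}$, $B_i=V_{\beta_i}$. $\mathrm{GL}(\mathbf d)=\prod_x\mathrm{GL}(d_x)$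 acts by $g.V=(g_{t(\gamma)}V_\gamma g_{s(\gamma)}^{-1})_\gamma$; $\mathcal O_V$ is the orbit of $V$ and the quiver locus $\overline{\mathcal O_V}$ is its Zariski closure with reduced structure. Rank parameters. For an interval $[a,b]$ ($1\le a<b\le n$), $Q_{[a,b]}$ is the full subquiver on $a,\dots,b$. $M^Q_{[a,b]}(V)$ is the block matrix whose block rows are indexed by the sinks of $Q_{[a,b]}$ and block columns by the sources of $Q_{[a,b]}$ (both in decreasing order of integers), whose block at $(x,y)$ is the composition of the matrices of $V$ along the directed path from $y$ to $x$ if there is one, and $0$ otherwise. The rank parameter of $V$ is $\mathbf r=(r_{[a,b]})$, $r_{[a,b]}=\mathrm{rank}\,M^Q_{[a,b]}(V)$; it determines the orbit, and one writes $\mathcal O_{\mathbf r}=\mathcal O_V$. Sequences and blocked matrices. A sequence is a totally ordered set of vertices, order written $\prec$. For disjoint sequences $S,S'$, $S\triangleleft S'$ is their concatenation ($S$ first). A directed path is viewed as a sequence with $s(\gamma)\prec t(\gamma)$ for each of its arrows. Let $L_1,\dots,L_l$ be the maximal directed paths made of left arrows and $R_1,\dots,R_r$ the maximal directed paths made of right arrows, numbered from left to right; $s(P),t(P)$ are the start and end vertices of a path $P$. Put $$S'_Q=R_1\setminus t(R_1)\triangleleft\cdots\triangleleft R_r\setminus t(R_r)\triangleleft\{n\}\triangleleft L_l\setminus s(L_l)\triangleleft\cdots\triangleleft L_1\setminus s(L_1),$$ $$S_Q=L_l\setminus t(L_l)\triangleleft\cdots\triangleleft L_1\setminus t(L_1)\triangleleft\{1\}\triangleleft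 R_1\setminus s(R_1)\triangleleft\cdots\triangleleft R_r\setminus s(R_r).$$ Both are total orderings of $Q_0$. An $(S'_Q,S_Q)$-blocked matrix is an $N\times N$ matrix, $N=\sum_x d_x$, with block rows labelled top to bottom by $S'_Q$ and block columns labelled left to right by $S_Q$ (each in ascending order), where block row/column $[x]$ has height/width $d_x$; $(S_Q,S_Q)$-blocked is defined similarly. The $([x],[y])$-block is in block row $[x]$, block column $[y]$. $A_{[x]\times[y]}$ denotes the southwest submatrix formed by block rows with label $\succeq x$ in $S'_Q$ and block columns with label $\preceq y$ in $S_Q$. Groups. $G=\mathrm{GL}(N)$, $B$ and $B^-$ are the upper and lower triangular Borel subgroups, $P_Q$ is the parabolic subgroup of block upper triangular $(S_Q,S_Q)$-blocked matrices. A permutation $w\in S_N$ is identified with the matrix with entry $1$ at $(w(j),j)$ and $0$ elsewhere. $v_Q$ is the permutation whose $(S'_Q,S_Q)$-blocked matrix has $([x],[x])$-block $I_{d_x}$ and all other blocks $0$. The opposite cell $B^-v_QP_Q/P_Q$ is identified (via $A\mapsto AP_Q$) with the affine space $\mathbb A^{v_Q}$ of $(S'_Q,S_Q)$-blocked matrices whose $([x],[y])$-block is $I_{d_x}$ if $x=y$, is $0$ if $x\prec y$ in $S_Q$ or in $S'_Q$, and is arbitrary otherwise. Zelevinsky map. $\zeta_Q(V)\in\mathbb A^{v_Q}$ is the $(S'_Q,S_Q)$-blocked matrix with $([x],[y])$-block: $I_{d_x}$ if $x=y$; $0$ if there is no directed path from $y$ to $x$; $A_i$ if $y=x+1$ and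 $\alpha_i:x+1\to x$; $0$ if $y>x+1$ and there is a directed path from $y$ to $x$; $B_j\cdots B_{i+1}B_i$ if $y<x$ and there is a directed path $y\to y+1\to\cdots\to x$ with arrows $\beta_i,\beta_{i+1},\dots,\beta_j$. Zelevinsky permutation. An $(S'_Q,S_Q)$-blocked permutation matrix is of Z-type if the nonzero entries in each block form an identity matrix (possibly smaller than the block), and within each block row these identity matrices (from different blocks) are arranged from southwest to northeast, and within each block column from northwest to southeast. $w_Q(\mathbf r)$ is the unique $(S'_Q,S_Q)$-blocked permutation of Z-type with $\mathrm{rank}\,w_Q(\mathbf r)_{[x]\times[y]}=\mathrm{rank}\,\zeta_Q(V)_{[x]\times[y]}$ for all $V\in\mathcal O_{\mathbf r}$, $x,y\in Q_0$. *)

(* Defs.v *)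
From mathcomp Require Import all_boot all_order all_fingroup all_algebra.
From mathcomp Require Import mpoly.

Set Implicit Arguments.
Unset Strict Implicit.
Unset Printing Implicit Defensive.

Import GRing.Theory.
Local Open Scope ring_scope.

(* A type A quiver with n + 1 vertices 0, ..., n, i.e. the vertices are shifted
   by one with respect to the usual labels 1, ..., n + 1.  The arrow i : 'I_n
   joins i and i + 1; it is the right arrow i --> i + 1 if Q i is true, and the
   left arrow i + 1 --> i if Q i is false. *)
Definition quiverA (n : nat) := 'I_n -> bool.

Section Quiver.
Variables (n : nat) (Q : quiverA n).

Definition src (i : 'I_n) : 'I_n.+1 :=
  if Q i then widen_ord (leqnSn n) i else lift ord0 i.

Definition tgt (i : 'I_n) : 'I_n.+1 :=
  if Q i then lift ord0 i else widen_ord (leqnSn n) i.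

Definition arrow : rel 'I_n.+1 :=
  fun y x => [exists i, (src i == y) && (tgt i == x)].

Definition dpath (y x : 'I_n.+1) : bool := connect arrow y x.

(* The interval [p, q] is the support of a nontrivial directed path made of
   right arrows (b = true), resp. of left arrows (b = false). *)
Definition straight (b : bool) (p q : 'I_n.+1) : bool :=
  (p < q)%N && [forall i : 'I_n, (p <= i < q)%N ==> (Q i == b)].

Definition max_straight (b : bool) (p q : 'I_n.+1) : bool :=
  straight b p q &&
  [forall p' : 'I_n.+1, forall q' : 'I_n.+1,
     [&& p' <= p, q <= q' & straight b p' q']%N ==> (p' == p) && (q' == q)].

(* The supports of the maximal directed paths R_1, ..., R_r (b = true), resp.
   L_1, ..., L_l (b = false), from left to right. *)
Definition max_paths (b : bool) : seq ('I_n.+1 * 'I_n.+1) :=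
  [seq pq <- [seq (p, q) | p <- enum 'I_n.+1, q <- enum 'I_n.+1]
  | max_straight b pq.1 pq.2].

(* A right path on [p, q] starts at p and ends at q; a left path on [p, q]
   starts at q and ends at p. *)
Definition right_path (pq : 'I_n.+1 * 'I_n.+1) : seq 'I_n.+1 :=
  [seq x : 'I_n.+1 <- enum 'I_n.+1 | (pq.1 <= x <= pq.2)%N].

Definition left_path (pq : 'I_n.+1 * 'I_n.+1) : seq 'I_n.+1 :=
  rev (right_path pq).

(* S'_Q *)
Definition rowseq : seq 'I_n.+1 :=
  flatten [seq [seq x <- right_path pq | x != pq.2] | pq <- max_paths true]
  ++ [:: ord_max]
  ++ flatten [seq [seq x <- left_path pq | x != pq.2]
             | pq <- rev (max_paths false)].

(* S_Q *)
Definition colseq : seq 'I_n.+1 :=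
  flatten [seq [seq x <- left_path pq | x != pq.1]
          | pq <- rev (max_paths false)]
  ++ [:: ord0]
  ++ flatten [seq [seq x <- right_path pq | x != pq.1] | pq <- max_paths true].

Definition prec (S : seq 'I_n.+1) (x y : 'I_n.+1) : bool :=
  (index x S < index y S)%N.

Definition preceq (S : seq 'I_n.+1) (x y : 'I_n.+1) : bool :=
  (index x S <= index y S)%N.

Lemma uniq_max_paths b : uniq (max_paths b).
Proof.
rewrite filter_uniq // allpairs_uniq ?enum_uniq //.
by move=> [? ?] [? ?] _ _ /= [-> ->].
Qed.

Lemma max_straight_ex b (i : 'I_n) : Q i == b ->
  exists pq, (pq \in max_paths b) && (pq.1 <= i < pq.2)%N.
Proof.
move=> Qi.
pose P (pq : 'I_n.+1 * 'I_n.+1) := straight b pq.1 pq.2 && (pq.1 <= i < pq.2)%N.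
have P0 : P (widen_ord (leqnSn n) i, lift ord0 i).
  rewrite /P /straight /= /bump /= add1n ltnS leqnn /= andbT.
  apply/forallP => j; apply/implyP => /andP[le_ij]; rewrite ltnS => le_ji.
  by rewrite (_ : j = i) //; apply/val_inj/anti_leq; rewrite le_ij le_ji.
case: (arg_maxnP (fun pq : 'I_n.+1 * 'I_n.+1 => pq.2 - pq.1)%N P0) => -[p q].
move=> /andP[/= spq ipq] maxpq; exists (p, q).
rewrite mem_filter allpairs_f ?mem_enum // andbT /= ipq andbT.
rewrite /max_straight spq /=; apply/forallP => p'; apply/forallP => q'.
apply/implyP => /and3P[lp lq s'].
have /= := maxpq (p', q'); rewrite /P /= s' /=.
have -> : (p' <= i < q')%N.
  by case/andP: ipq => ? ?; rewrite (leq_trans lp) // (leq_trans _ lq).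
move=> /(_ isT) le'; have lt_pq : (p < q)%N by case/andP: spq.
have e : (p' = p :> nat) /\ (q' = q :> nat).
  have := leq_sub2l q' lp; have := leq_sub2r p lq; move=> h1 h2.
  have e1 : (q - p = q' - p)%N.
    by apply/anti_leq; rewrite h1 (leq_trans h2 le').
  have e2 : (q' - p = q' - p')%N.
    by apply/anti_leq; rewrite h2 -e1.
  have le_pq' : (p <= q')%N by rewrite (leq_trans (ltnW lt_pq)).
  split.
    by rewrite -(subKn (leq_trans lp le_pq')) -e2 subKn.
  by rewrite -(subnK le_pq') -e1 subnK // ltnW.
by case: e => /val_inj-> /val_inj->; rewrite !eqxx.
Qed.

Lemma max_straight_uniq b (i : 'I_n) pq pq' :
    pq \in max_paths b -> (pq.1 <= i < pq.2)%N ->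
    pq' \in max_paths b -> (pq'.1 <= i < pq'.2)%N -> pq = pq'.
Proof.
case: pq => p q; case: pq' => p' q'.
rewrite !mem_filter /= => /andP[/andP[s /forallP m] _] /andP[lp lq].
move=> /andP[/andP[s' /forallP m'] _] /andP[lp' lq'].
pose u := if (p <= p')%N then p else p'.
pose v := if (q <= q')%N then q' else q.
have le_up : (u <= p)%N by rewrite /u; case: (leqP p p') => // /ltnW.
have le_up' : (u <= p')%N by rewrite /u; case: (leqP p p').
have le_qv : (q <= v)%N by rewrite /v; case: (leqP q q').
have le_qv' : (q' <= v)%N by rewrite /v; case: (leqP q q') => // /ltnW.
have suv : straight b u v.
  apply/andP; split.
    by rewrite (leq_ltn_trans le_up) // (leq_ltn_trans lp) // (leq_trans lq).
  apply/forallP => j; apply/implyP => /andP[le_uj lt_jv].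
  case/andP: s => _ /forallP/(_ j)/implyP s.
  case/andP: s' => _ /forallP/(_ j)/implyP s'.
  have [le_ji|lt_ij] := leqP j i.
    have lt1 : (j < q)%N by apply: leq_ltn_trans lq.
    have lt2 : (j < q')%N by apply: leq_ltn_trans lq'.
    by move: le_uj; rewrite /u; case: (leqP p p') => _ h; [apply: s|apply: s'];
      rewrite h.
  have le1 : (p <= j)%N by rewrite (leq_trans lp) // ltnW.
  have le2 : (p' <= j)%N by rewrite (leq_trans lp') // ltnW.
  by move: lt_jv; rewrite /v; case: (leqP q q') => _ h; [apply: s'|apply: s];
    rewrite h ?le1 ?le2.
have /forallP/(_ v) := m u; rewrite le_up le_qv suv => /andP[/eqP eu /eqP ev].
have /forallP/(_ v) := m' u; rewrite le_up' le_qv' suv.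
by move=> /andP[/eqP eu' /eqP ev']; rewrite -eu -ev -eu' -ev'.
Qed.

Lemma count_max_paths b (i : 'I_n) :
  count (fun pq : 'I_n.+1 * 'I_n.+1 => pq.1 <= i < pq.2)%N (max_paths b) = (Q i == b).
Proof.
set a := (X in count X _).
have [Qi|nQi] := boolP (Q i == b).
  have [pq /andP[m apq]] := max_straight_ex Qi.
  rewrite (eq_in_count (a2 := pred1 pq)).
    by rewrite count_uniq_mem ?uniq_max_paths // m.
  move=> pq' m' /=; apply/idP/eqP => [apq'|-> //].
  exact: max_straight_uniq apq' m apq.
apply/eqP; rewrite -leqn0 leqNgt -has_count; apply/hasPn => pq.
rewrite mem_filter => /andP[/andP[/andP[_ /forallP/(_ i)/implyP s] _] _].
by apply: contra nQi => /s.
Qed.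

Lemma count_path b (c : 'I_n.+1 * 'I_n.+1 -> pred 'I_n.+1)
    (f : 'I_n.+1 * 'I_n.+1 -> seq 'I_n.+1) (s : seq ('I_n.+1 * 'I_n.+1))
    (x : 'I_n.+1) :
    (forall pq, perm_eq (f pq) (right_path pq)) -> perm_eq s (max_paths b) ->
  count_mem x (flatten [seq [seq y <- f pq | c pq y] | pq <- s]) =
  count (fun pq : 'I_n.+1 * 'I_n.+1 => (pq.1 <= x <= pq.2)%N && c pq x)
    (max_paths b).
Proof.
move=> fE sE; rewrite count_flatten -map_comp.
rewrite -(seq.permP sE); elim: s {sE} => //= pq s ->; congr addn.
have u : uniq [seq y <- f pq | c pq y].
  by rewrite filter_uniq // (perm_uniq (fE pq)) filter_uniq ?enum_uniq.
rewrite count_uniq_mem // mem_filter (perm_mem (fE pq)) mem_filter mem_enum.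
by rewrite andbT andbC.
Qed.

Lemma count_out b (x : 'I_n.+1) :
  count (fun pq : 'I_n.+1 * 'I_n.+1 => (pq.1 <= x <= pq.2)%N && (x != pq.2))
    (max_paths b) =
  (if unlift ord_max x is Some i then Q i == b else false).
Proof.
case: unliftP => [i ->|->].
  rewrite -count_max_paths; apply: eq_count => -[p q] /=.
  have e : bump n i = i by exact: lift_max.
  rewrite -(inj_eq val_inj) /= e -andbA; congr andb.
  by rewrite andbC -ltn_neqAle.
rewrite (@eq_count _ _ pred0) ?count_pred0 // => -[p q] /=.
rewrite -(inj_eq val_inj) /=.
have := leq_ord q; by case: ltngtP => //= _ _; rewrite andbF.
Qed.

Lemma count_in b (x : 'I_n.+1) :
  count (fun pq : 'I_n.+1 * 'I_n.+1 => (pq.1 <= x <= pq.2)%N && (x != pq.1))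
    (max_paths b) =
  (if unlift ord0 x is Some i then Q i == b else false).
Proof.
case: unliftP => [i ->|->].
  rewrite -count_max_paths; apply: eq_count => -[p q] /=.
  have e : bump 0 i = i.+1 by [].
  rewrite -(inj_eq val_inj) /= e andbAC; congr andb.
  by rewrite andbC eq_sym -ltn_neqAle ltnS.
rewrite (@eq_count _ _ pred0) ?count_pred0 // => -[p q] /=.
rewrite -(inj_eq val_inj) /= leqn0 eq_sym.
by case: eqP => //= _; rewrite andbF.
Qed.

Lemma perm_left_path pq : perm_eq (left_path pq) (right_path pq).
Proof. by rewrite perm_rev. Qed.

Lemma perm_rev_max_paths b : perm_eq (rev (max_paths b)) (max_paths b).
Proof. by rewrite perm_rev. Qed.

Lemma perm_rowseq : perm_eq rowseq (enum 'I_n.+1).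
Proof.
apply/allP => x _ /=; apply/eqP; rewrite [RHS](count_uniq_mem _ (enum_uniq _)) mem_enum.
rewrite !count_cat (count_path _ _ (fun=> perm_refl _) (perm_refl _)).
rewrite (count_path _ _ perm_left_path (perm_rev_max_paths false)).
rewrite !count_out //= addn0; case: unliftP => [i ->|->]; last by rewrite eqxx.
by rewrite (negPf (neq_lift _ _)); case: (Q i).
Qed.

Lemma perm_colseq : perm_eq colseq (enum 'I_n.+1).
Proof.
apply/allP => x _ /=; apply/eqP; rewrite [RHS](count_uniq_mem _ (enum_uniq _)) mem_enum.
rewrite !count_cat (count_path _ _ perm_left_path (perm_rev_max_paths false)).
rewrite (count_path _ _ (fun=> perm_refl _) (perm_refl _)).
rewrite !count_in //= addn0; case: unliftP => [i ->|->]; last by rewrite eqxx.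
by rewrite (negPf (neq_lift _ _)); case: (Q i).
Qed.

End Quiver.

Section Blocked.
Variables (n : nat) (d : 'I_n.+1 -> nat).

Definition dimtot : nat := (\sum_x d x)%N.

Lemma dimtotE (S : seq 'I_n.+1) : perm_eq S (enum 'I_n.+1) ->
  dimtot = (\sum_(i < size S) d (tnth (in_tuple S) i))%N.
Proof.
by move=> SE; rewrite /dimtot -big_enum -(perm_big _ SE) /= big_tnth.
Qed.

(* The label of p : 'I_N with respect to S: the vertex x such that the p-th row
   (or column) lies in the block row (or column) [x], and the position of p
   inside this block. *)
Definition label (S : seq 'I_n.+1) (SE : perm_eq S (enum 'I_n.+1))
    (p : 'I_dimtot) : {x : 'I_n.+1 & 'I_(d x)} :=
  let u := cast_ord (dimtotE SE) p in
  Tagged (fun x => 'I_(d x)) (tagnat.sig2 u).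

Variable Q : quiverA n.

Definition rowlab : 'I_dimtot -> {x : 'I_n.+1 & 'I_(d x)} :=
  label (perm_rowseq Q).
Definition collab : 'I_dimtot -> {x : 'I_n.+1 & 'I_(d x)} :=
  label (perm_colseq Q).

Definition rowv (p : 'I_dimtot) : 'I_n.+1 := tag (rowlab p).
Definition colv (q : 'I_dimtot) : 'I_n.+1 := tag (collab q).

Definition rowoff (p : 'I_dimtot) : nat := tagged (rowlab p).
Definition coloff (q : 'I_dimtot) : nat := tagged (collab q).

(* The (S'_Q, S_Q)-blocked matrix with ([x], [y])-block F x y *)
Definition blocked (R : Type) (F : forall x y, 'M[R]_(d x, d y)) :
    'M[R]_dimtot :=
  \matrix_(p, q) F (rowv p) (colv q) (tagged (rowlab p)) (tagged (collab q)).

(* A_{[x] x [y]} *)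
Definition swrows (x : 'I_n.+1) : {set 'I_dimtot} :=
  [set p | preceq (rowseq Q) x (rowv p)].
Definition swcols (y : 'I_n.+1) : {set 'I_dimtot} :=
  [set q | preceq (colseq Q) (colv q) y].
Definition swsub (R : Type) (A : 'M[R]_dimtot) (x y : 'I_n.+1) :
    'M[R]_(#|swrows x|, #|swcols y|) :=
  mxsub enum_val enum_val A.

End Blocked.

Section Representations.
Variables (n : nat) (Q : quiverA n) (d : 'I_n.+1 -> nat).

Definition rep (R : Type) : Type :=
  forall i : 'I_n, 'M[R]_(d (tgt Q i), d (src Q i)).

Section Ring.
Variables (R : comNzRingType) (V : rep R).

(* The matrix of the arrow y --> x, or 0 if there is no such arrow (there is at
   most one; conform_mx only serves to identify the dimensions). *)
Definition arrow_mx (x y : 'I_n.+1) : 'M[R]_(d x, d y) :=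
  \sum_(i | (src Q i == y) && (tgt Q i == x)) conform_mx 0 (V i).

(* The sum, over the directed paths of length m from y to x, of the composition
   of the matrices of V along the path. *)
Fixpoint walk_mx (m : nat) (x y : 'I_n.+1) : 'M[R]_(d x, d y) :=
  if m is m'.+1 then \sum_z arrow_mx x z *m walk_mx m' z y
  else if x == y then pid_mx (d x) else 0.

(* In type A there is at most one directed path from y to x, and its length is
   then |x - y|; so this is the composition along that path, or 0. *)
Definition path_mx (x y : 'I_n.+1) : 'M[R]_(d x, d y) :=
  walk_mx ((x - y) + (y - x))%N x y.

Definition zeta_block (x y : 'I_n.+1) : 'M[R]_(d x, d y) :=
  if x == y then pid_mx (d x)
  else if ~~ dpath Q y x then 0
  else if (y == x.+1 :> nat) then arrow_mx x y
  else if (x.+1 < y)%N then 0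
  else path_mx x y.

Definition zeta : 'M[R]_(dimtot d) := blocked Q zeta_block.

End Ring.

Definition sub_sinks (a b : 'I_n.+1) : seq 'I_n.+1 :=
  rev [seq x : 'I_n.+1 <- enum 'I_n.+1 | (a <= x <= b)%N &&
        [forall y : 'I_n.+1, (a <= y <= b)%N ==> ~~ arrow Q x y]].

Definition sub_sources (a b : 'I_n.+1) : seq 'I_n.+1 :=
  rev [seq x : 'I_n.+1 <- enum 'I_n.+1 | (a <= x <= b)%N &&
        [forall y : 'I_n.+1, (a <= y <= b)%N ==> ~~ arrow Q y x]].

Definition rank_mx (R : comNzRingType) (V : rep R) (a b : 'I_n.+1) :=
  \mxblock_(i < size (sub_sinks a b), j < size (sub_sources a b))
    path_mx V (tnth (in_tuple (sub_sinks a b)) i)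
              (tnth (in_tuple (sub_sources a b)) j).

End Representations.

(* Zariski topology and ideals.  A space T with coordinates c : T -> I -> k, for
   a finite index set I, has coordinate ring {mpoly k[#|I|]}. *)
Section Affine.
Variables (k : fieldType) (I : finType) (T : Type) (c : T -> I -> k).

Definition evalat (p : {mpoly k[#|I|]}) (t : T) : k :=
  p.@[fun j => c t (enum_val j)].

Definition vanishing_ideal (E : T -> Prop) : {mpoly k[#|I|]} -> Prop :=
  fun p => forall t, E t -> evalat p t = 0.

Definition zclosure (E : T -> Prop) : T -> Prop :=
  fun t => forall p, vanishing_ideal E p -> evalat p t = 0.

End Affine.

Definition ideal_sum (R : nzRingType) (I J : R -> Prop) : R -> Prop :=
  fun f => exists g h, [/\ I g, J h & f = g + h].

(* The ring morphism phi : A -> A' induces an isomorphism A / J -> A' / J' of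
   quotient rings, i.e. an isomorphism Spec (A' / J') -> Spec (A / J) of affine
   schemes: it is well defined and injective, and surjective. *)
Definition induces_quotient_iso (A A' : nzRingType) (phi : A -> A')
    (J : A -> Prop) (J' : A' -> Prop) : Prop :=
  (forall f, J f <-> J' (phi f)) /\ (forall g, exists f, J' (g - phi f)).

Section QuiverLoci.
Variables (k : closedFieldType) (n : nat) (Q : quiverA n) (d : 'I_n.+1 -> nat).

Definition rep_index : finType :=
  {i : 'I_n & ('I_(d (tgt Q i)) * 'I_(d (src Q i)))%type}.

Definition rep_coord (V : rep Q d k) (u : rep_index) : k :=
  V (tag u) (tagged u).1 (tagged u).2.

Definition orbit_of (V U : rep Q d k) : Prop :=
  exists g : forall x, 'M[k]_(d x),
    (forall x, g x \in unitmx) /\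
    forall i, U i = g (tgt Q i) *m V i *m invmx (g (src Q i)).

Definition quiver_locus (V : rep Q d k) : rep Q d k -> Prop :=
  zclosure rep_coord (orbit_of V).

Definition quiver_locus_ideal (V : rep Q d k) : {mpoly k[#|rep_index|]} -> Prop :=
  vanishing_ideal rep_coord (quiver_locus V).

Definition rank_parameter (V : rep Q d k) (r : 'I_n.+1 -> 'I_n.+1 -> nat) :
    Prop :=
  forall a b : 'I_n.+1, (a < b)%N -> \rank (rank_mx V a b) = r a b.

End QuiverLoci.

(* The subsets of G / P are represented by their inverse images in G = GL(N),
   i.e. by the right P-stable subsets of G. *)
Section KazhdanLusztig.
Variables (k : closedFieldType) (n : nat) (Q : quiverA n) (d : 'I_n.+1 -> nat).

Local Notation N := (dimtot d).
Local Notation rowv := (@rowv n d Q).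
Local Notation colv := (@colv n d Q).
Local Notation rowoff := (@rowoff n d Q).
Local Notation coloff := (@coloff n d Q).

Definition mx_index : finType := ('I_N * 'I_N)%type.

Definition mx_coord (A : 'M[k]_N) (u : mx_index) : k := A u.1 u.2.

Definition borel_up (A : 'M[k]_N) : Prop := A \in unitmx /\ is_trig_mx A^T.

Definition borel_low (A : 'M[k]_N) : Prop := A \in unitmx /\ is_trig_mx A.

(* P_Q; here the rows are also labelled by S_Q. *)
Definition parabolic (A : 'M[k]_N) : Prop :=
  A \in unitmx /\
  forall p q, prec (colseq Q) (colv q) (colv p) -> A p q = 0.

Definition same_point (A A' : 'M[k]_N) : Prop :=
  exists2 h, parabolic h & A' = A *m h.

Definition perm_matrix (w : 'S_N) : 'M[k]_N := \matrix_(i, j) (i == w j)%:R.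

Definition v_mx : 'M[k]_N :=
  blocked Q (fun x y => if x == y then pid_mx (d x) else 0).

Definition opp_cell (A : 'M[k]_N) : Prop :=
  exists b h, [/\ borel_low b, parabolic h & A = b *m v_mx *m h].

Definition schubert_cell (w : 'S_N) (A : 'M[k]_N) : Prop :=
  exists b h, [/\ borel_up b, parabolic h & A = b *m perm_matrix w *m h].

(* Closed subsets of G / P for the quotient topology *)
Definition flag_closed (F : 'M[k]_N -> Prop) : Prop :=
  [/\ forall A, F A -> A \in unitmx,
      forall A, A \in unitmx -> zclosure mx_coord F A -> F A &
      forall A A', same_point A A' -> F A -> F A'].

Definition schubert_variety (w : 'S_N) (A : 'M[k]_N) : Prop :=
  A \in unitmx /\
  forall F, flag_closed F -> (forall A', schubert_cell w A' -> F A') -> F A.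

Definition cell_space (A : 'M[k]_N) : Prop :=
  (forall p q, rowv p = colv q -> A p q = (rowoff p == coloff q)%:R) /\
  (forall p q, prec (colseq Q) (rowv p) (colv q) \/
               prec (rowseq Q) (rowv p) (colv q) -> A p q = 0).

(* The points of the Kazhdan-Lusztig variety *)
Definition kl_variety (w : 'S_N) (A : 'M[k]_N) : Prop :=
  schubert_variety w A /\ opp_cell A.

(* The scheme-theoretic intersection of the Schubert variety of w with the
   opposite cell.  Under the identification of the opposite cell with
   cell_space it is the pullback along cell_space -> G -> G / P of the Schubert
   variety with its reduced structure.  As G -> G / P is smooth, the pullback to
   G is still reduced; hence the ideal in the coordinate ring of the space of
   N x N matrices is the sum of the two vanishing ideals (the determinant is
   constant and nonzero on cell_space, so it need not be inverted). *)
Definition kl_ideal (w : 'S_N) : {mpoly k[#|mx_index|]} -> Prop :=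
  ideal_sum (vanishing_ideal mx_coord (schubert_variety w))
            (vanishing_ideal mx_coord cell_space).

Definition entry (i : 'I_n) (a : 'I_(d (tgt Q i))) (b : 'I_(d (src Q i))) :
    rep_index Q d :=
  Tagged (fun j => ('I_(d (tgt Q j)) * 'I_(d (src Q j)))%type) (a, b).

Definition generic_rep : rep Q d {mpoly k[#|rep_index Q d|]} :=
  fun i => \matrix_(a, b) 'X_(enum_rank (entry a b)).

(* The comorphism f |-> f o zeta *)
Definition zeta_comorphism (f : {mpoly k[#|mx_index|]}) :
    {mpoly k[#|rep_index Q d|]} :=
  f \mPo [tuple zeta generic_rep (enum_val j).1 (enum_val j).2
         | j < #|mx_index|].

(* The nonzero entries of perm_matrix w are at the positions (w q, q).  In each
   block they form an identity matrix of size m, placed at offset (a0, b0); the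
   identity matrices go from southwest to northeast in each block row, and from
   northwest to southeast in each block column. *)
Definition z_type (w : 'S_N) : Prop :=
  [/\ forall x y : 'I_n.+1, exists a0 b0 m : nat,
        [/\ (a0 + m <= d x)%N, (b0 + m <= d y)%N &
          forall p q, rowv p = x -> colv q = y ->
            (p == w q) = [exists t : 'I_m,
                           (rowoff p == a0 + t)%N && (coloff q == b0 + t)%N]],
      forall q q', rowv (w q) = rowv (w q') ->
        prec (colseq Q) (colv q) (colv q') -> (w q' < w q)%N &
      forall q q', colv q = colv q' ->
        prec (rowseq Q) (rowv (w q)) (rowv (w q')) -> (q < q')%N].

Definition zelevinsky_perm (r : 'I_n.+1 -> 'I_n.+1 -> nat) (w : 'S_N) : Prop :=
  z_type w /\
  forall V : rep Q d k, rank_parameter V r -> forall x y,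
    \rank (swsub Q (perm_matrix w) x y) = \rank (swsub Q (zeta V) x y).

End KazhdanLusztig.

(* Main.v *)
Require Import Defs.
From mathcomp Require Import all_boot all_order all_fingroup all_algebra.
From mathcomp Require Import mpoly zify.

Set Implicit Arguments.
Unset Strict Implicit.
Unset Printing Implicit Defensive.

Import GRing.Theory.

(** Relabelling the rows of a blocked matrix, from S'_Q to S_Q, turns it into an
    operator on k^N that is graded by the vertices.  Then zeta V becomes

      [zetaop V = (1 - R)^-1 (1 + L)],

    where R and L are the sums of all right and of all left arrows of V
    ([zeta_opmE]), and the block orders become two integer keys [rkey] and [ckey]
    on the vertices.  The proof rests on this factorization.

    Double cosets.  Let p and h be invertible and block upper triangular, p for the
    order of the rows and h for that of the columns.  If [zetaop U h = p zetaop V],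
    then the diagonal blocks of [(1 + L_U)^-1 p (1 - R_V)^-1] commute with the
    arrows, and U lies in the orbit of V ([double_coset_orbit]).  Moreover every
    point of the cell of the form [p (zetaop V) h] is [zetaop U] for some U
    ([cell_recognition]): its blocks, and those of its inverse, vanish between
    vertices where those of [zetaop V], and of its inverse, do.  So zeta maps the
    orbit of V onto the intersection of the cell with the double coset of zeta V.

    Ranks.  A south-west rank of zeta V equals, up to constants that do not depend
    on V, the rank of a matrix with one block row for each arrow in some set
    ([rank_swsub_zeta]).  Splitting and pivoting reduce this matrix to the arrows
    of an interval [a, b] ([rho_reduction]), where its rank is r_[a,b] up to a
    constant ([rho_interval], [rank_incidence]).  Hence the rank parameter
    determines the south-west ranks ([swsub_zeta_parameter]).  A Bruhat
    decomposition of zeta V gives a permutation u with these ranks; reordering u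
    inside the block rows and columns gives the only permutation w of Z-type with
    the same ranks ([zelevinsky_perm_exists]).

    The locus goes into the Schubert variety.  The matrix of u arises from that of
    w by exchanges of rows of the same block row; each exchange leads from a double
    coset into its closure ([flag_closed_pm]).  So the orbit is mapped into X_w
    ([schubert_rank]), and then so is its closure, because zeta is polynomial.

    The equations.  On the open set where the minors [cellminor] do not vanish,
    block elimination brings a matrix into the cell by triangular operations on the
    rows and on the columns.  This [normal_form] fixes the cell pointwise and
    maps BwP, where it is defined, into zeta (orbit of V).  If f vanishes on zeta (orbit of V),
    then the composition of f with it, multiplied by a power of the minors, is a
    polynomial that vanishes on BwP, hence on X_w, and agrees with f on the cell,
    where the minors are 1 ([kl_extension]).  So the equations of the locus are
    those of X_w, up to equations of the cell.  Since zeta has a polynomial left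
    inverse [recover], the theorem follows. *)

(** * The two orders on the vertices *)

Section Orders.
Variables (n : nat) (Q : quiverA n).

(** The orientation as a function of natural numbers, so that the arguments on
    the two vertex orders become integer arithmetic. *)
Definition orient (m : nat) : bool := if insub m is Some i then Q i else false.

(** The arrow between [m] and [m.+1] is a right, resp. a left arrow; [ri] and
    [li] say the same about the arrow between [m.-1] and [m]. There is no
    arrow on the right of [n] or on the left of 0. *)
Definition rt (m : nat) : bool := (m < n)%N && orient m.
Definition lt (m : nat) : bool := (m < n)%N && ~~ orient m.
Definition ri (m : nat) : bool := (0 < m)%N && orient m.-1.
Definition li (m : nat) : bool := (0 < m)%N && ~~ orient m.-1.

(** In the order of the rows, the vertices with a right arrow on their right
    come first, from left to right, then the others from right to left. In
    that of the columns, the vertices with a left arrow on their left come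
    first, from right to left, then the others from left to right. *)
Definition rkey (m : nat) : nat := if rt m then m else (n.*2 - m)%N.
Definition ckey (m : nat) : nat := if li m then (n - m)%N else (n + m)%N.

Lemma orientE (i : 'I_n) : orient i = Q i.
Proof. by rewrite /orient valK. Qed.

Lemma straight_orient b (p q : 'I_n.+1) m :
  straight Q b p q -> (p <= m < q)%N -> orient m = b.
Proof.
move=> /andP[_ /forallP s] /andP[pm mq].
have mn : (m < n)%N by have := ltn_ord q; lia.
have := s (Ordinal mn); rewrite /= pm mq /= => /eqP <-.
by rewrite -orientE.
Qed.

Lemma pairwise_flatten (T : eqType) (r : rel T) (ss : seq (seq T)) :
  all (pairwise r) ss -> pairwise (allrel r) ss -> pairwise r (flatten ss).
Proof.
elim: ss => //= s ss IH /andP[ps pss] /andP[ass aps].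
rewrite pairwise_cat ps IH // !andbT.
elim: ss {IH pss aps} ass => /= [|t ss IH]; first by rewrite allrel0r.
by move=> /andP[a b]; rewrite allrel_catr a IH.
Qed.

Lemma pairwise_rev (T : Type) (r : rel T) s :
  pairwise r (rev s) = pairwise (fun x y => r y x) s.
Proof.
elim: s => //= x s IH; rewrite rev_cons pairwise_rcons IH.
by rewrite all_rev.
Qed.

(** The enumeration of pairs is lexicographic, and two maximal paths of the
    same direction share at most an end. *)
Lemma pairwise_max_paths b :
  pairwise (fun u v : 'I_n.+1 * 'I_n.+1 => (u.2 <= v.1)%N) (max_paths Q b).
Proof.
have un := uniq_max_paths Q b.
have lex : pairwise (fun u v : 'I_n.+1 * 'I_n.+1 =>
    (u.1 < v.1)%N || (u.1 == v.1) && (u != v)) (max_paths Q b).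
  rewrite /max_paths; apply: pairwise_filter.
  have en : pairwise (fun x y : 'I_n.+1 => (x < y)%N) (enum 'I_n.+1).
    rewrite -(pairwise_map val ltn) val_enum_ord -sorted_pairwise ?iota_ltn_sorted //.
    exact: ltn_trans.
  elim: {1 3}(enum 'I_n.+1) en => //= p s IH.
  have us := enum_uniq 'I_n.+1; move=> /andP[ps en]; rewrite pairwise_cat IH // andbT; apply/andP; split.
    apply/allrelP => u v /mapP[x _ ->] /allpairsP[[y z] /= [ys zs ->]] /=.
    by rewrite (allP ps).
  rewrite pairwise_map; move: us; rewrite uniq_pairwise; apply: sub_pairwise => x y /= xy.
  by rewrite eqxx xpair_eqE eqxx xy orbT.
apply: (sub_in_pairwise (P := mem (max_paths Q b)) _ _ lex); last exact: allss.
move=> [p q] [p' q'] m m' /=; rewrite xpair_eqE.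
have /andP[pq _] : straight Q b p q.
  by move: m; rewrite mem_filter /= => /andP[/andP[]].
have /andP[pq' _] : straight Q b p' q'.
  by move: m'; rewrite mem_filter /= => /andP[/andP[]].
move=> o; rewrite leqNgt; apply/negP => h.
have ln : (p' < n)%N by have := ltn_ord q; lia.
have e : (p, q) = (p', q').
  by apply: (@max_straight_uniq _ Q b (Ordinal ln)) => //=;
    case/orP: o => [|/andP[/eqP->]]; lia.
by case: e o => -> ->; rewrite !eqxx ltnn.
Qed.

Lemma index_key (S : seq 'I_n.+1) (key : nat -> nat) x y :
    perm_eq S (enum 'I_n.+1) ->
    pairwise (fun x y : 'I_n.+1 => (key x < key y)%N) S ->
  (index x S < index y S)%N = (key x < key y)%N.
Proof.
move=> pS; have inS (z : 'I_n.+1) : z \in S by rewrite (perm_mem pS) mem_enum.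
have tr : transitive (fun x y : 'I_n.+1 => (key x < key y)%N).
  by move=> a b c; apply: ltn_trans.
rewrite -sorted_pairwise // => sS.
have h a b := @sorted_ltn_index _ _ tr S sS a b (inS a) (inS b).
case: ltngtP => [/h -> //|/h|e]; first lia.
by rewrite -(nth_index x (inS x)) e nth_index // ltnn.
Qed.

Lemma pairwise_right_path (pq : 'I_n.+1 * 'I_n.+1) :
  pairwise (fun x y : 'I_n.+1 => (x < y)%N) (right_path pq).
Proof.
apply: pairwise_filter.
rewrite -(pairwise_map val ltn) val_enum_ord -sorted_pairwise ?iota_ltn_sorted //.
exact: ltn_trans.
Qed.

Lemma pairwise_left_path (pq : 'I_n.+1 * 'I_n.+1) :
  pairwise (fun x y : 'I_n.+1 => (y < x)%N) (left_path pq).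
Proof. by rewrite pairwise_rev; exact: pairwise_right_path. Qed.

Lemma max_paths_orient b p q m :
  (p, q) \in max_paths Q b -> (p <= m < q)%N -> orient m = b.
Proof.
rewrite mem_filter /= => /andP[/andP[s _] _]; exact: straight_orient s.
Qed.

Lemma mem_right_path (pq : 'I_n.+1 * 'I_n.+1) x : (x \in right_path pq) = (pq.1 <= x <= pq.2)%N.
Proof. by rewrite mem_filter mem_enum andbT. Qed.

Lemma mem_left_path (pq : 'I_n.+1 * 'I_n.+1) x : (x \in left_path pq) = (pq.1 <= x <= pq.2)%N.
Proof. by rewrite mem_rev mem_right_path. Qed.

Lemma pairwise_rowseq : pairwise (fun x y : 'I_n.+1 => (rkey x < rkey y)%N) (rowseq Q).
Proof.
have rT pq (x : 'I_n.+1) : pq \in max_paths Q true ->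
    x \in [seq y <- right_path pq | y != pq.2] ->
    [/\ rt x, (pq.1 <= x)%N & (x < pq.2)%N].
  case: pq => p q m; rewrite mem_filter mem_right_path /= => /andP[xq /andP[px xq']].
  have lt : (x < q)%N by rewrite ltn_neqAle xq' andbT.
  split=> //; rewrite /rt (max_paths_orient m) ?px //.
  by have := ltn_ord q; lia.
have lT pq (x : 'I_n.+1) : pq \in max_paths Q false ->
    x \in [seq y <- left_path pq | y != pq.2] ->
    [/\ ~~ rt x, (pq.1 <= x)%N & (x < pq.2)%N].
  case: pq => p q m; rewrite mem_filter mem_left_path /= => /andP[xq /andP[px xq']].
  have lt : (x < q)%N by rewrite ltn_neqAle xq' andbT.
  by split=> //; rewrite /rt (max_paths_orient m) ?px ?andbF.
rewrite /rowseq !pairwise_cat /=; apply/and3P; split.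
- apply/allrelP => x y /flatten_mapP[[p1 q1] mpq /(rT _ _ mpq)[rx _ /= xq]].
  have nn : rt n = false by rewrite /rt ltnn.
  rewrite inE => /orP[/eqP->|/flatten_mapP[[p2 q2]]].
    by rewrite /rkey rx /= nn; have := ltn_ord q1; lia.
  rewrite mem_rev => mpq' /(lT _ _ mpq')[ry _ /= yq].
  by rewrite /rkey rx (negPf ry); have := ltn_ord q1; have := ltn_ord q2; lia.
- apply: pairwise_flatten.
    apply/allP => s /mapP[[p1 q1] mpq ->]; apply: (sub_in_pairwise
      (P := mem [seq y <- right_path (p1,q1) | y != (p1,q1).2]) _ (allss _)).
      2: apply/pairwise_filter/pairwise_right_path.
    by move=> x y /(rT _ _ mpq)[rx _ _] /(rT _ _ mpq)[ry _ _]; rewrite /rkey rx ry.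
  rewrite pairwise_map; apply: (sub_in_pairwise (P := mem (max_paths Q true)) _
    (allss _) (pairwise_max_paths true)) => -[p1 q1] [p2 q2] m m' /= le.
  apply/allrelP => x y /(rT _ _ m)[rx _ /= h] /(rT _ _ m')[ry /= h' _].
  by rewrite /rkey rx ry; lia.
- apply/andP; split.
    apply/allrelP => z x; rewrite inE => /eqP-> /flatten_mapP[[p1 q1]].
    have nn : rt n = false by rewrite /rt ltnn.
    rewrite mem_rev => mpq /(lT _ _ mpq)[rx _ /= h].
    by rewrite /rkey nn (negPf rx); have := ltn_ord q1; lia.
apply: pairwise_flatten.
  apply/allP => s /mapP[[p1 q1]]; rewrite mem_rev => mpq ->; apply: (sub_in_pairwise
    (P := mem [seq y <- left_path (p1,q1) | y != (p1,q1).2]) _ (allss _)).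
    2: apply/pairwise_filter/pairwise_left_path.
  move=> x y /(lT _ _ mpq)[rx _ /= h] /(lT _ _ mpq)[ry _ _]; rewrite /rkey (negPf rx) (negPf ry).
  by have := ltn_ord q1; lia.
rewrite pairwise_map pairwise_rev.
apply: (sub_in_pairwise (P := mem (max_paths Q false)) _
  (allss _) (pairwise_max_paths false)) => -[p1 q1] [p2 q2] m m' /= le.
apply/allrelP => x y /(lT _ _ m')[rx /= h _] /(lT _ _ m)[ry _ /= h'].
by rewrite /rkey (negPf rx) (negPf ry); have := ltn_ord q2; have := ltn_ord x; lia.
Qed.

Lemma pairwise_colseq : pairwise (fun x y : 'I_n.+1 => (ckey x < ckey y)%N) (colseq Q).
Proof.
have rT pq (x : 'I_n.+1) : pq \in max_paths Q true ->
    x \in [seq y <- right_path pq | y != pq.1] ->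
    [/\ ~~ li x, (pq.1 < x)%N & (x <= pq.2)%N].
  case: pq => p q m; rewrite mem_filter mem_right_path /= => /andP[xq /andP[px xq']].
  have lt : (p < x)%N by rewrite ltn_neqAle px andbT eq_sym.
  by split=> //; rewrite /li (max_paths_orient m) ?andbF //; lia.
have lT pq (x : 'I_n.+1) : pq \in max_paths Q false ->
    x \in [seq y <- left_path pq | y != pq.1] ->
    [/\ li x, (pq.1 < x)%N & (x <= pq.2)%N].
  case: pq => p q m; rewrite mem_filter mem_left_path /= => /andP[xq /andP[px xq']].
  have lt : (p < x)%N by rewrite ltn_neqAle px andbT eq_sym.
  by split=> //; rewrite /li (max_paths_orient m) ?andbT //; lia.
have n0 : li (ord0 : 'I_n.+1) = false by [].
rewrite /colseq !pairwise_cat /=; apply/and3P; split.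
- apply/allrelP => x y /flatten_mapP[[p1 q1]].
  rewrite mem_rev => mpq /(lT _ _ mpq)[rx /= xq _].
  rewrite inE => /orP[/eqP->|/flatten_mapP[[p2 q2]] mpq' /(rT _ _ mpq')[ry /= yq _]].
    by rewrite /ckey rx n0 /=; have := ltn_ord x; lia.
  by rewrite /ckey rx (negPf ry); have := ltn_ord x; lia.
- apply: pairwise_flatten.
    apply/allP => s /mapP[[p1 q1]]; rewrite mem_rev => mpq ->; apply: (sub_in_pairwise
      (P := mem [seq y <- left_path (p1,q1) | y != (p1,q1).1]) _ (allss _)).
      2: apply/pairwise_filter/pairwise_left_path.
    move=> x y /(lT _ _ mpq)[rx _ /= h] /(lT _ _ mpq)[ry _ _]; rewrite /ckey rx ry.
    by have := ltn_ord x; lia.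
  rewrite pairwise_map pairwise_rev.
  apply: (sub_in_pairwise (P := mem (max_paths Q false)) _
    (allss _) (pairwise_max_paths false)) => -[p1 q1] [p2 q2] m m' /= le.
  apply/allrelP => x y /(lT _ _ m')[rx /= h _] /(lT _ _ m)[ry _ /= h'].
  by rewrite /ckey rx ry; have := ltn_ord x; lia.
- apply/andP; split.
    apply/allrelP => z x; rewrite inE => /eqP-> /flatten_mapP[[p1 q1]] mpq /(rT _ _ mpq)[rx /= h _].
    by rewrite /ckey n0 (negPf rx) /=; lia.
apply: pairwise_flatten.
  apply/allP => s /mapP[[p1 q1] mpq ->]; apply: (sub_in_pairwise
    (P := mem [seq y <- right_path (p1,q1) | y != (p1,q1).1]) _ (allss _)).
    2: apply/pairwise_filter/pairwise_right_path.
  by move=> x y /(rT _ _ mpq)[rx _ _] /(rT _ _ mpq)[ry _ _]; rewrite /ckey (negPf rx) (negPf ry); lia.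
rewrite pairwise_map; apply: (sub_in_pairwise (P := mem (max_paths Q true)) _
  (allss _) (pairwise_max_paths true)) => -[p1 q1] [p2 q2] m m' /= le.
apply/allrelP => x y /(rT _ _ m)[rx _ /= h] /(rT _ _ m')[ry /= h' _].
by rewrite /ckey (negPf rx) (negPf ry); lia.
Qed.

Lemma prec_rowseq x y : prec (rowseq Q) x y = (rkey x < rkey y)%N.
Proof. exact: index_key (perm_rowseq Q) pairwise_rowseq. Qed.

Lemma prec_colseq x y : prec (colseq Q) x y = (ckey x < ckey y)%N.
Proof. exact: index_key (perm_colseq Q) pairwise_colseq. Qed.

Lemma preceq_rowseq x y : preceq (rowseq Q) x y = (rkey x <= rkey y)%N.
Proof. by rewrite leqNgt -prec_rowseq /preceq leqNgt. Qed.

Lemma preceq_colseq x y : preceq (colseq Q) x y = (ckey x <= ckey y)%N.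
Proof. by rewrite leqNgt -prec_colseq /preceq leqNgt. Qed.

Lemma rkey_inj (x y : 'I_n.+1) : rkey x = rkey y -> x = y.
Proof.
move=> e; have inS z : z \in rowseq Q by rewrite (perm_mem (perm_rowseq Q)) mem_enum.
rewrite -(nth_index x (inS x)) -(nth_index x (inS y)); congr nth; apply/eqP; rewrite eqn_leq.
by rewrite -![(index _ _ <= index _ _)%N]/(preceq _ _ _) !preceq_rowseq e leqnn.
Qed.

Lemma ckey_inj (x y : 'I_n.+1) : ckey x = ckey y -> x = y.
Proof.
move=> e; have inS z : z \in colseq Q by rewrite (perm_mem (perm_colseq Q)) mem_enum.
rewrite -(nth_index x (inS x)) -(nth_index x (inS y)); congr nth; apply/eqP; rewrite eqn_leq.
by rewrite -![(index _ _ <= index _ _)%N]/(preceq _ _ _) !preceq_colseq e leqnn.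
Qed.

End Orders.

Local Open Scope ring_scope.

(** * Operators graded by the vertices *)

Section Graded.
Variables (A : pzRingType) (n : nat) (e : nat -> A).

Implicit Types r s t : nat -> nat -> bool.

(** A complete system of orthogonal idempotents, extended by 0 beyond [n]. *)
Definition graded :=
  [/\ forall i, e i * e i = e i, forall i j, i != j -> e i * e j = 0,
      forall i, (n < i)%N -> e i = 0 & \sum_(i < n.+1) e i = 1].

(** The block of [X] at [i], [j] vanishes unless [r i j]. Triangularity and
    the shape of the quiver become conditions of this kind, which are stable
    under products ([suppM]). *)
Definition supp (X : A) (r : nat -> nat -> bool) :=
  forall i j, (i <= n)%N -> (j <= n)%N -> ~~ r i j -> e i * X * e j = 0.

Hypothesis ge : graded.
Let ee : forall i, e i * e i = e i. Proof. by case: ge. Qed.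
Let eo : forall i j, i != j -> e i * e j = 0. Proof. by case: ge. Qed.
Let en : forall i, (n < i)%N -> e i = 0. Proof. by case: ge. Qed.
Let es : \sum_(i < n.+1) e i = 1. Proof. by case: ge. Qed.

Lemma e_sumr X : X = \sum_(i < n.+1) X * e i.
Proof. by rewrite -mulr_sumr es mulr1. Qed.

Lemma e_suml X : X = \sum_(i < n.+1) e i * X.
Proof. by rewrite -mulr_suml es mul1r. Qed.

Lemma supp_out X r i j : supp X r -> ~~ r i j -> e i * X * e j = 0.
Proof.
move=> sX rij; case: (leqP i n) => [li|/en ->]; last by rewrite !mul0r.
by case: (leqP j n) => [lj|/en ->]; [exact: sX|rewrite mulr0].
Qed.

Lemma graded_eq X Y :
  (forall i j, (i <= n)%N -> (j <= n)%N -> e i * X * e j = e i * Y * e j) -> X = Y.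
Proof.
move=> h; rewrite (e_suml X) (e_suml Y); apply: eq_bigr => i _.
rewrite (e_sumr (_ * X)) (e_sumr (_ * Y)); apply: eq_bigr => j _.
by apply: h; rewrite -ltnS.
Qed.

Lemma supp0 X r : supp X r -> (forall i j, ~~ r i j) -> X = 0.
Proof.
by move=> sX nr; apply: graded_eq => i j _ _; rewrite mulr0 mul0r (supp_out sX).
Qed.

Lemma supp_sub X (r r' : nat -> nat -> bool) : supp X r ->
  (forall i j, (i <= n)%N -> (j <= n)%N -> r i j -> r' i j) -> supp X r'.
Proof. by move=> sX rr' i j li lj nr; apply: sX => //; apply: contra nr; apply: rr'. Qed.

Lemma suppN X r : supp X r -> supp (- X) r.
Proof. by move=> sX i j li lj nr; rewrite mulrN mulNr sX ?oppr0. Qed.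

Lemma suppD X Y r : supp X r -> supp Y r -> supp (X + Y) r.
Proof. by move=> sX sY i j li lj nr; rewrite mulrDr mulrDl sX ?sY ?addr0. Qed.

Lemma supp_diagC X m : supp X eq_op -> e m * X = X * e m.
Proof.
move=> sX; apply: graded_eq => i j li lj.
have -> : e i * (e m * X) * e j = if i == m then e i * X * e j else 0.
  by rewrite !mulrA; case: eqVneq => [->|/eo ->]; rewrite ?ee ?mul0r.
have -> : e i * (X * e m) * e j = if m == j then e i * X * e j else 0.
  by rewrite -!mulrA; case: eqVneq => [->|/eo ->]; rewrite ?ee ?mulr0.
case: (eqVneq i j) => [->|ij]; first by rewrite eq_sym.
by rewrite (supp_out sX) // !if_same.
Qed.

Lemma supp_diagM X Y i : supp X eq_op ->
  e i * (X * Y) * e i = (e i * X * e i) * (e i * Y * e i).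
Proof.
move=> sX; rewrite -!mulrA (mulrA (e i) (e i)) ee (mulrA X (e i)) -(supp_diagC i sX).
by rewrite !mulrA ee.
Qed.

Lemma supp1 r : (forall i, r i i) -> supp 1 r.
Proof.
move=> r1 i j _ _; rewrite mulr1; case: (eqVneq i j) => [->|/eo //].
by rewrite r1.
Qed.

Lemma suppM X Y r s t : supp X r -> supp Y s ->
  (forall i m j, (i <= n)%N -> (m <= n)%N -> (j <= n)%N -> r i m -> s m j -> t i j) ->
  supp (X * Y) t.
Proof.
move=> sX sY rst i j li lj nt.
rewrite {1}(e_sumr X) mulr_suml mulr_sumr mulr_suml big1 // => m _.
have lm : (m <= n)%N by rewrite -ltnS.
rewrite -[e m]ee !mulrA -(mulrA _ _ (e j)) -(mulrA _ _ (Y * _)) mulrA.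
rewrite -!mulrA (mulrA (e m) Y) (mulrA (e i)) (mulrA (e i * X)).
case r1: (r i m); last by rewrite sX ?r1 // mul0r.
case r2: (s m j); last by rewrite sY ?r2 // mulr0.
by rewrite (rst _ _ _ li lm lj r1 r2) in nt.
Qed.

(** A unipotent element has an inverse with the same support: solve
    [Z = 1 - P Z] row by row. *)
Lemma supp_inv (f : nat -> nat) P Z r : (1 + P) * Z = 1 -> supp P r ->
  (forall i j m, r i j -> r j m -> r i m) ->
  (forall i j, (i <= n)%N -> (j <= n)%N -> r i j -> (f j < f i)%N) ->
  supp (Z - 1) r.
Proof.
move=> PZ sP tr r_lt i; have [b] := ubnP (f i); elim: b i => // b IH i fi j li lj nr.
have -> : Z - 1 = - P - P * (Z - 1).
  rewrite mulrBr mulr1 opprB addKr; apply/eqP; rewrite subr_eq addrC -subr_eq opprK.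
  by rewrite -PZ mulrDl mul1r.
rewrite mulrBr mulrBl mulrN mulNr sP // oppr0 sub0r mulrA.
rewrite (e_suml (Z - 1)) mulr_sumr mulr_suml big1 ?oppr0 // => m _.
have lm : (m <= n)%N by rewrite -ltnS.
rewrite -[e m]ee -!mulrA (mulrA P) (mulrA (e i)) !mulrA -(mulrA _ (Z - 1)) -mulrA.
rewrite (mulrA (e m)).
case rim: (r i m); last by rewrite mulrA sP ?rim // !mul0r.
rewrite IH ?mulr0 //; first by have := r_lt _ _ li lm rim; lia.
by apply: contra nr; apply: tr.
Qed.

Variable Q : quiverA n.
Local Notation rt := (rt Q).
Local Notation lt := (lt Q).
Local Notation ri := (ri Q).
Local Notation li := (li Q).

(** The positions of the blocks of right and of left arrows; rows are targets
    and columns are sources. *)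
Definition rarrow (i j : nat) := (i == j.+1) && rt j.
Definition larrow (i j : nat) := (j == i.+1) && lt i.

Lemma rarrow_shift NR m : supp NR rarrow -> NR * e m = e m.+1 * NR.
Proof.
move=> s; apply: graded_eq => i j li lj.
case: (eqVneq j m) => [<-|jm]; last first.
  rewrite -!mulrA eo 1?eq_sym // !mulr0.
  case: (eqVneq i m.+1) => [->|im]; last by rewrite 2!mulrA eo // !mul0r.
  rewrite mulrA ee mulrA (supp_out s) // /rarrow negb_and eqSS eq_sym jm //.
case: (eqVneq i j.+1) => [->|ij]; last first.
  rewrite !mulrA (eo ij) !mul0r -mulrA ee (supp_out s) //.
  by rewrite /rarrow (negPf ij).
by rewrite -!mulrA ee !mulrA ee.
Qed.

Lemma larrow_shift NL m : supp NL larrow -> NL * e m.+1 = e m * NL.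
Proof.
move=> s; apply: graded_eq => i j li lj.
case: (eqVneq i m) => [<-|im]; last first.
  rewrite !mulrA (eo im) !mul0r.
  case: (eqVneq j m.+1) => [->|jm]; last by rewrite -!mulrA eo 1?eq_sym // !mulr0.
  by rewrite -!mulrA ee mulrA (supp_out s) // /larrow eqSS eq_sym (negPf im).
case: (eqVneq j i.+1) => [->|ij]; last first.
  rewrite -!mulrA eo 1?eq_sym // !mulr0 mulrA ee mulrA (supp_out s) //.
  by rewrite /larrow (negPf ij).
by rewrite -!mulrA ee !mulrA ee.
Qed.

Lemma rarrow_0 NR : supp NR rarrow -> e 0 * NR = 0.
Proof.
move=> s; apply: graded_eq => i j li lj; rewrite mulr0 mul0r.
case: (eqVneq i 0%N) => [->|i0]; last by rewrite mulrA eo // !mul0r.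
by rewrite mulrA ee (supp_out s).
Qed.

Lemma larrow_0 NL : supp NL larrow -> NL * e 0 = 0.
Proof.
move=> s; apply: graded_eq => i j li lj; rewrite mulr0 mul0r.
case: (eqVneq 0%N j) => [<-|i0]; last by rewrite -!mulrA eo // !mulr0.
by rewrite -!mulrA ee mulrA (supp_out s).
Qed.

Lemma rarrow_e NR m : supp NR rarrow -> ~~ rt m -> NR * e m = 0.
Proof.
move=> s nrt; apply: graded_eq => i j li lj; rewrite mulr0 mul0r.
case: (eqVneq m j) => [<-|i0]; last by rewrite -!mulrA eo // !mulr0.
by rewrite -!mulrA ee mulrA (supp_out s) // /rarrow (negPf nrt) andbF.
Qed.

Lemma larrow_e NL m : supp NL larrow -> ~~ lt m -> e m * NL = 0.
Proof.
move=> s nlt; apply: graded_eq => i j li lj; rewrite mulr0 mul0r.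
case: (eqVneq i m) => [->|i0]; last by rewrite mulrA eo // !mul0r.
by rewrite mulrA ee (supp_out s) // /larrow (negPf nlt) andbF.
Qed.

Lemma rarrowM_larrow NR NL : supp NR rarrow -> supp NL larrow -> NR * NL = 0.
Proof.
move=> sR sL; rewrite (e_suml NL) mulr_sumr big1 // => i _; rewrite mulrA.
have [l|l] := boolP (lt i); last by rewrite -mulrA (larrow_e sL) ?mulr0.
by rewrite (rarrow_e sR) ?mul0r //; move: l; rewrite /lt /rt; case: orient; rewrite ?andbF.
Qed.

Lemma larrowM_rarrow NR NL : supp NR rarrow -> supp NL larrow -> NL * NR = 0.
Proof.
move=> sR sL; rewrite (e_suml NR) mulr_sumr big1 // => i _; rewrite mulrA.
case: i => [[|i] /= _]; first by rewrite (larrow_0 sL) mul0r.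
have [l|l] := boolP (lt i); last by rewrite (larrow_shift i sL) (larrow_e sL) ?mul0r.
rewrite -mulrA -(rarrow_shift i sR) (rarrow_e sR) ?mulr0 //.
by move: l; rewrite /lt /rt; case: orient; rewrite ?andbF.
Qed.

Lemma rt_n : rt n = false. Proof. by rewrite /rt ltnn. Qed.
Lemma lt_n : lt n = false. Proof. by rewrite /lt ltnn. Qed.
Lemma lt_rt x : (x < n)%N -> lt x = ~~ rt x.
Proof. by rewrite /lt /rt => ->. Qed.
Lemma rtW x : rt x -> (x < n)%N. Proof. by case/andP. Qed.
Lemma ltW x : lt x -> (x < n)%N. Proof. by case/andP. Qed.
Lemma lt_nrt x : lt x -> ~~ rt x.
Proof. by move=> h; rewrite -lt_rt // ltW. Qed.
Lemma rt_nlt x : rt x -> ~~ lt x.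
Proof. by move=> h; rewrite lt_rt ?negbK // rtW. Qed.

Definition upper (key : nat -> nat) := fun i j => (key i <= key j)%N.

Section Intertwiner.
Variables (NR NL NR' NL' Y p h : A).
Hypotheses (sNR : supp NR rarrow) (sNL : supp NL larrow).
Hypotheses (sNR' : supp NR' rarrow) (sNL' : supp NL' larrow).
Hypotheses (Yp : (1 + NL') * Y * (1 - NR) = p) (Yh : (1 - NR') * Y * (1 + NL) = h).
Hypotheses (sp : supp p (upper (rkey Q))) (sh : supp h (upper (ckey Q))).

(** Downward induction on [i]: [p] vanishes there, and the factor [1 + NL']
    only adds the next row. *)
Lemma intertwiner_rt_col x i : rt x -> (x < i)%N -> e i * Y * (1 - NR) * e x = 0.
Proof.
move=> rx; have [m] := ubnP (n.+1 - i); elim: m i => // m IH i lem xi.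
case: (leqP i n) => [lin|/en ->]; last by rewrite !mul0r.
have : e i * p * e x = 0.
  rewrite (supp_out sp) // /upper -ltnNge /rkey rx.
  by case: ifP => // _; have := rtW rx; lia.
have := IH i.+1; rewrite -Yp -!mulrA [(1 + NL') * _]mulrDl mul1r mulrDr.
rewrite [e i * (NL' * _)]mulrA -(larrow_shift i sNL') -!mulrA => ->; last 2 first.
- lia.
- lia.
by rewrite mulr0 addr0.
Qed.

Lemma intertwiner_lt_row x j : lt x -> (x < j)%N -> e x * (1 + NL') * Y * e j = 0.
Proof.
move=> lx; have [m] := ubnP (n.+1 - j); elim: m j => // m IH j lem xj.
case: (leqP j n) => [ljn|/en ->]; last by rewrite mulr0.
have : e x * p * e j = 0.
  rewrite (supp_out sp) // /upper -ltnNge /rkey (negPf (lt_nrt lx)).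
  by case: ifP => [/rtW|] // _; have := ltW lx; lia.
have := IH j.+1; rewrite -Yp !mulrA mulrBr mulr1 mulrBl.
rewrite -[_ * NR * e j]mulrA (rarrow_shift j sNR) mulrA => ->; last 2 first.
- lia.
- lia.
by rewrite mul0r subr0.
Qed.

Lemma intertwiner_lt_col x i : lt x -> (i <= x)%N -> e i * Y * (1 + NL) * e x.+1 = 0.
Proof.
move=> lx; elim: i => [|i IH] ix.
  have : e 0 * h * e x.+1 = 0.
    rewrite (supp_out sh) // /upper -ltnNge /ckey /li /=.
    by move: lx => /andP[xn ->]; lia.
  rewrite -Yh -!mulrA [(1 - NR') * _]mulrBl mul1r mulrBr.
  by rewrite [e 0 * (NR' * _)]mulrA (rarrow_0 sNR') mul0r subr0.
have : e i.+1 * h * e x.+1 = 0.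
  rewrite (supp_out sh) // /upper -ltnNge /ckey.
  have -> : li x.+1 by case/andP: lx => _; rewrite /li.
  by have := ltW lx; case: ifP => _; lia.
rewrite -Yh -!mulrA [(1 - NR') * _]mulrBl mul1r mulrBr.
rewrite [e i.+1 * (NR' * _)]mulrA -(rarrow_shift i sNR') -!mulrA.
by move: IH; rewrite -!mulrA => -> //; [rewrite mulr0 subr0|lia].
Qed.

Lemma intertwiner_rt_row x j : rt x -> (j <= x)%N -> e x.+1 * (1 - NR') * Y * e j = 0.
Proof.
move=> rx; elim: j => [|j IH] jx.
  have : e x.+1 * h * e 0 = 0.
    rewrite (supp_out sh) // /upper -ltnNge /ckey /li /=.
    by move: rx => /andP[xn ->] /=; lia.
  rewrite -Yh !mulrA mulrDr mulr1 mulrDl.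
  by rewrite -[_ * NL * e 0]mulrA (larrow_0 sNL) mulr0 addr0.
have : e x.+1 * h * e j.+1 = 0.
  rewrite (supp_out sh) // /upper -ltnNge /ckey.
  have -> : li x.+1 = false by case/andP: rx => _; rewrite /li /= => ->.
  by have := rtW rx; case: ifP => _; lia.
rewrite -Yh !mulrA mulrDr mulr1 mulrDl.
rewrite -[_ * NL * e j.+1]mulrA (larrow_shift j sNL) mulrA IH; last by lia.
by rewrite mul0r addr0.
Qed.

(** Two of the vanishing blocks are next to the diagonal; together they say
    that the diagonal blocks of [Y] commute with the arrow. *)
Lemma intertwiner_rt x : rt x -> NR' * (e x * Y * e x) = (e x.+1 * Y * e x.+1) * NR.
Proof.
move=> rx.
have := intertwiner_rt_row rx (leqnn x).
have := intertwiner_rt_col rx (ltnSn x).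
rewrite mulrBr mulr1 !mulrBl mulrBr mulr1 !mulrBl => /eqP; rewrite subr_eq0 => /eqP h1.
move/eqP; rewrite subr_eq0 h1 -(rarrow_shift x sNR') -!mulrA => /eqP <-.
by rewrite (rarrow_shift x sNR).
Qed.

Lemma intertwiner_lt x : lt x -> NL' * (e x.+1 * Y * e x.+1) = (e x * Y * e x) * NL.
Proof.
move=> lx.
have := intertwiner_lt_row lx (ltnSn x).
have := intertwiner_lt_col lx (leqnn x).
rewrite mulrDr mulr1 !mulrDl mulrDr mulr1 !mulrDl => h1 /eqP.
rewrite -h1 -subr_eq0 opprD addrACA subrr add0r subr_eq0 => /eqP.
rewrite -(larrow_shift x sNL') -!mulrA => ->.
by rewrite (larrow_shift x sNL).
Qed.

End Intertwiner.

Section Composition.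
Variables (NR NL Y1 Y2 : A).
Hypotheses (sNR : supp NR rarrow) (sNL : supp NL larrow).
Hypotheses
  (c_rt : forall x i, rt x -> (x < i)%N -> e i * Y2 * (1 - NR) * e x = 0)
  (c_lt : forall x i, lt x -> (i <= x)%N -> e i * Y2 * (1 + NL) * e x.+1 = 0)
  (r_lt : forall x j, lt x -> (x < j)%N -> e x * (1 + NL) * Y1 * e j = 0)
  (r_rt : forall x j, rt x -> (j <= x)%N -> e x.+1 * (1 - NR) * Y1 * e j = 0).

(** Each vertex [x <> z] is paired with the arrow joining it to its neighbour on
    the side of [z]; the hypotheses make every such pair vanish in the product. *)
Lemma intertwiner_comp z : (z <= n)%N ->
  e z * (Y2 * ((1 - NR) * (1 + NL)) * Y1) * e z = (e z * Y2 * e z) * (e z * Y1 * e z).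
Proof.
move=> zn.
(* The contribution of the arrow between [x] and [x.+1] to
   [(1 - NR) (1 + NL) - 1]. *)
have [E EE] : exists E, forall x, E x = - (NR * e x) + e x * NL by exists (fun x => - (NR * e x) + e x * NL).
have sN : \sum_(0 <= x < n) E x = - NR + NL.
  under eq_bigr do rewrite EE.
  rewrite big_split /= sumrN {2}[NR]e_sumr {2}[NL]e_suml.
  rewrite -!(big_mkord xpredT (fun i => _ * e i)).
  rewrite -(big_mkord xpredT (fun i => e i * _)) !big_nat_recr //=.
  by rewrite (rarrow_e sNR) ?rt_n // (larrow_e sNL) ?lt_n // !addr0.
have eT : (1 - NR) * (1 + NL) = \sum_(0 <= x < z) (e x + E x) + e z
    + \sum_(z <= x < n) (e x.+1 + E x).
  rewrite mulrDr mulr1 mulrBl mul1r (rarrowM_larrow sNR sNL) subr0.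
  rewrite -addrA -sN -es -(big_mkord xpredT e).
  rewrite (@big_cat_nat _ _ _ z) //= ?(leqW zn) // big_nat_recl //.
  rewrite (@big_cat_nat _ _ _ z 0 n) //= !big_split /=.
  rewrite -!addrA; congr (_ + _); rewrite [RHS]addrCA; congr (_ + _).
  by rewrite addrCA.
rewrite eT !(mulrDr, mulrDl) big_nat_cond mulr_sumr mulr_suml mulr_sumr mulr_suml big1.
  rewrite add0r big_nat_cond mulr_sumr mulr_suml mulr_sumr mulr_suml big1.
    by rewrite addr0 !mulrA -[in RHS](mulrA _ (e z) (e z)) ee.
  move=> x /andP[/andP[zx xn] _].
  have [rx|] := boolP (rt x).
    have -> : e x.+1 + E x = e x.+1 * (e x.+1 * (1 - NR)).
      rewrite mulrA ee mulrBr mulr1 EE (larrow_e sNL (rt_nlt rx)) addr0.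
      by rewrite (rarrow_shift x sNR).
    by move: (r_rt rx zx); rewrite -!mulrA => ->; rewrite !mulr0.
  rewrite -lt_rt // => lx.
  have -> : e x.+1 + E x = (1 + NL) * e x.+1 * e x.+1.
    rewrite -mulrA ee mulrDl mul1r EE (rarrow_e sNR (lt_nrt lx)) oppr0 add0r.
    by rewrite (larrow_shift x sNL).
  by move: (c_lt lx zx); rewrite !mulrA => ->; rewrite !mul0r.
move=> x /andP[xz _]; rewrite /= in xz.
have xn : (x < n)%N by lia.
have [rx|] := boolP (rt x).
  have -> : e x + E x = (1 - NR) * e x * e x.
    rewrite -mulrA ee mulrBl mul1r EE (larrow_e sNL (rt_nlt rx)) addr0.
    by [].
  by move: (c_rt rx xz); rewrite !mulrA => ->; rewrite !mul0r.
rewrite -lt_rt // => lx.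
have -> : e x + E x = e x * (e x * (1 + NL)).
  by rewrite mulrA ee mulrDr mulr1 EE (rarrow_e sNR (lt_nrt lx)) oppr0 add0r.
by move: (r_lt lx xz); rewrite -!mulrA => ->; rewrite !mulr0.
Qed.
End Composition.

Section Recognition.

Definition blk (r : nat -> nat -> bool) X : A :=
  \sum_(i < n.+1) \sum_(j < n.+1 | r i j) e i * X * e j.

Lemma blkE r X i j : (i <= n)%N -> (j <= n)%N ->
  e i * blk r X * e j = if r i j then e i * X * e j else 0.
Proof.
move=> li lj; rewrite /blk mulr_sumr mulr_suml.
rewrite (bigD1 (Ordinal (li : (i < n.+1)%N))) //= [X in _ + X]big1 ?addr0 => [|m /eqP mi]; last first.
  have nm : i != m by case: eqVneq => [e'|//]; case: mi; apply: val_inj.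
  rewrite mulr_sumr mulr_suml big1 // => a _.
  by rewrite !mulrA (eo nm) !mul0r.
rewrite mulr_sumr mulr_suml big_mkcond.
rewrite (bigD1 (Ordinal (lj : (j < n.+1)%N))) //= [X in _ + X]big1 ?addr0 => [|m /eqP mj]; last first.
  have nm : (m : nat) != j by case: eqVneq => [e'|//]; case: mj; apply: val_inj.
  by case: ifP => // _; rewrite -!mulrA (eo nm) !mulr0.
case: ifP => // _; by rewrite !mulrA ee -!mulrA ee.
Qed.

Lemma blk_supp r X : supp (blk r X) r.
Proof. by move=> i j li lj nr; rewrite blkE // (negPf nr). Qed.

(** If [j] precedes [i] in both orders, then the segment from [j] to [i]
    leaves [j] and enters [i] by arrows directed from [j] to [i]. *)
Lemma cell_pairs i j : (i <= n)%N -> (j <= n)%N -> i != j ->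
  (rkey Q j < rkey Q i)%N -> (ckey Q j < ckey Q i)%N ->
  [&& (j < i)%N, rt j & ri i] || [&& (i < j)%N, lt i & li j].
Proof.
rewrite /rkey /ckey /rt /lt /ri /li => li lj ij.
case: (ltngtP i j) ij => //= ij _;
  case: (orient Q i); case: (orient Q j); case: (orient Q i.-1); case: (orient Q j.-1);
  rewrite ?andbT ?andbF ?orbF //=; do ?case: ifP => /=; lia.
Qed.

Variables (X B : A).
Hypotheses (XB : X * B = 1) (BX : B * X = 1).
Hypothesis Xdiag : forall i, (i <= n)%N -> e i * X * e i = e i.
Hypothesis Xlow : supp X
  (fun i j => (i == j) || (rkey Q j < rkey Q i)%N && (ckey Q j < ckey Q i)%N).
Hypothesis XL : forall i j, lt i -> li j -> (i.+2 <= j)%N -> e i * X * e j = 0.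
Hypothesis BR : forall i j, rt i -> ri j -> (i.+2 <= j)%N -> e j * B * e i = 0.

(** Off the diagonal, [X] is the sum of a right part [P] and of a left part
    [M], and [P M = M P = 0]; so [X = (1 + P) (1 + M)]. By [XL] the left part
    consists of neighbouring blocks. Since [(1 + P)^-1 = B (1 + M)], [BR] says
    the same of [1 - (1 + P)^-1]. *)
Lemma zeta_recognition : (1 - blk rarrow X) * X = 1 + blk larrow X.
Proof.
set M := blk larrow X; have [P PD] : exists P, P = X - 1 - M by exists (X - 1 - M).
pose Pr i j := [&& (j < i)%N, rt j & ri i].
have lt_li i : lt i -> li i.+1 by case/andP.
have rt_ri i : rt i -> ri i.+1 by case/andP.
have li_ri i : li i -> ~~ ri i by case/andP=> h; rewrite /ri h.
have sM : supp M larrow by exact: blk_supp.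
have sP : supp P Pr.
  move=> i j li lj nP; rewrite PD !(mulrBr, mulrBl) mulr1 blkE //.
  case: (eqVneq i j) => [<-|ij].
    rewrite Xdiag // ee subrr /larrow (_ : (i == i.+1) = false) ?subr0 //.
    by apply/eqP; lia.
  rewrite (eo ij) subr0; case: ifP => [_|nl]; first by rewrite subrr.
  rewrite subr0.
  case c: ((rkey Q j < rkey Q i)%N && (ckey Q j < ckey Q i)%N); last first.
    by rewrite (supp_out Xlow) // (negPf ij) c.
  case/andP: c => c1 c2; have := cell_pairs li lj ij c1 c2.
  rewrite -[X in X || _]/(Pr i j) (negPf nP) /= => /and3P[ij' l1 l2].
  apply: XL => //; rewrite ltn_neqAle ij' andbT; apply/eqP => e'.
  by rewrite /larrow -e' eqxx l1 in nl.
have MP0 : M * P = 0.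
  apply: (supp0 (r := fun _ _ => false)) => //.
  apply: (suppM sM sP) => i m j _ _ _ /andP[/eqP-> l] /and3P[_ _].
  by rewrite (negPf (li_ri _ (lt_li _ l))).
have PM0 : P * M = 0.
  apply: (supp0 (r := fun _ _ => false)) => //.
  apply: (suppM sP sM) => i m j _ _ _ /and3P[_ r _] /andP[_ l].
  by rewrite (negPf (lt_nrt l)) in r.
have PE : 1 + P + M = X by rewrite PD addrA subrK addrC subrK.
have X1 : X = (1 + P) * (1 + M).
  by rewrite mulrDr mulr1 mulrDl mul1r PM0 addr0 PE.
have X2 : X = (1 + M) * (1 + P).
  by rewrite mulrDr mulr1 mulrDl mul1r MP0 addr0 addrAC PE.
(* The inverse of [1 + P]. *)
pose Z := B * (1 + M).
have ZP : Z * (1 + P) = 1 by rewrite /Z -mulrA -X2 BX.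
have ZE : Z = (1 + M) * B.
  have PZ : (1 + P) * ((1 + M) * B) = 1 by rewrite mulrA -X1 XB.
  by have := congr1 (GRing.mul Z) PZ; rewrite mulrA ZP mul1r mulr1 => ->.
have PZ : (1 + P) * Z = 1 by rewrite ZE mulrA -X1 XB.
have sZ : supp (Z - 1) Pr.
  apply: (supp_inv (f := id) PZ sP) => [i j m /and3P[a b c] /and3P[a' b' c']|i j _ _ /and3P[]//].
  by apply/and3P; split=> //; lia.
have Z1 : Z - 1 = - P - P * (Z - 1).
  rewrite mulrBr mulr1 opprB addKr; apply/eqP; rewrite subr_eq addrC -subr_eq opprK.
  by rewrite -PZ mulrDl mul1r.
have ZB : Z - B = M * B by rewrite ZE mulrDl mul1r [B + _]addrC addrK.
have MB : (1 + M) * (1 - M * B) = 1.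
  have MZ : M * (Z - 1) = 0.
    by rewrite Z1 mulrBr mulrN MP0 mulrA MP0 mul0r !oppr0 addr0.
  have {}MZ : M * Z = M by apply/eqP; rewrite -subr_eq0 -[X in _ - X]mulr1 -mulrBr MZ.
  rewrite mulrDl mul1r mulrBr mulr1 mulrA.
  have -> : M * M * B = M - M * B.
    by rewrite -mulrA -[in LHS]ZB mulrBr MZ.
  by rewrite subKr subrK.
have sMB : supp (1 - M * B - 1) (fun i j => (i < j)%N).
  apply: (@supp_inv (fun i => n - i)%N M (1 - M * B) _ MB) => [|i j m|i j]; try lia.
  by apply: (supp_sub sM) => i j _ _ /andP[/eqP-> _].
have ZNR : Z = 1 - blk rarrow X.
  apply: graded_eq => i j li lj; rewrite mulrBr mulrBl blkE // mulr1.
  rewrite -[Z](subrK 1) mulrDr mulrDl mulr1 addrC; congr (_ + _).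
  case: ifP => [/andP[/eqP ij rj]|nr].
    rewrite Z1 mulrBr mulrN mulrBl mulNr.
    rewrite (supp_out (suppM sP sZ (t := fun i j => (j.+1 < i)%N) _)) ?ij ?ltnn //; last first.
      by move=> a b c _ _ _ /and3P[h _ _] /and3P[h' _ _]; lia.
    rewrite subr0 PD !mulrBr !mulrBl mulr1 eo; last by apply/eqP; lia.
    rewrite subr0 /M blkE -?ij // /larrow ij (_ : (j == j.+2) = false) ?subr0 //.
    by apply/eqP; lia.
  case pr: (Pr i j); last by rewrite (supp_out sZ) ?pr ?oppr0.
  case/and3P: pr => ji rj rii; rewrite oppr0.
  have ij : (j.+2 <= i)%N.
    by rewrite ltn_neqAle ji andbT; apply: contraFneq nr => <-; rewrite /rarrow eqxx.
  rewrite -(subrK B Z) addrAC mulrDr mulrDl mulrDr mulrDl BR // addr0.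
  rewrite mulrN mulNr mulr1 eo; last by apply/eqP; lia.
  rewrite subr0 ZB.
  have := sMB i j li lj; rewrite addrAC subrr sub0r mulrN mulNr => h.
  by apply: oppr_inj; rewrite h ?oppr0 // -leqNgt ltnW.
by rewrite -ZNR {1}X1 mulrA ZP mul1r.
Qed.
End Recognition.

Section DiagonalIso.
Variables (NR NL NR' NL' Y Y' p h p' h' : A).
Hypotheses (sNR : supp NR rarrow) (sNL : supp NL larrow).
Hypotheses (sNR' : supp NR' rarrow) (sNL' : supp NL' larrow).
Hypotheses (Yp : (1 + NL') * Y * (1 - NR) = p) (Yh : (1 - NR') * Y * (1 + NL) = h).
Hypotheses (Yp' : (1 + NL) * Y' * (1 - NR') = p') (Yh' : (1 - NR) * Y' * (1 + NL') = h').
Hypotheses (sp : supp p (upper (rkey Q))) (sh : supp h (upper (ckey Q))).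
Hypotheses (sp' : supp p' (upper (rkey Q))) (sh' : supp h' (upper (ckey Q))).
Hypothesis YY : forall z, (z <= n)%N ->
  e z * (Y' * ((1 - NR') * (1 + NL')) * Y) * e z = e z.

Let blkD X : blk (fun i j => i == j) X = \sum_(i < n.+1) e i * X * e i.
Proof.
apply: eq_bigr => i _; rewrite (bigD1 i) //= big1 ?addr0 // => j /andP[/eqP e1 /eqP []].
exact: val_inj.
Qed.

(** The diagonal blocks of [Y] are an isomorphism of representations, whose
    inverse consists of those of [Y']. *)
Lemma diagonal_iso : let f := blk (fun i j => i == j) Y in
  let g := blk (fun i j => i == j) Y' in
  [/\ g * f = 1, NR' * f = f * NR & NL' * f = f * NL].
Proof.
move=> f g; have sf : supp f eq_op by exact: blk_supp.
have sg : supp g eq_op by exact: blk_supp.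
split.
- apply: graded_eq => i j li lj; rewrite mulr1.
  case: (eqVneq i j) => [<-|ij]; last first.
    rewrite eo // (supp_out (r := fun i j => i == j)) //.
    by apply: (suppM sg sf) => a b c _ _ _ /eqP-> /eqP->.
  rewrite (supp_diagM f i sg) !blkE // !eqxx.
  rewrite -(intertwiner_comp sNR' sNL' _ _ _ _ li); first by rewrite ee YY.
  - exact: (intertwiner_rt_col sNL Yp' sp').
  - exact: (intertwiner_lt_col sNR Yh' sh').
  - exact: (intertwiner_lt_row sNR Yp sp).
  - exact: (intertwiner_rt_row sNL Yh sh).
- rewrite /f !blkD mulr_sumr mulr_suml.
  rewrite big_ord_recr [RHS]big_ord_recl /= mulrA mulrA (rarrow_e sNR') ?rt_n // !mul0r addr0.
  rewrite -(mulrA _ (e 0) NR) (rarrow_0 sNR) mulr0 add0r.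
  apply: eq_bigr => m _; rewrite -[bump 0 m]/(m.+1); have [rm|nr] := boolP (rt m).
    by rewrite (intertwiner_rt sNR sNL sNR' sNL' Yp Yh sp sh rm).
  rewrite !mulrA (rarrow_e sNR' nr) !mul0r -mulrA.
  by rewrite -(rarrow_shift m sNR) (rarrow_e sNR nr) mulr0.
- rewrite /f !blkD mulr_sumr mulr_suml.
  rewrite big_ord_recl [RHS]big_ord_recr /= -(mulrA _ (e n)) (larrow_e sNL) ?lt_n // mulr0 addr0.
  rewrite !mulrA (larrow_0 sNL') !mul0r add0r.
  apply: eq_bigr => m _; rewrite -[bump 0 m]/(m.+1); have [lm|nl] := boolP (lt m).
    by have := intertwiner_lt sNR sNL sNR' sNL' Yp Yh sp sh lm; rewrite !mulrA.
  rewrite !mulrA (larrow_shift m sNL') (larrow_e sNL' nl) !mul0r.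
  by rewrite -mulrA (larrow_e sNL nl) mulr0.
Qed.
End DiagonalIso.

End Graded.

(** * Positions, projections and submatrices *)

Section Labels.
Variables (n : nat) (d : 'I_n.+1 -> nat).
Variables (S : seq 'I_n.+1) (SE : perm_eq S (enum 'I_n.+1)).
Local Notation N := (dimtot d).
Local Notation lab := (@label n d S SE).

Lemma label_inj : injective lab.
Proof.
move=> p q; rewrite /label => e.
have uS : uniq S by rewrite (perm_uniq SE) enum_uniq.
set u := cast_ord _ p in e; set u' := cast_ord _ q in e.
have e1 : tagnat.sig1 u = tagnat.sig1 u'.
  apply: val_inj; apply/eqP.
  have := congr1 tag e; rewrite /= !(tnth_nth ord0) /= => /eqP.
  by rewrite nth_uniq.
have : tagnat.sig u = tagnat.sig u'.
  rewrite !tagnat.sigE12; move: (tagnat.sig2 u) (tagnat.sig2 u') e; rewrite -e1 => a b e.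
  have -> // : a = b.
  apply: eqP; have /eqP := e; rewrite -tag_eqE /tag_eq /= eqxx /=.
  by rewrite tagged_asE.
by move=> /tagnat.sig_inj /cast_ord_inj.
Qed.

Lemma label_lt_index (p q : 'I_N) :
  (index (tag (lab p)) S < index (tag (lab q)) S)%N -> (p < q)%N.
Proof.
have uS : uniq S by rewrite (perm_uniq SE) enum_uniq.
rewrite /label /= !(tnth_nth ord0) /= !index_uniq // => lt12.
rewrite ltnNge; apply/negP => le.
have := @tagnat.le_sig1 _ _ (cast_ord (dimtotE d SE) q) (cast_ord (dimtotE d SE) p) le.
by rewrite leEord leqNgt lt12.
Qed.

Lemma label_lt_tagged (p q : 'I_N) : tag (lab p) = tag (lab q) ->
  (p < q)%N = (tagged (lab p) < tagged (lab q))%N.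
Proof.
have uS : uniq S by rewrite (perm_uniq SE) enum_uniq.
move=> e0; have e : tagnat.sig1 (cast_ord (dimtotE d SE) p) =
    tagnat.sig1 (cast_ord (dimtotE d SE) q).
  move: e0; rewrite /label /= !(tnth_nth ord0) /= => /eqP; rewrite nth_uniq //.
  by move=> /eqP/val_inj.
rewrite /label /=; set u := cast_ord _ p in e *; set u' := cast_ord _ q in e *.
rewrite -[(p < q)%N]/(u < u')%N {1}(tagnat.rect u) {1}(tagnat.rect u') /=.
by move: (nat_of_ord (tagnat.sig2 u)) (nat_of_ord (tagnat.sig2 u')) => a b; rewrite e ltn_add2l.
Qed.
End Labels.

Section Positions.
Variables (n : nat) (d : 'I_n.+1 -> nat) (Q : quiverA n).
Local Notation N := (dimtot d).
Local Notation rowlab := (@rowlab n d Q).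
Local Notation collab := (@collab n d Q).
Local Notation rowv := (@rowv n d Q).
Local Notation colv := (@colv n d Q).
Local Notation rowoff := (@rowoff n d Q).
Local Notation coloff := (@coloff n d Q).

Lemma row_lt_key p q : (rkey Q (rowv p) < rkey Q (rowv q))%N -> (p < q)%N.
Proof. by rewrite -prec_rowseq; exact: label_lt_index. Qed.

Lemma col_lt_key p q : (ckey Q (colv p) < ckey Q (colv q))%N -> (p < q)%N.
Proof. by rewrite -prec_colseq; exact: label_lt_index. Qed.

Lemma row_lt_off p q : rowv p = rowv q -> (p < q)%N = (rowoff p < rowoff q)%N.
Proof. exact: label_lt_tagged. Qed.

Lemma col_lt_off p q : colv p = colv q -> (p < q)%N = (coloff p < coloff q)%N.
Proof. exact: label_lt_tagged. Qed.

Lemma rowlab_inj : injective rowlab. Proof. exact: label_inj. Qed.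
Lemma collab_inj : injective collab. Proof. exact: label_inj. Qed.

Lemma card_labels : #|'I_N| = #|{: {x : 'I_n.+1 & 'I_(d x)}}|.
Proof. by rewrite card_ord tagnat.card. Qed.

Lemma collab_bij : bijective collab.
Proof. by apply: inj_card_bij collab_inj _; rewrite card_labels. Qed.

(** The permutation v_Q^-1, which sends a row to the column with the same
    label. *)
Definition row2col (p : 'I_N) : 'I_N :=
  odflt p [pick q | collab q == rowlab p].

Lemma row2colE p : collab (row2col p) = rowlab p.
Proof.
rewrite /row2col; case: pickP => [q /eqP //|no].
by have [f _ K] := collab_bij; have := no (f (rowlab p)); rewrite K eqxx.
Qed.

Lemma eq_label (u v : {x : 'I_n.+1 & 'I_(d x)}) :
  tag u = tag v -> tagged u = tagged v :> nat -> u = v.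
Proof.
by case: u v => x i [y j] /= e; subst y => /val_inj ->.
Qed.

Lemma codomP_surj u : u \in codom collab.
Proof. by have [f _ K] := collab_bij; apply/codomP; exists (f u); rewrite K. Qed.

Lemma row2col_inj : injective row2col.
Proof. by move=> p q e; apply: rowlab_inj; rewrite -!row2colE e. Qed.

Lemma colv_row2col p : colv (row2col p) = rowv p.
Proof. by rewrite /Defs.colv row2colE. Qed.

Lemma coloff_row2col p : coloff (row2col p) = rowoff p.
Proof. by rewrite /Defs.coloff row2colE. Qed.

Lemma eq_row2col p q :
  (q == row2col p) = (rowv p == colv q) && (rowoff p == coloff q).
Proof.
apply/eqP/andP => [->|[/eqP e1 /eqP e2]].
  by rewrite colv_row2col coloff_row2col !eqxx.
by apply: collab_inj; rewrite row2colE; apply: eq_label.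
Qed.

Definition colpos (x : 'I_n.+1) (i : 'I_(d x)) : 'I_N :=
  iinv (codomP_surj (Tagged (fun x => 'I_(d x)) i)).

Lemma colposE x (i : 'I_(d x)) : collab (colpos i) = Tagged (fun x => 'I_(d x)) i.
Proof. exact: f_iinv. Qed.

Lemma colv_colpos x (i : 'I_(d x)) : colv (colpos i) = x.
Proof. by rewrite /Defs.colv colposE. Qed.

Lemma colpos_label q : colpos (tagged (collab q)) = q.
Proof. by apply: collab_inj; rewrite colposE; case: (collab q). Qed.

End Positions.

Section Projections.
Variables (R : comNzRingType) (n N : nat).
Implicit Types (c : 'I_N -> 'I_n.+1) (X Y : pred nat).

(** Projection onto the coordinates whose vertex lies in [X]. *)
Definition pr c X : 'M[R]_N := diag_mx (\row_p (X (c p))%:R).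

Lemma prE c X p q : pr c X p q = ((p == q) && X (c p))%:R.
Proof. by rewrite !mxE; case: (p == q); rewrite ?mulr1n ?mulr0n. Qed.

Lemma mul_prE c X (A : 'M_N) p q : (pr c X *m A) p q = (X (c p))%:R * A p q.
Proof. by rewrite mul_diag_mx !mxE. Qed.

Lemma mulmx_prE c X (A : 'M_N) p q : (A *m pr c X) p q = A p q * (X (c q))%:R.
Proof. by rewrite mul_mx_diag !mxE. Qed.

Lemma prM c X Y : pr c X *m pr c Y = pr c (fun m => X m && Y m).
Proof.
by apply/matrixP => p q; rewrite mul_prE !prE; case: (X _); case: (p == q);
  rewrite ?mul1r ?mul0r ?andbF.
Qed.

Lemma pr_id c X : pr c X *m pr c X = pr c X.
Proof. by rewrite prM; congr diag_mx; apply/rowP => p; rewrite !mxE andbb. Qed.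

Lemma eq_pr c X Y : (forall m, (m <= n)%N -> X m = Y m) -> pr c X = pr c Y.
Proof. by move=> e; apply/matrixP => p q; rewrite !prE e // -ltnS. Qed.

Lemma pr0 c X : (forall m, (m <= n)%N -> X m = false) -> pr c X = 0.
Proof. by move=> e; apply/matrixP => p q; rewrite prE e ?andbF ?mxE // -ltnS. Qed.

Lemma prC c X : 1%:M - pr c X = pr c (fun m => ~~ X m).
Proof.
apply/matrixP => p q; rewrite mxE [X in _ + X]mxE !prE mxE.
by case: (p == q); case: (X _); rewrite ?subrr ?subr0.
Qed.

Lemma tr_pr c X : (pr c X)^T = pr c X.
Proof. by rewrite tr_diag_mx. Qed.

Definition ev c (m : nat) : 'M[R]_N := pr c (eq_op^~ m).

Lemma graded_ev c : graded n (ev c : nat -> 'M[R]_N).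
Proof.
split.
- by move=> i; exact: pr_id.
- move=> i j ij; rewrite [LHS]prM pr0 // => m _.
  by case: eqP => // ->; rewrite (negPf ij).
- by move=> i ni; rewrite /ev pr0 // => m mn; apply/eqP; lia.
apply/matrixP => p q; rewrite summxE.
rewrite (bigD1 (c p)) //= prE eqxx andbT big1 ?addr0 => [|m /eqP nm]; first by rewrite mxE.
by rewrite prE; case: eqP => //= _; case: eqP => // /val_inj e; case: nm.
Qed.

Lemma supp_evP c (A : 'M_N) (r : nat -> nat -> bool) :
  (forall p q, ~~ r (c p) (c q) -> A p q = 0) <-> supp n (ev c) A r.
Proof.
split=> [h i j li lj nr|h p q nr].
  apply/matrixP => p q; rewrite mulmx_prE mul_prE mxE.
  case: eqP => [e1|_]; last by rewrite !mul0r.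
  case: eqP => [e2|_]; last by rewrite mulr0.
  by rewrite h ?mulr0 ?mul0r // e1 e2.
have := h (c p) (c q) (leq_ord (c p)) (leq_ord (c q)) nr => /matrixP/(_ p q).
by rewrite mulmx_prE mul_prE !eqxx mxE mul1r mulr1.
Qed.

Lemma supp_entry c (A : 'M_N) (r : nat -> nat -> bool) p q :
  supp n (ev c) A r -> ~~ r (c p) (c q) -> A p q = 0.
Proof. by move=> /supp_evP; exact. Qed.

End Projections.

Section Submatrices.
Variables (k : fieldType) (N : nat).

Definition ind (P : pred 'I_N) : 'M[k]_N := diag_mx (\row_p (P p)%:R).

(** The selection of the rows [f], by which submatrices become products. *)
Definition sel a (f : 'I_a -> 'I_N) : 'M[k]_(a, N) := \matrix_(i, j) (f i == j)%:R.

Lemma mul_selE a (f : 'I_a -> 'I_N) b (A : 'M_(N, b)) i j :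
  (sel f *m A) i j = A (f i) j.
Proof.
rewrite mxE (bigD1 (f i)) //= mxE eqxx mul1r big1 ?addr0 // => m /negPf nm.
by rewrite mxE eq_sym nm mul0r.
Qed.

Lemma mul_sel_tr a (f : 'I_a -> 'I_N) : injective f -> sel f *m (sel f)^T = 1%:M.
Proof.
by move=> fI; apply/matrixP => i j; rewrite mul_selE !mxE (inj_eq fI) eq_sym.
Qed.

Lemma tr_sel_mul a (f : 'I_a -> 'I_N) : injective f ->
  (sel f)^T *m sel f = ind [pred p | p \in codom f].
Proof.
move=> fI; apply/matrixP => p q; rewrite !mxE /=.
case: codomP => [[i ->]|no]; last first.
  rewrite mul0rn big1 // => i _; rewrite !mxE; case: eqP => [e|]; last by rewrite mul0r.
  by case: no; exists i.
rewrite (bigD1 i) //= !mxE eqxx mul1r big1 ?addr0 // => m nm.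
by rewrite !mxE (inj_eq fI) (negPf nm) mul0r.
Qed.

Lemma mxsub_sel a b (f : 'I_a -> 'I_N) (g : 'I_b -> 'I_N) (A : 'M[k]_N) :
  mxsub f g A = sel f *m A *m (sel g)^T.
Proof.
apply/matrixP => i j; rewrite -mulmxA mul_selE !mxE (bigD1 (g j)) //= big1 ?addr0.
  by rewrite !mxE eqxx mulr1.
by move=> m /negPf nm; rewrite !mxE eq_sym nm mulr0.
Qed.

Lemma rank_mxsub a b (f : 'I_a -> 'I_N) (g : 'I_b -> 'I_N) (A : 'M[k]_N) :
  injective f -> injective g ->
  \rank (mxsub f g A) =
  \rank (ind [pred p | p \in codom f] *m A *m ind [pred p | p \in codom g]).
Proof.
move=> fI gI; rewrite -!tr_sel_mul // mxsub_sel.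
have free c (h : 'I_c -> 'I_N) : injective h -> row_free (sel h).
  by move=> hI; apply/row_freeP; exists (sel h)^T; exact: mul_sel_tr.
rewrite !mulmxA (mxrankMfree _ (free _ _ gI)) -!mulmxA -[in RHS]mxrank_tr trmx_mul trmxK.
by rewrite (mxrankMfree _ (free _ _ fI)) mxrank_tr.
Qed.

Lemma eq_ind (P P' : pred 'I_N) : P =1 P' -> ind P = ind P'.
Proof. by move=> e; congr diag_mx; apply/rowP => p; rewrite !mxE e. Qed.

Lemma rank_ind (P : pred 'I_N) : \rank (ind P) = #|P|.
Proof.
have eI : injective (fun i : 'I_#|P| => enum_val i) by exact: enum_val_inj.
have -> : ind P = ind [pred p | p \in codom (fun i : 'I_#|P| => enum_val i)].
  apply: eq_ind => p /=; apply/idP/codomP => [Pp|[i ->]]; last exact: enum_valP.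
  by exists (enum_rank_in Pp p); rewrite enum_rankK_in.
rewrite -tr_sel_mul // mxrankMfree ?mxrank_tr.
  by apply/eqP; apply/row_freeP; exists (sel (fun i : 'I_#|P| => enum_val i))^T; exact: mul_sel_tr.
by apply/row_freeP; exists (sel (fun i : 'I_#|P| => enum_val i))^T; exact: mul_sel_tr.
Qed.

Lemma pr_ind n (c : 'I_N -> 'I_n.+1) (X : pred nat) : pr k c X = ind (fun p => X (c p)).
Proof. by []. Qed.

End Submatrices.

(** * The operators of a representation *)

(** The matrix of v_Q, over any ring: multiplication by it on the left relabels the
    rows, from [S_Q] to [S'_Q]. *)
Local Notation rowperm_mx R Q d :=
  (blocked Q (fun x y => if x == y then pid_mx (d x) else 0) : 'M[R]_(dimtot d)).

Section BlockOperators.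
Variables (R : comNzRingType) (n : nat) (d : 'I_n.+1 -> nat) (Q : quiverA n).
Local Notation N := (dimtot d).
Local Notation collab := (@collab n d Q).
Local Notation rowv := (@rowv n d Q).
Local Notation colv := (@colv n d Q).
Local Notation row2col := (@row2col n d Q).

(** The operator with given blocks. Its rows and its columns carry the same
    labels, those of the columns of a blocked matrix, so that such operators
    can be multiplied. *)
Definition opm (F : forall x y, 'M[R]_(d x, d y)) : 'M[R]_N :=
  \matrix_(p, q) F (colv p) (colv q) (tagged (collab p)) (tagged (collab q)).

Definition opblk (A : 'M[R]_N) x y : 'M[R]_(d x, d y) :=
  \matrix_(i, j) A (colpos Q i) (colpos Q j).

Lemma opblkK A : opm (opblk A) = A.
Proof. by apply/matrixP => p q; rewrite !mxE !colpos_label. Qed.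

Lemma opmE F x y (i : 'I_(d x)) (j : 'I_(d y)) :
  opm F (colpos Q i) (colpos Q j) = F x y i j.
Proof. by rewrite mxE /Defs.colv; do 2!rewrite colposE. Qed.

Lemma opmK F x y : opblk (opm F) x y = F x y.
Proof. by apply/matrixP => i j; rewrite mxE opmE. Qed.

Lemma sum_collab (F : {x : 'I_n.+1 & 'I_(d x)} -> R) :
  \sum_q F (collab q) = \sum_z \sum_(i : 'I_(d z)) F (Tagged (fun x => 'I_(d x)) i).
Proof.
rewrite (sig_big_dep xpredT (fun=> xpredT) (fun z i => F (Tagged (fun x => 'I_(d x)) i))) /=.
have [f K1 K2] := collab_bij d Q.
rewrite (reindex f) /=; last by exists collab => u _; [exact: K2|exact: K1].
by apply: eq_bigr => u _; rewrite K2; case: u.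
Qed.

Lemma opm_mul F G : opm F *m opm G = opm (fun x y => \sum_z F x z *m G z y).
Proof.
apply/matrixP => p q; rewrite mxE [RHS]mxE summxE.
pose H (u : {x : 'I_n.+1 & 'I_(d x)}) :=
  F (colv p) (tag u) (tagged (collab p)) (tagged u) *
  G (tag u) (colv q) (tagged u) (tagged (collab q)).
rewrite (eq_bigr (fun r => H (collab r))); last by move=> r _; rewrite !mxE.
by rewrite sum_collab; apply: eq_bigr => z _; rewrite mxE.
Qed.

Lemma opm1 : opm (fun x y => if x == y then pid_mx (d x) else 0) = 1%:M.
Proof.
apply/matrixP => p q; rewrite mxE [RHS]mxE -(inj_eq (@collab_inj n d Q)).
case: eqP => [e|ne]; last first.
  by rewrite mxE; case: eqP => // e; case: ne; rewrite /Defs.colv e.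
rewrite mxE ltn_ord andbT; congr (_%:R : R); congr nat_of_bool.
apply/eqP/eqP => e'; first exact: eq_label.
have := congr1 (fun u : {x : 'I_n.+1 & 'I_(d x)} => nat_of_ord (tagged u)) e'; by [].
Qed.

Local Notation v := (rowperm_mx R Q d).

Lemma vE p q : v p q = (q == row2col p)%:R.
Proof.
rewrite mxE eq_row2col; case: eqP => //= [e|_]; last by rewrite mxE.
by rewrite mxE ltn_ord andbT.
Qed.

Lemma mul_vE m (A : 'M_(N, m)) p q : (v *m A) p q = A (row2col p) q.
Proof.
rewrite mxE (bigD1 (row2col p)) //= vE eqxx mul1r big1 ?addr0 // => m' /negPf nm.
by rewrite vE nm mul0r.
Qed.

Lemma blocked_opm F : blocked Q F = v *m opm F.
Proof.
apply/matrixP => p q; rewrite mul_vE !mxE /Defs.colv; by rewrite row2colE.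
Qed.

Lemma v_tr : v *m v^T = 1%:M.
Proof.
apply/matrixP => p q; rewrite mul_vE mxE vE mxE (inj_eq (@row2col_inj n d Q)).
by [].
Qed.

Lemma v_pr X : v *m pr R colv X = pr R rowv X *m v.
Proof.
apply/matrixP => p q; rewrite mulmx_prE mul_prE vE.
by case: eqP => [->|]; rewrite ?mul0r ?mulr0 // mul1r mulr1 colv_row2col.
Qed.

End BlockOperators.

Section ArrowOperators.
Variables (R : comNzRingType) (n : nat) (d : 'I_n.+1 -> nat) (Q : quiverA n).
Variable V : rep Q d R.
Local Notation N := (dimtot d).
Local Notation collab := (@collab n d Q).
Local Notation colv := (@colv n d Q).
Local Notation ev := (ev R colv).

Definition rightop : 'M[R]_N :=
  opm Q (fun x y => if x == y.+1 :> nat then arrow_mx V x y else 0).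
Definition leftop : 'M[R]_N :=
  opm Q (fun x y => if y == x.+1 :> nat then arrow_mx V x y else 0).

Lemma arrow_mx0 x y : ~~ arrow Q y x -> arrow_mx V x y = 0.
Proof.
move=> na; rewrite /arrow_mx big_pred0 // => i; apply/negP => h.
by case/negP: na; apply/existsP; exists i.
Qed.

Lemma arrow_adj y x : arrow Q y x ->
  (x == y.+1 :> nat) && rt Q y || (y == x.+1 :> nat) && lt Q x.
Proof.
case/existsP => i /andP[/eqP<- /eqP<-]; rewrite /src /tgt /rt /lt.
by case qi: (Q i); rewrite /= orientE qi ltn_ord ?andbT ?orbT // eqxx ?orbT.
Qed.

Lemma supp_rightop : supp n ev rightop (rarrow Q).
Proof.
apply/supp_evP => p q; rewrite mxE /rarrow.
case: eqP => [e /= nr|_ _]; last by rewrite mxE.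
rewrite arrow_mx0 ?mxE //; apply: contra nr => /arrow_adj.
by case/orP => /andP[/eqP e' //]; lia.
Qed.

Lemma supp_leftop : supp n ev leftop (larrow Q).
Proof.
apply/supp_evP => p q; rewrite mxE /larrow.
case: eqP => [e /= nr|_ _]; last by rewrite mxE.
rewrite arrow_mx0 ?mxE //; apply: contra nr => /arrow_adj.
by case/orP => /andP[/eqP e' //]; lia.
Qed.

Lemma arrow_opE : opm Q (arrow_mx V) = rightop + leftop.
Proof.
apply/matrixP => p q; rewrite !mxE.
case: eqP => [e|ne]; case: eqP => [e'|ne']; rewrite ?mxE ?addr0 ?add0r //; first lia.
rewrite arrow_mx0 ?mxE //; apply/negP => /arrow_adj.
by case/orP => /andP[/eqP].
Qed.

Lemma walk_op m : opm Q (walk_mx V m) = (rightop + leftop) ^+ m :> 'M[R]_N.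
Proof.
elim: m => [|m IH]; first exact: opm1.
by rewrite exprS -IH -arrow_opE [RHS]opm_mul.
Qed.

Let ge := graded_ev R colv.

(** A directed path in type A does not turn. *)
Lemma walk_op_split m :
  (rightop + leftop) ^+ m.+1 = rightop ^+ m.+1 + leftop ^+ m.+1 :> 'M[R]_N.
Proof.
elim: m => [|m IH]; first by rewrite !expr1.
rewrite exprS IH mulrDl !mulrDr -!exprS [leftop ^+ _]exprS [rightop ^+ m.+1]exprS.
rewrite mulrA (rarrowM_larrow ge supp_rightop supp_leftop) mul0r addr0.
by rewrite mulrA (larrowM_rarrow ge supp_rightop supp_leftop) mul0r add0r.
Qed.

Lemma supp_rightop_exp m : supp n ev (rightop ^+ m) (fun i j => i == j + m)%N.
Proof.
elim: m => [|m IH]; first by apply: (supp1 ge) => i; rewrite addn0.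
rewrite exprSr; apply: (suppM ge IH supp_rightop) => i a j _ _ _ /eqP-> /andP[/eqP-> _].
by rewrite addSnnS.
Qed.

Lemma supp_leftop_exp m : supp n ev (leftop ^+ m) (fun i j => j == i + m)%N.
Proof.
elim: m => [|m IH]; first by apply: (supp1 ge) => i; rewrite addn0.
rewrite exprSr; apply: (suppM ge IH supp_leftop) => i a j _ _ _ /eqP-> /andP[/eqP-> _].
by rewrite addnS.
Qed.

Lemma walk_dpath m x y : ~~ dpath Q y x -> walk_mx V m x y = 0.
Proof.
elim: m x => [|m IH] x /= np.
  by case: eqP => // e; case/negP: np; rewrite e; exact: connect0.
rewrite big1 // => z _; have [yz|/IH ->] := boolP (dpath Q y z); last by rewrite mulmx0.
rewrite arrow_mx0 ?mul0mx //; apply: contra np => zx.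
exact: connect_trans yz (connect1 zx).
Qed.

(** Zeta takes all paths of right arrows, but of left arrows only the paths of
    length at most one. *)
Lemma zeta_opm : opm Q (zeta_block V) =
  1 + leftop + \sum_(m < n) rightop ^+ m.+1 :> 'M[R]_N.
Proof.
apply/matrixP => p q; set x := colv p; set y := colv q.
have pw m : (rightop ^+ m.+1 : 'M_N) p q = if x == (y + m.+1)%N :> nat then walk_mx V m.+1 x y (tagged (collab p)) (tagged (collab q)) else 0.
  case: ifP => [/eqP e|ne]; last first.
    by apply: (supp_entry (@supp_rightop_exp m.+1)); rewrite -/x -/y ne.
  transitivity (opm Q (walk_mx V m.+1) p q); last by rewrite mxE.
  rewrite walk_op walk_op_split [RHS]mxE.
  rewrite (supp_entry (@supp_leftop_exp m.+1)) ?addr0 //.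
  by rewrite -/x -/y e; apply/eqP; lia.
rewrite mxE [RHS]mxE [X in _ = X + _]mxE summxE -/x -/y /zeta_block.
rewrite (eq_bigr _ (fun (m : 'I_n) _ => pw m)).
rewrite [leftop p q]mxE -/x -/y.
case: eqP => [e|nxy].
  have en : x = y :> nat by rewrite e.
  rewrite [X in _ + X]big1 => [|m _]; last by rewrite ifF //; apply/eqP; lia.
  rewrite ifF; last by apply/eqP; lia.
  rewrite [X in _ + X + _]mxE !addr0 -(opm1 R d Q : _ = 1) [RHS]mxE -/x -/y; case: eqP => // ne.
rewrite [X in X + _ + _](_ : _ = 0) ?add0r; last first.
  by rewrite mxE; case: eqP => // e; case: nxy; rewrite /x /y e.
have nxy' : x <> y :> nat by move=> /val_inj.
have [ltxy|leyx] := ltnP x y.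
  rewrite [X in _ + X]big1 => [|m _]; last by rewrite ifF //; apply/eqP; lia.
  rewrite addr0; case: eqP => [e|ne].
    have [//|nd] := boolP (dpath Q y x); rewrite mxE /=.
    rewrite arrow_mx0 ?mxE //; apply: contra nd; exact: connect1.
  by rewrite (_ : (x.+1 < y)%N = true) ?if_same ?mxE //; lia.
have yx : (y < x)%N by rewrite ltn_neqAle leyx andbT; apply/eqP => /esym/nxy'.
have e1 : (y == x.+1 :> nat) = false by apply/eqP; lia.
have e2 : (x.+1 < y)%N = false by lia.
rewrite e1 e2.
have lt : (x - y.+1 < n)%N by have := ltn_ord x; lia.
rewrite (bigD1 (Ordinal lt)) // [X in _ + (_ + X)]big1 => [|m /eqP nm]; last first.
  rewrite ifF //; apply/eqP => e; case: nm; apply: val_inj; rewrite -[val (Ordinal _)]/(x - y.+1)%N -[val m]/(nat_of_ord m); lia.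
have vo : nat_of_ord (Ordinal lt) = (x - y.+1)%N by [].
have ex : nat_of_ord x = (y + (x - y.+1).+1)%N by lia.
rewrite vo [X in _ = _ + (X + _)]ifT; last by apply/eqP; exact: ex.
have -> : path_mx V x y = walk_mx V (x - y.+1).+1 x y.
  have e3 : ((x - y) + (y - x))%N = (x - y.+1).+1 by lia.
  by rewrite /path_mx e3.
rewrite [X in X + _]mxE addr0 add0r; have [//|nd] := boolP (dpath Q y x).
by rewrite walk_dpath //= ?mxE.
Qed.

Lemma rightop_nil : rightop ^+ n.+1 = 0 :> 'M[R]_N.
Proof.
apply/matrixP => p q; rewrite (supp_entry (@supp_rightop_exp n.+1)) ?mxE //.
by apply/eqP; have := ltn_ord (colv p); lia.
Qed.

Lemma leftop_nil : leftop ^+ n.+1 = 0 :> 'M[R]_N.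
Proof.
apply/matrixP => p q; rewrite (supp_entry (@supp_leftop_exp n.+1)) ?mxE //.
by apply/eqP; have := ltn_ord (colv q); lia.
Qed.

(** The inverses of [1 - rightop] and [1 + leftop]: geometric series, as both
    arrow operators are nilpotent. *)
Definition right_sum : 'M[R]_N := \sum_(m < n.+1) rightop ^+ m.
Definition left_sum : 'M[R]_N := \sum_(m < n.+1) (- leftop) ^+ m.

Lemma nil_sumK (x : 'M[R]_N) m : x ^+ m = 0 -> (1 - x) * \sum_(i < m) x ^+ i = 1.
Proof. by move=> x0; rewrite -opprB mulNr -subrX1 x0 sub0r opprK. Qed.

Lemma right_sumK : (1 - rightop) * right_sum = 1.
Proof. exact: nil_sumK rightop_nil. Qed.

Lemma left_sumK : (1 + leftop) * left_sum = 1.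
Proof. by rewrite -[leftop]opprK nil_sumK // exprNn leftop_nil mulr0. Qed.

(** A right arrow cannot follow a left one, so that
    [right_sum * leftop = leftop]. *)
Lemma zeta_opmE : opm Q (zeta_block V) = right_sum * (1 + leftop).
Proof.
rewrite mulrDr mulr1 zeta_opm /right_sum [in RHS]big_ord_recl expr0 mulrDl mul1r.
rewrite mulr_suml [X in _ = _ + (_ + X)]big1 ?addr0 1?addrAC // => m _.
by rewrite exprSr -mulrA (rarrowM_larrow ge supp_rightop supp_leftop) mulr0.
Qed.
End ArrowOperators.

(** * Orbits and double cosets *)

Lemma supp_sum (A : pzRingType) n (e : nat -> A) (I : finType) (F : I -> A) (r : nat -> nat -> bool) :
  (forall i, supp n e (F i) r) -> supp n e (\sum_i F i) r.
Proof.
by move=> sF i j li lj nr; rewrite mulr_sumr mulr_suml big1 // => a _; rewrite sF.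
Qed.

Section Orbits.
Variables (k : closedFieldType) (n : nat) (d : 'I_n.+1 -> nat) (Q : quiverA n).
Local Notation N := (dimtot d).
Local Notation colv := (@colv n d Q).
Local Notation ev := (ev k colv).
Local Notation opm := (@opm k n d Q).
Local Notation opblk := (@opblk k n d Q).
Implicit Types (U V : rep Q d k) (A B X Y p h : 'M[k]_N).

Let ge : graded n ev := graded_ev k colv.

(** The matrix [zeta V] with its rows relabelled like its columns. *)
Definition zetaop V : 'M[k]_N := opm (zeta_block V).

Local Notation v := (rowperm_mx k Q d).

Lemma zeta_zetaop V : zeta V = v *m zetaop V.
Proof. exact: blocked_opm. Qed.

Lemma arrow_inj i j : src Q i = src Q j -> tgt Q i = tgt Q j -> i = j.
Proof.
rewrite /src /tgt => e1 e2; apply: val_inj.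
have := congr1 val e1; have := congr1 val e2.
by case: (Q i); case: (Q j) => /=; rewrite /bump /=; lia.
Qed.

Lemma arrow_mxE V i : arrow_mx V (tgt Q i) (src Q i) = V i.
Proof.
rewrite /arrow_mx (bigD1 i) ?eqxx //= conform_mx_id big1 ?addr0 // => j.
by move=> /andP[/andP[/eqP e1 /eqP e2]]; rewrite (arrow_inj e1 e2) eqxx.
Qed.

Lemma arrow_mx_opblk X x y :
  arrow_mx (fun i => opblk X (tgt Q i) (src Q i)) x y =
  if arrow Q y x then opblk X x y else 0.
Proof.
case: ifP => [/existsP[i /andP[/eqP<- /eqP<-]]|na]; first by rewrite arrow_mxE.
by rewrite arrow_mx0 ?na.
Qed.

Lemma arrowE x y : arrow Q y x = rarrow Q x y || larrow Q x y.
Proof.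
apply/idP/idP => [/arrow_adj//|]; rewrite /rarrow /larrow.
case/orP => /andP[/eqP e /andP[lt o]]; apply/existsP; exists (Ordinal lt);
  rewrite /src /tgt -(orientE Q) /=.
  by rewrite o; apply/andP; split; apply/eqP/val_inj.
by rewrite (negPf o); apply/andP; split; apply/eqP/val_inj.
Qed.

Lemma opblk_mul A B x y : opblk (A *m B) x y = \sum_z opblk A x z *m opblk B z y.
Proof. by rewrite -{1}(opblkK Q A) -{1}(opblkK Q B) opm_mul opmK. Qed.

Lemma opblk1 x : opblk 1%:M x x = 1%:M.
Proof.
by rewrite -(opm1 k d Q) opmK eqxx; apply/matrixP => i j; rewrite !mxE ltn_ord andbT.
Qed.

Lemma opblk_diag A x y : supp n ev A eq_op -> x != y -> opblk A x y = 0.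
Proof.
move=> sA xy; apply/matrixP => i j; rewrite !mxE (supp_entry sA) //.
by rewrite !colv_colpos.
Qed.

Lemma opblk_arrow V x y : opblk (rightop V + leftop V) x y = arrow_mx V x y.
Proof. by rewrite -arrow_opE opmK. Qed.

(** An isomorphism of representations is an invertible block diagonal operator
    that commutes with the arrows. *)
Lemma intertwiner_orbit U V (f g : 'M[k]_N) :
  supp n ev f eq_op -> supp n ev g eq_op -> f *m g = 1%:M ->
  rightop U *m f = f *m rightop V -> leftop U *m f = f *m leftop V -> orbit_of V U.
Proof.
move=> sf sg fg fR fL.
have fu x : opblk f x x *m opblk g x x = 1%:M.
  rewrite -opblk1 -fg opblk_mul (bigD1 x) //= big1 ?addr0 // => z zx.
  by rewrite (opblk_diag sf) ?mul0mx // eq_sym.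
exists (fun x => opblk f x x); split=> [x|i]; first by have [] := mulmx1_unit (fu x).
have u := (mulmx1_unit (fu (src Q i))).1.
have : (rightop U + leftop U) *m f = f *m (rightop V + leftop V).
  by rewrite mulmxDl mulmxDr fR fL.
move/(congr1 (fun A => opblk A (tgt Q i) (src Q i))); rewrite !opblk_mul.
rewrite (bigD1 (src Q i)) //= big1 ?addr0 => [|z zx]; last by rewrite (opblk_diag sf zx) mulmx0.
rewrite (bigD1 (tgt Q i)) //= big1 ?addr0 => [|z zx]; last by rewrite (opblk_diag sf) ?mul0mx // eq_sym.
rewrite !opblk_arrow !arrow_mxE => <-.
by rewrite mulmxK.
Qed.

Lemma orbit_intertwiner U V : orbit_of V U -> exists f : 'M[k]_N,
  [/\ f \in unitmx, supp n ev f eq_op, supp n ev (invmx f) eq_op,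
   rightop U *m f = f *m rightop V & leftop U *m f = f *m leftop V].
Proof.
move=> [g [gu gE]].
pose dg (g : forall x, 'M[k]_(d x)) : 'M[k]_N :=
  opm (fun x y => if x == y then conform_mx 0 (g x) else 0).
have dgx g' x y : opblk (dg g') x y = if x == y then conform_mx 0 (g' x) else 0.
  by rewrite opmK.
have sdg g' : supp n ev (dg g') eq_op.
  by apply/supp_evP => p q /= /negPf ne; rewrite mxE -(inj_eq val_inj) ne mxE.
have blk_inj A B : (forall x y, opblk A x y = opblk B x y) -> A = B.
  move=> e; rewrite -(opblkK Q A) -(opblkK Q B); apply/matrixP => p q.
  by rewrite !mxE; have /matrixP := e (colv p) (colv q) => /(_ (tagged (collab Q p)) (tagged (collab Q q))); rewrite !mxE.
have dM g1 g2 : (forall x, g1 x *m g2 x = 1%:M) -> dg g1 *m dg g2 = 1%:M.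
  move=> e; apply: blk_inj => x y; rewrite opblk_mul (bigD1 x) //= big1 => [|z zx]; last first.
    by rewrite dgx eq_sym (negPf zx) mul0mx.
  rewrite addr0 !dgx eqxx -(opm1 k d Q) opmK; case: eqP => [<-|_]; last by rewrite mulmx0.
  rewrite !conform_mx_id e; apply/matrixP => i j; by rewrite !mxE ltn_ord andbT.
have fg : dg g *m dg (fun x => invmx (g x)) = 1%:M.
  by apply: dM => x; rewrite mulmxV.
have fu : dg g \in unitmx by have [] := mulmx1_unit fg.
have iE : invmx (dg g) = dg (fun x => invmx (g x)).
  by rewrite -[RHS](mulKmx fu) fg mulmx1.
have ar x y : arrow_mx U x y *m g y = g x *m arrow_mx V x y.
  have [/existsP[i /andP[/eqP<- /eqP<-]]|na] := boolP (arrow Q y x).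
    by rewrite !arrow_mxE gE mulmxKV.
  by rewrite !arrow_mx0 // mul0mx mulmx0.
have L (W : rep Q d k) (c : 'I_n.+1 -> 'I_n.+1 -> bool) x y :
    opblk (opm (fun x y => if c x y then arrow_mx W x y else 0) *m dg g) x y =
    if c x y then arrow_mx W x y *m g y else 0.
  rewrite opblk_mul (bigD1 y) //= big1 => [|z zy]; last by rewrite dgx (negPf zy) mulmx0.
  by rewrite addr0 dgx eqxx conform_mx_id opmK; case: ifP; rewrite ?mul0mx.
have Rr (W : rep Q d k) (c : 'I_n.+1 -> 'I_n.+1 -> bool) x y :
    opblk (dg g *m opm (fun x y => if c x y then arrow_mx W x y else 0)) x y =
    if c x y then g x *m arrow_mx W x y else 0.
  rewrite opblk_mul (bigD1 x) //= big1 => [|z zx]; last by rewrite dgx eq_sym (negPf zx) mul0mx.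
  by rewrite addr0 dgx eqxx conform_mx_id opmK; case: ifP; rewrite ?mulmx0.
exists (dg g); split=> //; first by rewrite iE.
- by apply: blk_inj => x y; rewrite L Rr ar.
- by apply: blk_inj => x y; rewrite L Rr ar.
Qed.

Lemma right_sumKl V : right_sum V * (1 - rightop V) = 1.
Proof. exact: mulmx1C (right_sumK V). Qed.

Lemma left_sumKl V : left_sum V * (1 + leftop V) = 1.
Proof. exact: mulmx1C (left_sumK V). Qed.

Lemma zetaopE V : zetaop V = right_sum V * (1 + leftop V).
Proof. exact: zeta_opmE. Qed.

Lemma left_right_sumC V : left_sum V * right_sum V = right_sum V * left_sum V.
Proof.
have sR := @supp_rightop k n d Q V; have sL := @supp_leftop k n d Q V.
have DC : (1 - rightop V) * (1 + leftop V) = (1 + leftop V) * (1 - rightop V).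
  rewrite mulrDr mulr1 mulrBl mul1r (rarrowM_larrow ge sR sL) subr0.
  by rewrite mulrBr mulr1 mulrDl mul1r (larrowM_rarrow ge sR sL) addr0 addrAC.
have e1 : (left_sum V * right_sum V) * ((1 - rightop V) * (1 + leftop V)) = 1.
  by rewrite mulrA -(mulrA (left_sum V)) right_sumKl mulr1 left_sumKl.
have e2 : ((1 - rightop V) * (1 + leftop V)) * (right_sum V * left_sum V) = 1.
  by rewrite DC mulrA -(mulrA (1 + _)) right_sumK mulr1 left_sumK.
by have := congr1 (fun t => t * (right_sum V * left_sum V)) e1; rewrite -mulrA e2 mulr1 mul1r.
Qed.

Lemma supp_left_sum V : supp n ev (left_sum V) (fun i j => (i <= j)%N).
Proof.
apply: supp_sum => a; apply: (@supp_sub _ _ _ _ (fun i j => j == i + a)%N) => [|i j _ _ /eqP->]; last exact: leq_addr.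
rewrite exprNn; apply: (suppM ge (r := eq_op) (s := fun i j => j == i + a)%N).
- elim: (nat_of_ord a) => [|b IH]; first by apply: (supp1 ge) => i; exact: eqxx.
  rewrite exprS mulN1r; exact: suppN.
- exact: supp_leftop_exp.
- by move=> i m j _ _ _ /eqP->.
Qed.

Lemma supp_right_sum V : supp n ev (right_sum V) (fun i j => (j <= i)%N).
Proof.
apply: supp_sum => a; apply: (@supp_sub _ _ _ _ (fun i j => i == j + a)%N) => [|i j _ _ /eqP->]; last exact: leq_addr.
exact: supp_rightop_exp.
Qed.

Lemma left_right_sum_diag V z : (z <= n)%N -> ev z * (left_sum V * right_sum V) * ev z = ev z.
Proof.
move=> zn; have sR := @supp_rightop k n d Q V; have sL := @supp_leftop k n d Q V.
have [ee _ _ _] := ge.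
have LE : left_sum V = 1 - leftop V * left_sum V.
  by apply/eqP; rewrite eq_sym subr_eq eq_sym -(left_sumK V) mulrDl mul1r.
have RE : right_sum V = 1 + rightop V * right_sum V.
  by apply/eqP; rewrite -subr_eq -{1}[right_sum V]mul1r -mulrBl right_sumK.
have LR : left_sum V * rightop V = rightop V.
  have LE' : left_sum V = 1 - left_sum V * leftop V.
    by apply/eqP; rewrite eq_sym subr_eq eq_sym -(left_sumKl V) mulrDr mulr1.
  by rewrite LE' mulrBl mul1r -mulrA (larrowM_rarrow ge sR sL) mulr0 subr0.
rewrite RE mulrDr mulr1 mulrA LR mulrDr mulrDl.
rewrite [X in _ + X](supp_out ge (r := fun i j => (j < i)%N)) ?ltnn ?addr0 //; last first.
  apply: (suppM ge sR (@supp_right_sum V)) => i a j _ _ _ /andP[/eqP-> _] /=; lia.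
rewrite LE mulrBr mulr1 mulrBl ee [X in _ - X](supp_out ge (r := fun i j => (i < j)%N)) ?ltnn ?subr0 //.
apply: (suppM ge sL (@supp_left_sum V)) => i a j _ _ _ /andP[/eqP-> _] /=; lia.
Qed.

(** The operator [Y = (1 + L_U)^-1 p (1 - R_V)^-1] satisfies
    [(1 + L_U) Y (1 - R_V) = p] and [(1 - R_U) Y (1 + L_V) = h], because
    [zetaop = (1 - R)^-1 (1 + L)] and the two factors commute. The inverse
    equation gives the inverse isomorphism. *)
Lemma double_coset_orbit U V p h : p \in unitmx ->
  supp n ev p (upper (rkey Q)) -> supp n ev (invmx p) (upper (rkey Q)) ->
  h \in unitmx ->
  supp n ev h (upper (ckey Q)) -> supp n ev (invmx h) (upper (ckey Q)) ->
  zetaop U *m h = p *m zetaop V -> orbit_of V U.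
Proof.
move=> pu sp sip hu sh sih e.
have sR W := @supp_rightop k n d Q W; have sL W := @supp_leftop k n d Q W.
have gen (U1 V1 : rep Q d k) p1 h1 : zetaop U1 *m h1 = p1 *m zetaop V1 ->
    let Y := left_sum U1 * p1 * right_sum V1 in
    (1 + leftop U1) * Y * (1 - rightop V1) = p1 /\
    (1 - rightop U1) * Y * (1 + leftop V1) = h1.
  move=> e1 Y; split.
    by rewrite /Y !mulrA left_sumK mul1r -mulrA right_sumKl mulr1.
  rewrite /Y -!mulrA -zetaopE -[p1 * zetaop V1]e1 zetaopE.
  rewrite -[_ *m h1]/(right_sum U1 * (1 + leftop U1) * h1).
  rewrite !mulrA -(mulrA (1 - _)) left_right_sumC mulrA right_sumK mul1r.
  by rewrite left_sumKl mul1r.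
have e' : zetaop V *m invmx h = invmx p *m zetaop U.
  by rewrite -[LHS](mulKmx pu) (mulmxA p) -e -mulmxA mulmxV ?mulmx1.
have /= [Yp Yh] := gen _ _ _ _ e; have /= [Yp' Yh'] := gen _ _ _ _ e'.
have YY z : (z <= n)%N -> ev z * (left_sum V * invmx p * right_sum U *
    ((1 - rightop U) * (1 + leftop U)) * (left_sum U * p * right_sum V)) * ev z = ev z.
  move=> zn; rewrite -[RHS](left_right_sum_diag V zn); congr (_ * _ * _).
  rewrite -!mulrA; congr (_ * _).
  rewrite (mulrA (right_sum U)) right_sumKl mul1r (mulrA (1 + _)) left_sumK mul1r.
  by rewrite mulrA [invmx p * p]mulVmx // mul1r.
have [gf fR fL] := diagonal_iso ge (sR V) (sL V) (sR U) (sL U) Yp Yh Yp' Yh' sp sh sip sih YY.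
apply: (intertwiner_orbit _ _ (mulmx1C gf) fR fL); exact: blk_supp.
Qed.

End Orbits.

(** * The points of the cell in the double coset of a point zeta V *)

Section Cell.
Variables (k : closedFieldType) (n : nat) (d : 'I_n.+1 -> nat) (Q : quiverA n).
Local Notation N := (dimtot d).
Local Notation colv := (@colv n d Q).
Local Notation rowv := (@rowv n d Q).
Local Notation ev := (ev k colv).
Local Notation opblk := (@opblk k n d Q).
Implicit Types (U V : rep Q d k) (A B X Y p h : 'M[k]_N).

Let ge : graded n ev := graded_ev k colv.
Local Notation v := (rowperm_mx k Q d).

(** The blocks that are not forced to vanish on the cell. *)
Definition lowrel (i j : nat) :=
  (i == j) || (rkey Q j < rkey Q i)%N && (ckey Q j < ckey Q i)%N.

Lemma row2col_surj (q : 'I_N) : exists r : 'I_N, row2col Q r = q.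
Proof.
have [f _ K] : bijective (@row2col n d Q) by exact: injF_bij (@row2col_inj n d Q).
by exists (f q).
Qed.

Lemma cell_spaceP X : cell_space Q (v *m X) <->
  (forall i, (i <= n)%N -> ev i * X * ev i = ev i) /\ supp n ev X lowrel.
Proof.
split=> [[c1 c2]|[c1 c2]].
  split=> [i li|].
    apply/matrixP => p q; rewrite mulmx_prE mul_prE prE.
    case: (eqVneq (colv p : nat) i) => [e|_]; last by rewrite !mul0r andbF.
    have [r rE] := row2col_surj p; rewrite -rE.
    case: (eqVneq (colv q : nat) i) => [e'|ne]; last first.
      by rewrite mulr0; case: eqP => //= e'; case/eqP: ne; rewrite -e -rE e'.
    have er : rowv r = colv q by apply: val_inj; rewrite -colv_row2col rE /= e e'.
    have := c1 r q er; rewrite mul_vE => ->.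
    by rewrite mul1r mulr1 andbT [row2col _ _ == _]eq_sym eq_row2col er eqxx.
  apply/supp_evP => p q; have [r rE] := row2col_surj p; rewrite -rE colv_row2col => nl.
  have := c2 r q; rewrite mul_vE; apply.
  move: nl; rewrite negb_or negb_and -!leqNgt prec_colseq prec_rowseq => /andP[ne].
  case/orP; rewrite leq_eqVlt => /orP[/eqP e|->]; try by [left|right].
    by move/rkey_inj: e => e; rewrite e eqxx in ne.
  by move/ckey_inj: e => e; rewrite e eqxx in ne.
split=> p q.
  move=> e; rewrite mul_vE.
  have /matrixP/(_ (row2col Q p) q) := c1 (colv q) (leq_ord _).
  rewrite mulmx_prE mul_prE prE colv_row2col e !eqxx mul1r mulr1 andbT => ->.
  by rewrite eq_sym eq_row2col e eqxx.
move=> h; rewrite mul_vE (supp_entry c2) // colv_row2col; move: h.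
rewrite prec_colseq prec_rowseq negb_or negb_and -!leqNgt.
case=> h; apply/andP; split; try by [rewrite (ltnW h) ?orbT|apply: contraTneq h => ->; rewrite ltnn].
Qed.

Lemma supp_zetaop V : supp n ev (zetaop V) (fun i j => j <= i.+1)%N.
Proof.
rewrite zetaopE; apply: (suppM ge (@supp_right_sum _ _ _ _ V) (s := fun i j => (i <= j <= i.+1)%N)).
  apply: suppD; first by apply: (supp1 ge) => i; rewrite leqnn leqnSn.
  by apply: (supp_sub (@supp_leftop _ _ _ _ V)) => i j _ _ /andP[/eqP-> _]; rewrite leqnn leqnSn.
by move=> i m j _ _ _ /=; lia.
Qed.

Definition zetaopV V : 'M[k]_N := left_sum V * (1 - rightop V).

Lemma zetaopK V : zetaop V *m zetaopV V = 1%:M.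
Proof.
rewrite -[LHS]/(zetaop V * zetaopV V) zetaopE /zetaopV -mulrA (mulrA (1 + _)) left_sumK mul1r.
exact: right_sumKl.
Qed.

Lemma zetaop_unit V : zetaop V \in unitmx. Proof. by have [] := mulmx1_unit (zetaopK V). Qed.

Lemma supp_zetaopV V : supp n ev (zetaopV V) (fun i j => i <= j.+1)%N.
Proof.
apply: (suppM ge (@supp_left_sum _ _ _ _ V) (s := fun i j => (j <= i <= j.+1)%N)).
  apply: suppD; first by apply: (supp1 ge) => i; rewrite leqnn leqnSn.
  apply: suppN.
  by apply: (supp_sub (@supp_rightop _ _ _ _ V)) => i j _ _ /andP[/eqP-> _]; rewrite leqnn leqnSn.
by move=> i m j _ _ _ /=; lia.
Qed.

Lemma zeta_cell V : cell_space Q (zeta V).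
Proof.
pose Pr i j := [&& (j < i)%N, rt Q j & ri Q i].
have sP m : supp n ev (rightop V ^+ m.+1) Pr.
  have s1 : supp n ev (rightop V) Pr.
    apply: (supp_sub (@supp_rightop _ _ _ _ V)) => i j _ _ /andP[/eqP-> r].
    by rewrite /Pr ltnSn r; case/andP: r.
  elim: m => [|m IH]; first by rewrite expr1.
  rewrite exprS; apply: (suppM ge s1 IH) => i a j _ _ _ /and3P[h1 h2 h3] /and3P[h4 h5 h6].
  by apply/and3P; split=> //; lia.
have sS : supp n ev (\sum_(m < n) rightop V ^+ m.+1) Pr by apply: supp_sum => m; exact: sP.
have sL := @supp_leftop _ _ _ _ V.
rewrite zeta_zetaop; apply/cell_spaceP; rewrite /zetaop zeta_opm; split=> [i li|].
  rewrite !mulrDr mulr1 !mulrDl.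
  rewrite (supp_out ge sL) /larrow ?(supp_out ge sS) /Pr ?ltnn ?addr0 ?(gtn_eqF (ltnSn i)) //.
    by have [ee _ _ _] := ge.
  by rewrite (ltn_eqF (ltnSn i)).
apply: suppD; first apply: suppD.
- by apply: (supp1 ge) => i; rewrite /lowrel eqxx.
- apply: (supp_sub sL) => i j lei lej /andP[/eqP e l]; apply/orP; right.
  move: l; rewrite e /rkey /ckey /lt /rt /li /= => /andP[ln /negPf ->].
  by rewrite andbF /=; do ?case: ifP => /=; lia.
apply: (supp_sub sS) => i j lei lej /and3P[ji r rr]; apply/orP; right.
rewrite /rkey r /ckey; have -> : li Q i = false by move: rr; rewrite /li /ri => /andP[_ ->]; rewrite andbF.
by have := rtW r; do ?case: ifP => /=; lia.
Qed.

Lemma rightop_opblk X :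
  rightop (fun i => opblk X (tgt Q i) (src Q i)) = blk n ev (rarrow Q) X.
Proof.
apply: (graded_eq ge) => i j li lj; rewrite (blkE ge) //.
apply/matrixP => p q; rewrite mulmx_prE mul_prE.
have -> : (if rarrow Q i j then ev i * X * ev j else 0) p q =
    if rarrow Q i j then (colv p == i :> nat)%:R * X p q * (colv q == j :> nat)%:R else 0.
  by case: ifP => _; [rewrite mulmx_prE mul_prE|rewrite mxE].
case: (eqVneq (colv p : nat) i) => [e|_]; last by rewrite !mul0r if_same.
case: (eqVneq (colv q : nat) j) => [e'|_]; last by rewrite !mulr0 if_same.
rewrite !mul1r !mulr1 -e -e' mxE arrow_mx_opblk arrowE /rarrow /larrow.
case: eqP => [e1|]; last by rewrite mxE.
rewrite (_ : (_ == (colv p).+1) = false) /=; last by apply/eqP; lia.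
by rewrite orbF; case: ifP => _; rewrite !mxE // !colpos_label.
Qed.

Lemma leftop_opblk X :
  leftop (fun i => opblk X (tgt Q i) (src Q i)) = blk n ev (larrow Q) X.
Proof.
apply: (graded_eq ge) => i j li lj; rewrite (blkE ge) //.
apply/matrixP => p q; rewrite mulmx_prE mul_prE.
have -> : (if larrow Q i j then ev i * X * ev j else 0) p q =
    if larrow Q i j then (colv p == i :> nat)%:R * X p q * (colv q == j :> nat)%:R else 0.
  by case: ifP => _; [rewrite mulmx_prE mul_prE|rewrite mxE].
case: (eqVneq (colv p : nat) i) => [e|_]; last by rewrite !mul0r if_same.
case: (eqVneq (colv q : nat) j) => [e'|_]; last by rewrite !mulr0 if_same.
rewrite !mul1r !mulr1 -e -e' mxE arrow_mx_opblk arrowE /rarrow /larrow.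
case: eqP => [e1|]; last by rewrite mxE.
rewrite (_ : (_ == (colv q).+1) = false) /=; last by apply/eqP; lia.
by case: ifP => _; rewrite !mxE // !colpos_label.
Qed.

(** The triangular factors carry the vanishing of the blocks of [zetaop V],
    and of its inverse, between distant vertices over to [X] and its
    inverse. *)
Lemma cell_recognition X p h V : cell_space Q (v *m X) ->
  p \in unitmx -> supp n ev p (upper (rkey Q)) -> supp n ev (invmx p) (upper (rkey Q)) ->
  h \in unitmx -> supp n ev h (upper (ckey Q)) -> supp n ev (invmx h) (upper (ckey Q)) ->
  X = p *m zetaop V *m h -> exists2 U, zetaop U = X & orbit_of V U.
Proof.
move=> /cell_spaceP[c1 c2] pu sp sip hu sh sih XE.
have Xu : X \in unitmx by rewrite XE !unitmx_mul pu zetaop_unit.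
have iX : invmx X = invmx h *m zetaopV V *m invmx p.
  rewrite -[RHS](mulKmx Xu) -[LHS]mulmx1; congr (_ *m _).
  move: (zetaopV V) (zetaopK V) => Z zz.
  rewrite XE -!mulmxA (mulmxA h) mulmxV // mul1mx (mulmxA (zetaop V)) zz.
  by rewrite mul1mx mulmxV.
(* A vertex [i] with a left arrow on its right is followed, in the order of
   the rows, by vertices to its left only; the factor [zetaop V] moves at most
   one step to the right; and vertices that precede [j] in the order of the
   columns are not to its left. *)
have XL i j : lt Q i -> li Q j -> (i.+2 <= j)%N -> ev i * X * ev j = 0.
  move=> l1 l2 ij; have s : supp n ev X (fun i j => ~~ [&& lt Q i, li Q j & (i.+2 <= j)%N]).
    rewrite XE; apply: (suppM ge (suppM ge sp (@supp_zetaop V) (t := fun i j =>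
      (lt Q i ==> (j <= i.+1)%N)) _) sh).
    - move=> a b c la lb lc; rewrite /upper /rkey => h1 h2; apply/implyP => l.
      move: h1; rewrite (negPf (lt_nrt l)); have := ltW l.
      by case: ifP => [/rtW|] _; lia.
    move=> a b c la lb lc h1 h2; apply/negP => /and3P[l l' ac].
    move: h1 h2; rewrite l /= /upper /ckey l' => h1.
    by case/andP: l' => c0 _; case: ifP => _; lia.
  by apply: (supp_out ge s); rewrite l1 l2 ij.
have BR i j : rt Q i -> ri Q j -> (i.+2 <= j)%N -> ev j * invmx X * ev i = 0.
  move=> l1 l2 ij; have s : supp n ev (invmx X) (fun j i => ~~ [&& rt Q i, ri Q j & (i.+2 <= j)%N]).
    rewrite iX; apply: (suppM ge (suppM ge sih (@supp_zetaopV V) (t := fun j i =>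
      (ri Q j ==> (j <= i.+1)%N)) _) sip).
    - move=> a b c la lb lc; rewrite /upper /ckey => h1 h2; apply/implyP => l.
      move: h1; have -> : li Q a = false.
        by move: l; rewrite /li /ri => /andP[_ ->]; rewrite andbF.
      by case/andP: l => a0 _; case: ifP => _; lia.
    move=> a b c la lb lc h1 h2; apply/negP => /and3P[l l' ac].
    move: h1 h2; rewrite l' /= /upper /rkey l => h1.
    by have := rtW l; case: ifP => _; lia.
  by apply: (supp_out ge s); rewrite l1 l2 ij.
have := zeta_recognition ge (mulmxV Xu) (mulVmx Xu) c1 c2 XL BR.
rewrite -rightop_opblk -leftop_opblk; set U := fun i => _ => e.
have UX : zetaop U = X.
  by rewrite zetaopE -e mulrA -[X in X * _ = _]/(right_sum U * (1 - rightop U)) right_sumKl mul1r.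
exists U => //; apply: (double_coset_orbit (p := p) (h := invmx h)) => //.
- by rewrite unitmx_inv.
- by rewrite invmxK.
by rewrite UX XE -mulmxA mulmxV // mulmx1.
Qed.

End Cell.

(** * Bruhat decomposition *)

Section Bruhat.
Variable k : fieldType.

Definition pm n (w : 'S_n) : 'M[k]_n := \matrix_(i, j) (i == w j)%:R.

Lemma mul_pmE n m (w : 'S_n) (A : 'M[k]_(m, n)) i j : (A *m pm w) i j = A i (w j).
Proof.
rewrite mxE (bigD1 (w j)) //= mxE eqxx mulr1 big1 ?addr0 // => l /negPf nl.
by rewrite mxE nl mulr0.
Qed.

Lemma pm_mulE n m (w : 'S_n) (A : 'M[k]_(n, m)) i j : (pm w *m A) (w i) j = A i j.
Proof.
rewrite mxE (bigD1 i) //= mxE eqxx mul1r big1 ?addr0 // => l /negPf nl.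
by rewrite mxE (inj_eq perm_inj) eq_sym nl mul0r.
Qed.

Lemma pmM n (s t : 'S_n) : pm s *m pm t = pm (t * s)%g.
Proof.
by apply/matrixP => i j; rewrite mul_pmE !mxE permM.
Qed.

Lemma pm1 n : pm (1%g : 'S_n) = 1%:M.
Proof. by apply/matrixP => i j; rewrite !mxE perm1. Qed.

Lemma pm_unit n (s : 'S_n) : pm s \in unitmx.
Proof.
have e : pm s *m pm s^-1%g = 1%:M by rewrite pmM mulVg pm1.
by have [] := mulmx1_unit e.
Qed.

Definition uptrig n (A : 'M[k]_n) := forall i j : 'I_n, (j < i)%N -> A i j = 0.

Lemma uptrigP n (A : 'M[k]_n) : is_trig_mx A^T <-> uptrig A.
Proof.
split=> [/is_trig_mxP h i j ji|h]; first by have := h j i ji; rewrite mxE.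
by apply/is_trig_mxP => i j ij; rewrite mxE h.
Qed.

(** If [b] preserves a subspace then so does its inverse: the corner of [b] has a
    one-sided inverse, hence a two-sided one. *)
Lemma corner_inv n (f b : 'M[k]_n) : f *m f = f -> f *m b = f *m b *m f ->
  b \in unitmx -> f *m invmx b = f *m invmx b *m f.
Proof.
move=> ff fb bu; have [g gE] : exists g, g = 1%:M - f by exists (1%:M - f).
have fg : f *m g = 0 by rewrite gE mulmxBr mulmx1 ff subrr.
have gf : g *m f = 0 by rewrite gE mulmxBl mul1mx ff subrr.
have gg : g *m g = g by rewrite {2}gE mulmxBr mulmx1 gf subr0.
have e : (f *m b + g) *m (f *m invmx b *m f + g) = 1%:M.
  rewrite mulmxDl !mulmxDr gg.
  have -> : f *m b *m g = 0 by rewrite fb -mulmxA fg mulmx0.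
  have -> : g *m (f *m invmx b *m f) = 0 by rewrite !mulmxA gf !mul0mx.
  rewrite addr0 add0r !mulmxA -fb -(mulmxA f) mulmxV // mulmx1 ff.
  by rewrite gE addrC subrK.
have e' := mulmx1C e; move: e'; set X := f *m invmx b *m f => e'.
have fX : f *m X = X by rewrite /X !mulmxA ff.
have Xf : X *m f = X by rewrite /X -mulmxA ff.
have Xg : X *m g = 0 by rewrite -Xf -mulmxA fg mulmx0.
have Xb : X *m b = f.
  have := congr1 (mulmx f) e'; rewrite mulmxA mulmx1 [f *m (_ + _)]mulmxDr fX fg addr0.
  by rewrite mulmxDr Xg addr0 mulmxA Xf.
by rewrite -[in LHS]Xb -mulmxA mulmxV // mulmx1.
Qed.

Lemma key_upper_inv n (key : 'I_n -> nat) (b : 'M[k]_n) :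
  (forall p q, (key q < key p)%N -> b p q = 0) -> b \in unitmx ->
  forall p q, (key q < key p)%N -> invmx b p q = 0.
Proof.
move=> hb bu p q lt; pose f := ind k (fun l => (key p <= key l)%N).
have ff : f *m f = f.
  apply/matrixP => i j; rewrite mul_diag_mx !mxE; case: (i == j); rewrite ?mulr0 //.
  by case: leqP; rewrite ?mul1r ?mul0r.
have fb : f *m b = f *m b *m f.
  apply/matrixP => i j; rewrite mul_mx_diag mul_diag_mx !mxE.
  case: (leqP (key p) (key i)) => hi; last by rewrite !mul0r.
  by case: (leqP (key p) (key j)) => hj; rewrite ?mulr1 // hb ?mulr0 //; apply: leq_trans hj hi.
have /matrixP/(_ p q) := corner_inv ff fb bu.
rewrite mul_mx_diag mul_diag_mx !mxE leqnn mul1r (leqNgt (key p)) lt mulr0.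
by [].
Qed.

Lemma key_upperM n (key : 'I_n -> nat) (b b' : 'M[k]_n) :
  (forall p q, (key q < key p)%N -> b p q = 0) ->
  (forall p q, (key q < key p)%N -> b' p q = 0) ->
  forall p q, (key q < key p)%N -> (b *m b') p q = 0.
Proof.
move=> hb hb' p q lt; rewrite mxE big1 // => j _.
case: (ltnP (key j) (key p)) => l; first by rewrite hb ?mul0r.
by rewrite hb' ?mulr0 //; exact: leq_trans lt l.
Qed.

Lemma uptrigM n (b b' : 'M[k]_n) : uptrig b -> uptrig b' -> uptrig (b *m b').
Proof. exact: (@key_upperM _ (@nat_of_ord _)). Qed.

Definition border_mx n (i0 : 'I_n.+1) (a : k) (B : 'M[k]_n) : 'M[k]_n.+1 :=
  \matrix_(i, j) match unlift i0 i, unlift i0 j with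
    | Some i', Some j' => B i' j' | None, None => a | _, _ => 0 end.

Lemma border_mx_uptrig n (i0 : 'I_n.+1) a (B : 'M[k]_n) : uptrig B -> uptrig (border_mx i0 a B).
Proof.
move=> uB i j ji; rewrite mxE; case: unliftP => [i' e|e]; case: unliftP => [j' e'|e'] //.
  by apply: uB; move: ji; rewrite e e' /= /bump; do 2!case: leqP; lia.
by move: ji; rewrite e e' ltnn.
Qed.

Lemma sum_lift n (i0 : 'I_n.+1) (F : 'I_n.+1 -> k) :
  \sum_i F i = F i0 + \sum_(i < n) F (lift i0 i).
Proof. exact: bigD1_ord. Qed.

Lemma border_mx_unit n (i0 : 'I_n.+1) a (B : 'M[k]_n) : a != 0 -> B \in unitmx ->
  border_mx i0 a B \in unitmx.
Proof.
move=> a0 uB; have e : border_mx i0 a B *m border_mx i0 a^-1 (invmx B) = 1%:M.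
  apply/matrixP => i j; rewrite mxE (sum_lift i0) !mxE unlift_none.
  under eq_bigr do rewrite !mxE liftK.
  case: (unliftP i0 i) => [i' ->|->]; case: (unliftP i0 j) => [j' ->|->].
  - have /matrixP/(_ i' j') := mulmxV uB; rewrite !mxE => h.
    by rewrite mul0r add0r (inj_eq lift_inj).
  - rewrite mul0r add0r big1 ?(negPf (neq_lift _ _)) // => [|l _]; last by rewrite mulr0.
    by rewrite eq_sym (negPf (neq_lift _ _)).
  - rewrite mulr0 add0r big1 ?(negPf (neq_lift _ _)) // => l _; last by rewrite mul0r.
  - by rewrite mulfV // big1 ?addr0 ?eqxx // => l _; rewrite mulr0.
by have [] := mulmx1_unit e.
Qed.

(** Take as pivot the lowest nonzero entry of the first column. Upper
    triangular operations clear the column above it and the row to its right;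
    the induction hypothesis applies to the remaining minor. *)
Lemma bruhat n (A : 'M[k]_n) : A \in unitmx ->
  exists b b' s, [/\ b \in unitmx, uptrig b, b' \in unitmx, uptrig b' &
    A = b *m pm s *m b'].
Proof.
elim: n A => [|n IH] A uA.
  exists 1%:M, 1%:M, 1%g; split; rewrite ?unitmx1 //; try by case.
  by apply/matrixP; case.
have [i1 Ai1] : exists i, A i ord0 != 0.
  apply/existsP; apply: contraLR uA; rewrite negb_exists => /forallP z.
  rewrite unitmxE (expand_det_col _ ord0) big1 ?unitr0 // => i _.
  by have := z i; rewrite negbK => /eqP ->; rewrite mul0r.
case: (@arg_maxnP _ i1 (fun i => A i ord0 != 0) (@nat_of_ord _) Ai1) => i0 /= Ai0 maxi.
have {maxi} A0 (i : 'I_n.+1) : (i0 < i)%N -> A i ord0 = 0.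
  by move=> lt; apply/eqP; apply: contraTT lt => /maxi; rewrite leqNgt.
set a := A i0 ord0 in Ai0.
(* [L] clears the first column, [R] the row [i0]. *)
pose L : 'M[k]_n.+1 := \matrix_(i, j) ((i == j)%:R - ((j == i0) && (i < i0)%N)%:R * (A i ord0 / a)).
pose R : 'M[k]_n.+1 := \matrix_(i, j) ((i == j)%:R - ((i == ord0) && (0 < j)%N)%:R * (A i0 j / a)).
have uL : uptrig L.
  move=> i j ji; rewrite mxE; case: eqP => [e|_]; first by rewrite e ltnn in ji.
  case: eqP => [e|_] /=; last by rewrite mul0r subrr.
  by rewrite ltnNge -e (ltnW ji) /= mul0r subrr.
have uR : uptrig R.
  move=> i j ji; rewrite mxE; case: eqP => [e|_]; first by rewrite e ltnn in ji.
  case: eqP => [e|_] /=; last by rewrite mul0r subrr.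
  by rewrite e in ji.
have trig_unit (T : 'M[k]_n.+1) : uptrig T -> (forall i, T i i != 0) -> T \in unitmx.
  move=> uT dT; rewrite -unitmx_tr unitmxE (det_trig (iffRL (uptrigP T) uT)) unitfE.
  by apply/prodf_neq0 => i _; rewrite mxE.
have Lu : L \in unitmx.
  apply: trig_unit => // i; rewrite mxE eqxx; by case: (eqVneq i i0) => [->|_]; rewrite ?ltnn /= mul0r subr0 oner_neq0.
have Ru : R \in unitmx.
  by apply: trig_unit => // i; rewrite mxE eqxx; case: (eqVneq i ord0) => [->|_]; rewrite ?ltnn /= mul0r subr0 oner_neq0.
have LE (X : 'M[k]_n.+1) i j : (L *m X) i j = X i j - (i < i0)%N%:R * (A i ord0 / a) * X i0 j.
  rewrite mxE; under eq_bigr do rewrite mxE mulrBl.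
  rewrite sumrB (bigD1 i) //= eqxx mul1r big1 ?addr0 => [|l /negPf nl]; last by rewrite eq_sym nl mul0r.
  rewrite (bigD1 i0) //= eqxx big1 ?addr0 // => l /negPf nl.
  by rewrite nl !mul0r.
have RE (X : 'M[k]_n.+1) i j : (X *m R) i j = X i j - (0 < j)%N%:R * (A i0 j / a) * X i ord0.
  rewrite mxE; under eq_bigr do rewrite mxE mulrBr.
  rewrite sumrB (bigD1 j) //= eqxx mulr1 big1 ?addr0 => [|l /negPf nl]; last by rewrite nl mulr0.
  rewrite (bigD1 ord0) //= ?eqxx big1 ?addr0 /= => [|l /negPf nl]; first by rewrite mulrC.
  by rewrite nl !mul0r mulr0.
pose A1 := L *m A *m R.
have A1u : A1 \in unitmx by rewrite !unitmx_mul Lu uA.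
have A1c i : A1 i ord0 = (i == i0)%:R * a.
  rewrite RE LE /= !mul0r subr0 -/a -mulrA divfK //.
  case: (ltngtP i i0) => [lt|lt|/val_inj ->].
  - by rewrite mul1r subrr -(inj_eq val_inj) (ltn_eqF lt) mul0r.
  - by rewrite mul0r subr0 A0 // -(inj_eq val_inj) (gtn_eqF lt) mul0r.
  - by rewrite mul0r subr0 eqxx mul1r.
have A1r j : A1 i0 j = (j == ord0)%:R * a.
  case: (eqVneq j ord0) => [->|nj]; first by rewrite A1c eqxx.
  by rewrite RE !LE ltnn !mul0r !subr0 -/a lt0n nj mul1r divfK // subrr ?mul0r.
pose M := row' i0 (col' ord0 A1).
have uM : M \in unitmx.
  move: A1u; rewrite !unitmxE (expand_det_col A1 ord0) (bigD1 i0) //= A1c eqxx mul1r.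
  rewrite big1 ?addr0 => [|i /negPf ni]; last by rewrite A1c ni !mul0r.
  by rewrite /cofactor unitrM => /andP[_]; rewrite unitrM => /andP[].
have [b [b' [s [bu bt b'u b't ME]]]] := IH M uM.
exists (invmx L *m border_mx i0 a b), (border_mx ord0 1 b' *m invmx R), (lift_perm ord0 i0 s).
have A1E : A1 = border_mx i0 a b *m pm (lift_perm ord0 i0 s) *m border_mx ord0 1 b'.
  apply/matrixP => i j; rewrite [RHS]mxE (sum_lift ord0) mul_pmE lift_perm_id.
  under eq_bigr do rewrite mul_pmE lift_perm_lift.
  rewrite [border_mx i0 a b i i0]mxE [border_mx ord0 1 b' ord0 j]mxE !unlift_none.
  under eq_bigr do rewrite !mxE !liftK.
  case: (unliftP ord0 j) => [j' ->|->]; case: (unliftP i0 i) => [i' ->|->].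
  - rewrite mul0r add0r; have /matrixP/(_ i' j') := ME; rewrite !mxE => ->.
    by apply: eq_bigr => l _; rewrite mul_pmE.
  - by rewrite mulr0 add0r A1r big1 ?mul0r // => l _; rewrite mul0r.
  - by rewrite A1c mul0r add0r big1 ?(negPf _) ?mul0r // => [|l _]; rewrite ?mulr0 // eq_sym (negPf (neq_lift _ _)) mul0r.
  - by rewrite A1c eqxx mul1r mulr1 big1 ?addr0 // => l _; rewrite mul0r.
have inv_up m (T : 'M[k]_m) : T \in unitmx -> uptrig T -> uptrig (invmx T).
  by move=> Tu uT; exact: (@key_upper_inv _ (@nat_of_ord _)).
split.
- by rewrite unitmx_mul unitmx_inv Lu border_mx_unit.
- by apply: uptrigM; [exact: inv_up|exact: border_mx_uptrig].
- by rewrite unitmx_mul unitmx_inv Ru border_mx_unit ?oner_neq0.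
- by apply: uptrigM; [exact: border_mx_uptrig|exact: inv_up].
rewrite !mulmxA -!(mulmxA (invmx L)) -A1E /A1.
by rewrite -!mulmxA mulmxV // mulmx1 mulmxA mulVmx // mul1mx.
Qed.
End Bruhat.

(** * South-west ranks *)

Section CornerRank.
Variables (k : fieldType) (N : nat).
Implicit Types (f b M : 'M[k]_N).

Lemma rank_corner f b M : f *m f = f -> f *m b = f *m b *m f -> b \in unitmx ->
  \rank (f *m (b *m M)) = \rank (f *m M).
Proof.
move=> ff fb bu; apply/eqP; rewrite eqn_leq; apply/andP; split.
  by rewrite mulmxA fb -!mulmxA mulmxA mxrankM_maxr.
have -> : f *m M = f *m invmx b *m (f *m (b *m M)).
  rewrite !mulmxA -(corner_inv ff fb bu) -(mulmxA f) mulVmx // mulmx1 //.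
exact: mxrankM_maxr.
Qed.

Lemma rank_corner_r f b M : f *m f = f -> b *m f = f *m b *m f -> b \in unitmx ->
  \rank (M *m b *m f) = \rank (M *m f).
Proof.
move=> ff bf bu; rewrite -mxrank_tr -[RHS]mxrank_tr !trmx_mul; apply: rank_corner.
- by rewrite -trmx_mul ff.
- by rewrite -!trmx_mul {1}bf !mulmxA.
- by rewrite unitmx_tr.
Qed.

Lemma rank_pm_ind (u : 'S_N) (P R : pred 'I_N) :
  \rank (ind k P *m pm k u *m ind k R) = #|[set q | P (u q) && R q]|.
Proof.
have -> : ind k P *m pm k u *m ind k R = pm k u *m ind k (fun q => P (u q) && R q).
  apply/matrixP => i j; rewrite !mul_mx_diag mul_diag_mx !mxE.
  case: eqP => [->|_]; last by rewrite mulr0 !mul0r.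
  by case: (P _); case: (R _); rewrite ?mul1r ?mul0r ?mulr0.
have rf : row_free (pm k u)^T by rewrite row_free_unit unitmx_tr pm_unit.
rewrite -mxrank_tr trmx_mul mxrankMfree // mxrank_tr rank_ind cardsE.
by apply: eq_card.
Qed.
End CornerRank.

Section Permutations.
Variables (k : closedFieldType) (n : nat) (d : 'I_n.+1 -> nat) (Q : quiverA n).
Local Notation N := (dimtot d).
Local Notation colv := (@colv n d Q).
Local Notation rowv := (@rowv n d Q).
Local Notation rk p := (rkey Q (rowv p)).
Local Notation ck q := (ckey Q (colv q)).

Lemma rank_swsub (A : 'M[k]_N) x y :
  \rank (swsub Q A x y) =
  \rank (ind k (fun p => rkey Q x <= rk p)%N *m A *m ind k (fun q => ck q <= ckey Q y)%N).
Proof.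
rewrite rank_mxsub; try exact: enum_val_inj.
congr (\rank (_ *m _ *m _)); apply: eq_ind => p /=.
  apply/codomP/idP => [[i ->]|h].
    by have := enum_valP i; rewrite inE preceq_rowseq.
  have h' : p \in swrows d Q x by rewrite inE preceq_rowseq.
  by exists (enum_rank_in h' p); rewrite enum_rankK_in.
apply/codomP/idP => [[i ->]|h].
  by have := enum_valP i; rewrite inE preceq_colseq.
have h' : p \in swcols d Q y by rewrite inE preceq_colseq.
by exists (enum_rank_in h' p); rewrite enum_rankK_in.
Qed.

Definition rowupper (b : 'M[k]_N) := forall p q, (rk q < rk p)%N -> b p q = 0.
Definition colupper (b : 'M[k]_N) := forall p q, (ck q < ck p)%N -> b p q = 0.

Lemma uptrig_rowupper b : uptrig b -> rowupper b.
Proof. by move=> ub p q h; apply: ub; apply: (@row_lt_key _ _ Q). Qed.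

Lemma uptrig_colupper b : uptrig b -> colupper b.
Proof. by move=> ub p q h; apply: ub; apply: (@col_lt_key _ _ Q). Qed.

Lemma ind_id (P : pred 'I_N) : ind k P *m ind k P = ind k P.
Proof.
apply/matrixP => i j; rewrite mul_diag_mx !mxE; case: (i == j); rewrite ?mulr0 //.
by case: (P i); rewrite ?mul1r ?mul0r.
Qed.

(** Block upper triangular factors preserve the flags that cut out the
    south-west submatrices. *)
Lemma rank_swsub_mul (b h A : 'M[k]_N) x y :
  b \in unitmx -> rowupper b -> h \in unitmx -> colupper h ->
  \rank (swsub Q (b *m A *m h) x y) = \rank (swsub Q A x y).
Proof.
move=> bu ub hu uh; rewrite !rank_swsub -(mulmxA b) !mulmxA rank_corner_r ?ind_id //; last first.
  apply/matrixP => i j; rewrite !mul_mx_diag mul_diag_mx !mxE.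
  case: (leqP (ck j)) => hj; last by rewrite !mulr0.
  case: (leqP (ck i)) => hi; rewrite ?mul1r // uh ?mul0r ?mulr0 //.
  exact: leq_ltn_trans hj hi.
rewrite -mulmxA -(mulmxA _ b) rank_corner ?ind_id ?mulmxA //.
apply/matrixP => i j; rewrite mul_mx_diag mul_diag_mx !mxE.
case: (leqP (rkey Q x) (rk i)) => hi; last by rewrite !mul0r.
case: (leqP (rkey Q x) (rk j)) => hj; rewrite ?mulr1 // ub ?mulr0 //.
exact: leq_trans hj hi.
Qed.

Definition blkcount (u : 'S_N) x y := #|[set q | (rowv (u q) == x) && (colv q == y)]|.

(** The block counts are second differences of the south-west ranks. *)
Lemma blkcount_rank (u u' : 'S_N) :
  (forall x y, \rank (swsub Q (pm k u) x y) = \rank (swsub Q (pm k u') x y)) ->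
  forall x y, blkcount u x y = blkcount u' x y.
Proof.
move=> eqr.
(* The south-west ranks, as functions of integer bounds that need not be keys
   of vertices. *)
pose NN (w : 'S_N) a b := #|[set q | (a <= rk (w q))%N && (ck q < b)%N]|.
have eN a b : NN u a b = NN u' a b.
  have [x hx|nx] := pickP (fun x : 'I_n.+1 => a <= rkey Q x)%N; last first.
    by rewrite /NN !(@eq_card0 _ (mem (finset _))) // => q; rewrite !inE nx.
  have [y hy|ny] := pickP (fun y : 'I_n.+1 => ckey Q y < b)%N; last first.
    by rewrite /NN !(@eq_card0 _ (mem (finset _))) // => q; rewrite !inE ny andbF.
  case: (@arg_minnP _ x (fun x => a <= rkey Q x)%N (fun x : 'I_n.+1 => rkey Q x) hx) => x0 hx0 mx.
  case: (@arg_maxnP _ y (fun y => ckey Q y < b)%N (fun x : 'I_n.+1 => ckey Q x) hy) => y0 hy0 my.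
  have := eqr x0 y0; rewrite !rank_swsub !rank_pm_ind /NN => h.
  transitivity #|[set q | (rkey Q x0 <= rk (u q))%N && (ck q <= ckey Q y0)%N]|.
    apply: eq_card => q; rewrite !inE; congr andb.
      by apply/idP/idP => [/mx|/(leq_trans hx0)].
    by apply/idP/idP => [/my|/leq_ltn_trans->].
  rewrite h; apply: eq_card => q; rewrite !inE; congr andb.
    by apply/idP/idP => [/(leq_trans hx0)|/mx].
  by apply/idP/idP => [/leq_ltn_trans->|/my].
have split w a b : (NN w a b.+1 + NN w a.+1 b = NN w a b + NN w a.+1 b.+1 + 
    #|[set q | (rk (w q) == a) && (ck q == b)]|)%N.
  rewrite /NN -(cardsID [set q | (a < rk (w q))%N] [set q | (a <= rk (w q))%N && (ck q < b.+1)%N]).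
  rewrite -(cardsID [set q | (a < rk (w q))%N] [set q | (a <= rk (w q))%N && (ck q < b)%N]).
  have -> : [set q | (a <= rk (w q))%N && (ck q < b.+1)%N] :&: [set q | (a < rk (w q))%N] =
    [set q | (a < rk (w q))%N && (ck q < b.+1)%N].
    by apply/setP => q; rewrite !inE; lia.
  have -> : [set q | (a <= rk (w q))%N && (ck q < b)%N] :&: [set q | (a < rk (w q))%N] =
    [set q | (a < rk (w q))%N && (ck q < b)%N].
    by apply/setP => q; rewrite !inE; lia.
  have -> : #|[set q | (a <= rk (w q))%N && (ck q < b.+1)%N] :\: [set q | (a < rk (w q))%N]| =
    (#|[set q | (a <= rk (w q))%N && (ck q < b)%N] :\: [set q | (a < rk (w q))%N]| +
    #|[set q | (rk (w q) == a) && (ck q == b)]|)%N.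
    rewrite -cardsUI [X in (_ = _ + #|pred_of_set X|)%N](_ : _ = set0) ?cards0 ?addn0.
      by apply: eq_card => q; rewrite !inE; lia.
    by apply/setP => q; rewrite !inE; lia.
  by lia.
move=> x y; have := split u (rkey Q x) (ckey Q y); have := split u' (rkey Q x) (ckey Q y).
rewrite !eN => h h'; have e w : blkcount w x y = #|[set q | (rk (w q) == rkey Q x) && (ck q == ckey Q y)]|.
  apply: eq_card => q; rewrite !inE; congr andb.
    by apply/eqP/eqP => [->//|/rkey_inj].
  by apply/eqP/eqP => [->//|/ckey_inj].
by rewrite !e; lia.
Qed.

End Permutations.

(** * Permutations of Z-type *)

Section Sorting.
Local Open Scope nat_scope.
Variable N : nat.

Lemma card_count (P : pred 'I_N) : #|[set i | P i]| = count P (enum 'I_N).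
Proof. by rewrite cardsE cardE -size_filter /enum_mem -filter_predI; congr size; apply: eq_filter => i /=; rewrite andbT. Qed.

(** A monotone function on [0, N) is determined by the sizes of its fibres. *)
Lemma monotone_fibres (f g : 'I_N -> nat) :
  (forall i j : 'I_N, (i <= j)%N -> (f i <= f j)%N) ->
  (forall i j : 'I_N, (i <= j)%N -> (g i <= g j)%N) ->
  (forall c, #|[set i | f i == c]| = #|[set i | g i == c]|) -> f =1 g.
Proof.
move=> mf mg fg.
have so (h : 'I_N -> nat) : (forall i j : 'I_N, (i <= j)%N -> (h i <= h j)%N) ->
    sorted leq (map h (enum 'I_N)).
  move=> mh; rewrite sorted_pairwise; last exact: leq_trans.
  rewrite pairwise_map; apply: (@sub_pairwise _ (relpre val leq)) => [i j|]; first exact: mh.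
  rewrite -pairwise_map val_enum_ord -sorted_pairwise ?iota_sorted //.
  exact: leq_trans.
have e : map f (enum 'I_N) = map g (enum 'I_N).
  apply: (sorted_eq leq_trans anti_leq (so _ mf) (so _ mg)).
  apply/allP => c _ /=; rewrite count_map [X in _ == X]count_map.
  by apply/eqP; have := fg c; rewrite !card_count; apply.
by move=> i; have /eq_in_map := e; apply; rewrite mem_enum.
Qed.

Lemma card_set_perm (s : 'S_N) (P : pred 'I_N) : #|[set i | P (s i)]| = #|[set i | P i]|.
Proof.
rewrite -(card_imset _ (@perm_inj _ s)); apply: eq_card => i; rewrite !inE.
apply/imsetP/idP => [[j]|Pi]; first by rewrite inE => Pj ->.
by exists (s^-1 i)%g; rewrite ?inE permKV.
Qed.

Lemma perm_order_eq (w w' : 'S_N) :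
  (forall q q', (w q < w q')%N -> (w' q < w' q')%N) -> w = w'.
Proof.
move=> h; have e : (fun i => nat_of_ord (w' (w^-1 i)%g)) =1 (@nat_of_ord N).
  apply: monotone_fibres => // [i j|c].
    rewrite leq_eqVlt => /orP[/eqP/val_inj->//|lt]; apply: ltnW; apply: h.
    by rewrite !permKV.
  have := card_set_perm (w^-1 * w')%g (fun i => nat_of_ord i == c).
  by under eq_finset do rewrite permM.
by apply/permP => q; apply: val_inj; have := e (w q); rewrite permK.
Qed.

Lemma sort_perm (K : 'I_N -> nat) : injective K ->
  exists s : 'S_N, forall i j, (s i < s j)%N = (K i < K j)%N.
Proof.
move=> Kinj.
have lt i : (#|[set j | (K j < K i)%N]| < N)%N.
  rewrite -[X in (_ < X)%N]card_ord; apply: proper_card.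
  apply/properP; split; first by apply/subsetP.
  by exists i; rewrite ?inE // ltnn.
pose r i := Ordinal (lt i).
have rlt i j : (r i < r j)%N = (K i < K j)%N.
  rewrite /=; apply/idP/idP => [|ij]; last first.
    apply: proper_card; apply/properP; split.
      by apply/subsetP => l; rewrite !inE => /ltn_trans->.
    by exists i; rewrite !inE ?ltnn.
  apply: contraLR; rewrite -!leqNgt => ji; apply: subset_leq_card.
  by apply/subsetP => l; rewrite !inE => /leq_trans->.
have rinj : injective r.
  move=> i j e; have := rlt i j; have := rlt j i; rewrite e ltnn.
  by move=> /esym/negbT + /esym/negbT; rewrite -!leqNgt => a b; apply: Kinj; apply/eqP; rewrite eqn_leq a b.
by exists (perm rinj) => i j; rewrite !permE.
Qed.

Lemma lex_lt M a b a' b' : (b < M)%N -> (b' < M)%N ->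
  (a * M + b < a' * M + b')%N = (a < a')%N || (a == a') && (b < b')%N.
Proof. by move=> bM b'M; case: (ltngtP a a') => [h|h|->] /=; [nia|nia|lia]. Qed.

Lemma lex_inj M a b a' b' : (b < M)%N -> (b' < M)%N ->
  (a * M + b = a' * M + b')%N -> a = a' /\ b = b'.
Proof.
move=> bM b'M e; have M0 : (0 < M)%N by apply: leq_ltn_trans bM.
split; first by have := congr1 (divn^~ M) e; rewrite /= !divnMDl // !divn_small // !addn0.
by have := congr1 (modn^~ M) e; rewrite /= !modnMDl !modn_small.
Qed.

Lemma lex3_lt M N' a b c a' b' c' : (b < M)%N -> (b' < M)%N -> (c < N')%N -> (c' < N')%N ->
  ((a * M + b) * N' + c < (a' * M + b') * N' + c')%N =
  (a < a')%N || (a == a') && ((b < b')%N || (b == b') && (c < c')%N).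
Proof.
move=> bM b'M cN c'N; rewrite lex_lt // lex_lt //.
have -> : (a * M + b == a' * M + b')%N = (a == a') && (b == b').
  by apply/eqP/andP => [/lex_inj[] // -> ->|[/eqP-> /eqP->]].
by case: (ltngtP a a') => //=; case: (ltngtP b b').
Qed.

End Sorting.

Section ZType.
Local Open Scope nat_scope.
Variables (n : nat) (d : 'I_n.+1 -> nat) (Q : quiverA n).
Local Notation N := (dimtot d).
Local Notation colv := (@colv n d Q).
Local Notation rowv := (@rowv n d Q).
Local Notation rk p := (rkey Q (rowv p)).
Local Notation ck q := (ckey Q (colv q)).
Implicit Types (u w : 'S_N).

(** The Z-type in terms of the relative positions of the ones: in a block row,
    in a block column, and in a block. *)
Definition zorder w :=
  [/\ forall q q', rowv (w q) = rowv (w q') -> (ck q < ck q')%N -> (w q' < w q)%N,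
      forall q q', colv q = colv q' -> (rk (w q) < rk (w q'))%N -> (q < q')%N &
      forall q q', rowv (w q) = rowv (w q') -> colv q = colv q' -> (q < q')%N -> (w q < w q')%N].

Lemma card_label_lt (S : seq 'I_n.+1) (SE : perm_eq S (enum 'I_n.+1)) (x : 'I_n.+1) m :
  (m <= d x)%N ->
  #|[set p : 'I_N | (tag (label SE p) == x) && (tagged (label SE p) < m)%N]| = m.
Proof.
move=> md; have bij : bijective (@label n d S SE).
  by apply: inj_card_bij (@label_inj n d S SE) _; rewrite card_labels.
rewrite -(card_imset _ (bij_inj bij)).
transitivity #|[set Tagged (fun x => 'I_(d x)) (widen_ord md i) | i : 'I_m]|.
  apply: eq_card => u; apply/imsetP/imsetP => [[p]|[i _ ->]].
    rewrite inE => /andP[/eqP e lt] ->; exists (Ordinal lt) => //.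
    by apply: eq_label => //=.
  have [f _ K] := bij; exists (f (Tagged (fun x => 'I_(d x)) (widen_ord md i))); rewrite ?K //.
  by rewrite inE K /= eqxx ltn_ord.
rewrite card_imset ?card_ord // => i j e; apply: val_inj.
by have := congr1 (fun u : {x : 'I_n.+1 & 'I_(d x)} => nat_of_ord (tagged u)) e.
Qed.

Lemma card_row (x : 'I_n.+1) : #|[set p | rowv p == x]| = d x.
Proof.
rewrite -[RHS](card_label_lt (perm_rowseq Q) (leqnn (d x))).
apply: eq_card => p; rewrite !inE; case: eqP => //= <-.
by rewrite ltn_ord.
Qed.

Lemma card_col (x : 'I_n.+1) : #|[set p | colv p == x]| = d x.
Proof.
rewrite -[RHS](card_label_lt (perm_colseq Q) (leqnn (d x))).
apply: eq_card => p; rewrite !inE; case: eqP => //= <-.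
by rewrite ltn_ord.
Qed.

Lemma rowoff_card (p : 'I_N) : rowoff Q p = #|[set p' : 'I_N | (rowv p' == rowv p) && (p' < p)%N]|.
Proof.
have lt : (rowoff Q p <= d (rowv p))%N by apply: ltnW; exact: ltn_ord.
rewrite -[LHS](card_label_lt (perm_rowseq Q) lt); apply: eq_card => p'; rewrite !inE.
by case: eqP => //= e; rewrite (row_lt_off e).
Qed.

Lemma coloff_card (p : 'I_N) : coloff Q p = #|[set p' : 'I_N | (colv p' == colv p) && (p' < p)%N]|.
Proof.
have lt : (coloff Q p <= d (colv p))%N by apply: ltnW; exact: ltn_ord.
rewrite -[LHS](card_label_lt (perm_colseq Q) lt); apply: eq_card => p'; rewrite !inE.
by case: eqP => //= e; rewrite (col_lt_off e).
Qed.

(** The offsets of the identity in the block ([x], [y]) are the number of ones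
    further east in the block row and that of ones further north in the block
    column; by counting, there are no gaps. *)
Lemma z_typeP w : z_type Q w <-> zorder w.
Proof.
split=> [[z1 z2 z3]|[z2 z3 z1]].
  split=> [q q' e lt|q q' e lt|q q' e1 e2 lt].
  - by apply: z2; rewrite // prec_colseq.
  - by apply: z3; rewrite // prec_rowseq.
  have [a0 [b0 [m [_ _ h]]]] := z1 (rowv (w q)) (colv q).
  have := h _ _ erefl erefl; rewrite eqxx => /esym/existsP[t /andP[/eqP r1 /eqP c1]].
  have := h _ _ (esym e1) (esym e2); rewrite eqxx => /esym/existsP[t' /andP[/eqP r2 /eqP c2]].
  by move: lt; rewrite (col_lt_off e2) (row_lt_off e1) r1 r2 c1 c2 !ltn_add2l.
split=> [x y|q q' e|q q' e]; last 2 first.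
- by rewrite prec_colseq; exact: z2.
- by rewrite prec_rowseq; exact: z3.
(* The ones further east in the block row, those further north in the block
   column, those in the block; [t q] is the rank of [q] among the last. *)
pose A := [set q | (rowv (w q) == x) && (ckey Q y < ck q)%N].
pose B := [set q | (colv q == y) && (rk (w q) < rkey Q x)%N].
pose C := [set q | (rowv (w q) == x) && (colv q == y)].
pose t q := #|[set q' : 'I_N | (q' \in C) && (q' < q)%N]|.
have rowE q : q \in C -> rowoff Q (w q) = (#|A| + t q)%N.
  rewrite inE => /andP[/eqP e1 /eqP e2]; rewrite rowoff_card e1.
  rewrite -(card_set_perm w (fun p' => (rowv p' == x) && (p' < w q)%N)).
  rewrite /t -cardsUI [X in (_ = _ + #|pred_of_set X|)%N](_ : _ = set0).
    rewrite cards0 addn0; apply: eq_card => q'; rewrite !inE.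
    case: eqP => //= e1'; case: (ltngtP (ckey Q y) (ck q')) => h /=.
    - by rewrite (z2 q q') // ?e1 ?e1' // e2.
    - rewrite (_ : (colv q' == y) = false); last by apply: contraTF h => /eqP->; rewrite ltnn.
      by apply/negbTE; rewrite -leqNgt; apply: ltnW; apply: z2; rewrite ?e1 ?e1' // e2.
    move/ckey_inj: h => h; rewrite -h eqxx /=; apply/idP/idP => [lt|]; last first.
      by apply: z1; rewrite ?e1 ?e1' // e2.
    rewrite ltnNge leq_eqVlt; apply/norP; split.
      by apply: contraTneq lt => /val_inj ->; rewrite ltnn.
    apply: contraTN lt => lt; rewrite -leqNgt ltnW //.
    by apply: z1; rewrite ?e1 ?e1' // e2.
  apply/setP => q'; rewrite !inE; case: (eqVneq (colv q') y) => [->|_]; rewrite ?ltnn ?andbF //=.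
have colE q : q \in C -> coloff Q q = (#|B| + t q)%N.
  rewrite inE => /andP[/eqP e1 /eqP e2]; rewrite coloff_card e2.
  rewrite /t -cardsUI [X in (_ = _ + #|pred_of_set X|)%N](_ : _ = set0).
    rewrite cards0 addn0; apply: eq_card => q'; rewrite !inE.
    case: (eqVneq (colv q') y) => //= e2'; rewrite ?andbF ?andbT //.
    case: (ltngtP (rk (w q')) (rkey Q x)) => h /=.
    - by rewrite (z3 q' q) // ?e1 // e2.
    - rewrite (_ : (rowv (w q') == x) = false); last by apply: contraTF h => /eqP->; rewrite ltnn.
      by apply/negbTE; rewrite -leqNgt; apply: ltnW; apply: z3; rewrite ?e1 // e2.
    by move/rkey_inj: h => h; rewrite h eqxx.
  apply/setP => q'; rewrite !inE; apply/negbTE/negP.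
  by case/andP => /andP[_ h] /andP[/andP[/eqP e _] _]; rewrite e ltnn in h.
exists #|A|, #|B|, #|C|; split.
- rewrite -(card_row x) -(card_set_perm w) -cardsUI.
  rewrite [X in (_ + #|pred_of_set X| <= _)%N](_ : _ = set0) ?cards0 ?addn0.
    by apply: subset_leq_card; apply/subsetP => q; rewrite !inE => /orP[]/andP[].
  by apply/setP => q; rewrite !inE; case: eqP => //= _; case: eqP => [->|]; rewrite ?ltnn ?andbF.
- rewrite -(card_col y) -cardsUI.
  rewrite [X in (_ + #|pred_of_set X| <= _)%N](_ : _ = set0) ?cards0 ?addn0.
    by apply: subset_leq_card; apply/subsetP => q; rewrite !inE => /orP[]/andP[].
  by apply/setP => q; rewrite !inE; case: (eqVneq (rowv (w q)) x) => [->|] /=; rewrite ?ltnn ?andbF.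
have tlt q : q \in C -> (t q < #|C|)%N.
  move=> qC; apply: proper_card; apply/properP; split.
    by apply/subsetP => q'; rewrite inE => /andP[].
  by exists q => //; rewrite inE ltnn andbF.
move=> p q px qy; apply/eqP/existsP => [e|[t0 /andP[/eqP r0 /eqP c0]]].
  have qC : q \in C by rewrite inE -e px qy !eqxx.
  by exists (Ordinal (tlt _ qC)); rewrite e rowE // colE // !eqxx.
have qC : q \in C.
  rewrite inE qy eqxx andbT; case: (ltngtP (rk (w q)) (rkey Q x)) => h; last by rewrite (rkey_inj h).
    exfalso; suff : (coloff Q q < #|B|)%N by rewrite c0; lia.
    rewrite coloff_card qy; apply: proper_card; apply/properP; split.
      apply/subsetP => q'; rewrite !inE => /andP[/eqP e lt]; rewrite e eqxx /=.
      apply: leq_ltn_trans h; rewrite leqNgt; apply/negP => /z3.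
      by rewrite qy e => /(_ erefl); lia.
    by exists q; rewrite !inE ?qy ?eqxx ?h // ltnn andbF.
  exfalso; suff : (#|B| + #|C| <= coloff Q q)%N by rewrite c0; have := ltn_ord t0; lia.
  rewrite -cardsUI [X in (_ + #|pred_of_set X| <= _)%N](_ : _ = set0).
    rewrite cards0 addn0 coloff_card qy; apply: subset_leq_card; apply/subsetP => q'.
    rewrite !inE => /orP[/andP[/eqP e lt]|/andP[/eqP e1 /eqP e]]; rewrite e eqxx /=.
      by apply: z3; rewrite ?qy //; apply: ltn_trans h.
    by apply: z3; rewrite ?qy // e1.
  apply/setP => q'; rewrite !inE; apply/negbTE/negP.
  by case/andP => /andP[_ h'] /andP[/eqP e _]; rewrite e ltnn in h'.
have ex : rowv (w q) = x by move: qC; rewrite inE => /andP[/eqP].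
apply: (@rowlab_inj n d Q); apply: eq_label; first exact: etrans px (esym ex).
have te : t q = t0 by apply: (@addnI #|B|); rewrite -colE // c0.
by have := rowE _ qC; rewrite te -r0 => /esym.
Qed.
End ZType.

Section ZOrder.
Local Open Scope nat_scope.
Variables (n : nat) (d : 'I_n.+1 -> nat) (Q : quiverA n).
Local Notation N := (dimtot d).
Local Notation colv := (@colv n d Q).
Local Notation rowv := (@rowv n d Q).
Local Notation rk p := (rkey Q (rowv p)).
Local Notation ck q := (ckey Q (colv q)).
Local Notation zorder := (@zorder n d Q).
Local Notation blkcount := (@blkcount n d Q).
Implicit Types (u w : 'S_N).

Let M := n.*2.+1.

Lemma rk_lt p : (rk p < M)%N.
Proof. by rewrite /rkey /M; have := ltn_ord (rowv p); case: ifP => _; lia. Qed.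

Lemma ck_lt p : (ck p < M)%N.
Proof. by rewrite /ckey /M; have := ltn_ord (colv p); case: ifP => _; lia. Qed.

Lemma rk_mono (p q : 'I_N) : (p <= q)%N -> (rk p <= rk q)%N.
Proof. by move=> le; rewrite leqNgt; apply/negP => /row_lt_key; rewrite ltnNge le. Qed.

Lemma ck_mono (p q : 'I_N) : (p <= q)%N -> (ck p <= ck q)%N.
Proof. by move=> le; rewrite leqNgt; apply/negP => /col_lt_key; rewrite ltnNge le. Qed.

Definition negck q := (n.*2 - ck q)%N.

Lemma negck_lt p : (negck p < M)%N. Proof. by rewrite /negck /M; lia. Qed.

Lemma negck_ltE p q : (negck p < negck q)%N = (ck q < ck p)%N.
Proof. by rewrite /negck; have := ck_lt p; have := ck_lt q; rewrite /M; lia. Qed.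

(** Sort the ones of [u] by block row and decreasing block column to assign
    the rows, and by block column and block row to assign the columns. *)
Lemma zorder_exists u : exists2 w, zorder w & forall x y, blkcount w x y = blkcount u x y.
Proof.
have NN (q : 'I_N) : (q < N)%N := ltn_ord q.
(* Lexicographic keys; ties are broken by [q], so that the ones of a block
   keep their order by columns on both sides. *)
pose Kr (q : 'I_N) := ((rk (u q) * M + negck q) * N + q)%N.
pose Kc (q : 'I_N) := ((ck q * M + rk (u q)) * N + q)%N.
have Kri : injective Kr by move=> q q' /lex_inj [] // _ /val_inj.
have Kci : injective Kc by move=> q q' /lex_inj [] // _ /val_inj.
have [r rE] := sort_perm Kri; have [c cE] := sort_perm Kci.
have rlt q q' : (r q < r q')%N = (rk (u q) < rk (u q'))%N || (rk (u q) == rk (u q')) &&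
    ((ck q' < ck q)%N || (ck q == ck q') && (q < q')%N).
  rewrite rE /Kr lex3_lt ?negck_lt // negck_ltE.
  suff -> : (negck q == negck q') = (ck q == ck q') by [].
  have l1 := ck_lt q; have l2 := ck_lt q'; rewrite /M in l1 l2.
  by rewrite /negck; apply/eqP/eqP => h; lia.
have clt q q' : (c q < c q')%N = (ck q < ck q')%N || (ck q == ck q') &&
    ((rk (u q) < rk (u q'))%N || (rk (u q) == rk (u q')) && (q < q')%N).
  by rewrite cE /Kc lex3_lt ?rk_lt.
have rr q : rowv (r q) = rowv (u q).
  have e : (fun p => rk p) =1 (fun p => rk (u (r^-1 p)%g)).
    apply: monotone_fibres => [|i j ij|a]; first exact: rk_mono.
      rewrite leqNgt; apply/negP => lt.
      have := rlt (r^-1 j)%g (r^-1 i)%g; rewrite lt !permKV; lia.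
    have := card_set_perm (r^-1 * u)%g (fun p => rk p == a).
    by under eq_finset do rewrite permM; move=> ->.
  by have := e (r q); rewrite permK => /rkey_inj.
have cc q : colv (c q) = colv q.
  have e : (fun p => ck p) =1 (fun p => ck (c^-1 p)%g).
    apply: monotone_fibres => [|i j ij|a]; first exact: ck_mono.
      rewrite leqNgt; apply/negP => lt.
      have := clt (c^-1 j)%g (c^-1 i)%g; rewrite lt !permKV; lia.
    by have := card_set_perm (c^-1)%g (fun p => ck p == a).
  by have := e (c q); rewrite permK => /ckey_inj.
have wE q : (c^-1 * r)%g (c q) = r q by rewrite permM permK.
have surj q : exists q0, q = c q0 by exists (c^-1 q)%g; rewrite permKV.
exists (c^-1 * r)%g.
  split=> q q'; have [a ->] := surj q; have [b ->] := surj q'; rewrite !wE !rr !cc.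
  - by move=> e lt; rewrite rlt e eqxx lt /= orbT.
  - by move=> e lt; rewrite clt e eqxx lt /= orbT.
  - by move=> e1 e2; rewrite clt rlt e1 e2 !eqxx !ltnn /=.
move=> x y; rewrite /blkcount.
rewrite -(card_set_perm c (fun q => (rowv ((c^-1 * r)%g q) == x) && (colv q == y))).
by apply: eq_card => q; rewrite !inE wE rr cc.
Qed.

Lemma blkcount_pair (f : nat -> nat -> nat) u w :
    (forall p q p' q', f (rk p) (ck q) = f (rk p') (ck q') -> rk p = rk p' /\ ck q = ck q') ->
    (forall x y, blkcount u x y = blkcount w x y) ->
  forall a, #|[set q | f (rk (u q)) (ck q) == a]| = #|[set q | f (rk (w q)) (ck q) == a]|.
Proof.
move=> finj e a.
have [q0 /= q0E|nq] := pickP (fun pq : 'I_N * 'I_N => f (rk pq.1) (ck pq.2) == a); last first.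
  have z v : #|[set q | f (rk (v q)) (ck q) == a]| = 0.
    by apply: eq_card0 => q; rewrite !inE; exact: (nq (v q, q)).
  by rewrite !z.
have h (v : 'S_N) : #|[set q | f (rk (v q)) (ck q) == a]| = blkcount v (rowv q0.1) (colv q0.2).
  apply: eq_card => q; rewrite !inE -(eqP q0E); apply/eqP/andP => [/finj[]|[/eqP-> /eqP->]//].
  by move=> /rkey_inj -> /ckey_inj ->.
by rewrite !h e.
Qed.

(** Along the columns, the pairs (block column, block row) of the ones
    increase, with multiplicities that are the block counts; this determines
    the block row of each one. *)
Lemma zorder_unique w w' : zorder w -> zorder w' ->
  (forall x y, blkcount w x y = blkcount w' x y) -> w = w'.
Proof.
move=> [z2 z3 z1] [z2' z3' z1'] e.
have mono v : zorder v -> forall i j : 'I_N, (i <= j)%N ->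
    (ck i * M + rk (v i) <= ck j * M + rk (v j))%N.
  move=> [y2 y3 y1] i j ij; rewrite leqNgt; apply/negP; rewrite lex_lt ?rk_lt //.
  case/orP => [/col_lt_key|/andP[/eqP/ckey_inj ec /(y3 _ _ ec)]]; lia.
have er q : rowv (w q) = rowv (w' q).
  have h : (fun q => ck q * M + rk (w q))%N =1 (fun q => ck q * M + rk (w' q))%N.
    apply: monotone_fibres; [exact: mono|exact: mono|].
    apply: (@blkcount_pair (fun a b => b * M + a)%N) => // p q1 p' q2 /lex_inj[]; rewrite ?rk_lt //.
  by have /lex_inj[] := h q; rewrite ?rk_lt // => _ /rkey_inj.
apply: perm_order_eq => q q' lt.
case: (ltngtP (rk (w q)) (rk (w q'))) => [h|h|/rkey_inj h].
- by apply: (@row_lt_key _ _ Q); rewrite -!er.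
- by have := row_lt_key h; lia.
case: (ltngtP (ck q) (ck q')) => [h'|h'|/ckey_inj h'].
- by have := z2 _ _ h h'; lia.
- by apply: z2'; rewrite // -!er.
case: (ltngtP q q') => [h2|h2|/val_inj h2].
- by apply: z1'; rewrite // -!er.
- by have := z1 _ _ (esym h) (esym h') h2; lia.
- by rewrite h2 ltnn in lt.
Qed.

(** Every permutation with the block counts of [w] is reached from [w] (up to
    column permutations inside the blocks) by exchanging two rows of the same
    block row; the exchanges always go down in Bruhat order. *)
Lemma zorder_chain w (P : 'S_N -> Prop) : zorder w ->
    (forall t : 'S_N, (forall q, colv (t q) = colv q) -> P (t * w)%g) ->
    (forall u (i j : 'I_N), (i < j)%N -> rowv i = rowv j ->
      (ck (u^-1 i)%g < ck (u^-1 j)%g)%N -> P (u * tperm i j)%g -> P u) ->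
  forall u, (forall x y, blkcount u x y = blkcount w x y) -> P u.
Proof.
move=> [z2 z3 z1] Pb Ps u.
(* The exchange of rows decreases this sum, since it pairs the larger row with
   the smaller column key. *)
have [m] := ubnP (\sum_q (u q : nat) * ck q)%N; elim: m u => // m IH u lem e.
have [[i j] /= /and3P[ij /eqP er ec]|no] := pickP (fun ij : 'I_N * 'I_N =>
  [&& (ij.1 < ij.2)%N, rowv ij.1 == rowv ij.2 & (ck (u^-1 ij.1)%g < ck (u^-1 ij.2)%g)%N]).
  apply: (Ps u i j ij er ec); apply: IH; last first.
    move=> x y; rewrite -e; apply: eq_card => q; rewrite !inE permM; congr andb.
    by case: tpermP => [->|->|//]; rewrite er.
  rewrite ltnS in lem; apply: leq_trans lem.
  set a := (u^-1 i)%g in ec; set b := (u^-1 j)%g in ec.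
  have ua : u a = i by rewrite /a permKV.
  have ub : u b = j by rewrite /b permKV.
  have ab : b != a by apply: contraTneq ec => ->; rewrite ltnn.
  rewrite (bigD1 a) //= (bigD1 b) //= [X in (_ < X)%N](bigD1 a) //= [X in (_ < _ + X)%N](bigD1 b) //=.
  rewrite !permM ua ub tpermL tpermR !addnA.
  rewrite (eq_bigr (fun q => u q * ck q)%N) ?ltn_add2r; first by nia.
  move=> q /andP[qa qb]; rewrite permM tpermD //.
    by rewrite -ua (inj_eq perm_inj) eq_sym.
  by rewrite -ub (inj_eq perm_inj) eq_sym.
have mono (v : 'S_N) : (forall i j : 'I_N, (i < j)%N -> rowv i = rowv j -> (ck (v^-1 j)%g <= ck (v^-1 i)%g)%N) ->
    forall i j : 'I_N, (i <= j)%N ->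
    (rk i * M + negck (v^-1 i)%g <= rk j * M + negck (v^-1 j)%g)%N.
  move=> hv i j; rewrite leq_eqVlt => /orP[/eqP/val_inj->//|ij].
  rewrite leqNgt; apply/negP; rewrite lex_lt ?negck_lt // negck_ltE.
  case/orP => [/row_lt_key|/andP[/eqP/rkey_inj er]]; first by lia.
  by have := hv _ _ ij (esym er); lia.
have eu : (fun p => rk p * M + negck (u^-1 p)%g)%N =1 (fun p => rk p * M + negck (w^-1 p)%g)%N.
  apply: monotone_fibres => [||a].
  - apply: mono => i j ij er; have /= := no (i, j); rewrite ij er eqxx /=; lia.
  - apply: mono => i j ij er; rewrite leqNgt; apply/negP => lt.
    by have := z2 (w^-1 i)%g (w^-1 j)%g; rewrite !permKV => /(_ er lt); lia.
  have h (v : 'S_N) : #|[set p | rk p * M + negck (v^-1 p)%g == a]%N| =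
      #|[set q | rk (v q) * M + negck q == a]%N|.
    rewrite -(card_set_perm v (fun p => rk p * M + negck (v^-1 p)%g == a)%N).
    by apply: eq_card => q; rewrite !inE permK.
  rewrite !h; apply: (@blkcount_pair (fun a b => a * M + (n.*2 - b))%N) => // p q p' q'.
  move=> /lex_inj[]; try by rewrite /M; lia.
  by have := ck_lt q; have := ck_lt q'; rewrite /M => ? ? -> ?; split=> //; lia.
have -> : u = ((u * w^-1) * w)%g by rewrite mulgKV.
apply: Pb => q; have /lex_inj[] := eu (u q); rewrite ?negck_lt // => _.
rewrite permK permM /negck => h; apply: (@ckey_inj _ Q).
by have := ck_lt q; have := ck_lt (w^-1 (u q))%g; rewrite /M; lia.
Qed.

End ZOrder.

(** * Ranks of the rows of arrows *)

Section Idempotent.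
Variables (k : fieldType) (N : nat).
Implicit Types (P S e : 'M[k]_N).

(** Modulo the row space of [P], the matrix [S] may be replaced by
    [S (1 - P)], whose row space meets that of [P] in 0. *)
Lemma rank_add_idem P S : P *m P = P ->
  \rank (P + S)%MS = (\rank P + \rank (S *m (1%:M - P)))%N.
Proof.
move=> PP; have -> : \rank (P + S)%MS = \rank (P + S *m (1%:M - P))%MS.
  apply/eqmx_rank; apply/andP; rewrite !addsmx_sub !addsmxSl /=; split.
    have eS : S = S *m (1%:M - P) + S *m P by rewrite mulmxBr mulmx1 subrK.
    rewrite {1}eS; apply: addmx_sub; first exact: addsmxSr.
    by apply: submx_trans (addsmxSl _ _); exact: submxMl.
  rewrite mulmxBr mulmx1; apply: addmx_sub; first exact: addsmxSr.
  by rewrite eqmx_opp; apply: submx_trans (addsmxSl _ _); exact: submxMl.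
rewrite mxrank_disjoint_sum //; apply/eqP; rewrite -submx0; apply/rV_subP => u.
rewrite sub_capmx => /andP[/submxP[x ux] /submxP[y uy]].
have u0 : u *m P = 0 by rewrite uy -!mulmxA mulmxBl mul1mx PP subrr !mulmx0.
have -> : u = u *m P by rewrite {2}ux -mulmxA PP.
by rewrite u0 sub0mx.
Qed.

Lemma rank_idem_eq P e : P *m e = e -> e *m P = P -> \rank P = \rank e.
Proof.
move=> Pe eP; apply/eqP; rewrite eqn_leq -{1}eP mxrankM_maxl /=.
by rewrite -{1}Pe mxrankM_maxl.
Qed.
End Idempotent.

Section Incidence.
Variables (k : fieldType) (n N : nat) (c : 'I_N -> 'I_n.+1) (Q : quiverA n).
Local Notation pr := (pr k c).
Local Notation ev := (ev k c).
Local Notation rt := (rt Q).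
Implicit Types (W : 'M[k]_N) (Z : pred nat) (G : {set 'I_n}).

Definition esrc (m : nat) := if rt m then m else m.+1.
Definition etrg (m : nat) := if rt m then m.+1 else m.

(** The block row that the arrow [m] contributes to an incidence matrix. *)
Definition gen W (m : nat) := ev (esrc m) + ev (esrc m) *m W *m ev (etrg m).

Definition gspan W Z G := (\sum_(m in G) gen W m *m pr Z)%MS.
Definition rho W Z G := \rank (gspan W Z G).

Let ge := graded_ev k c.
Let ee i : ev i *m ev i = ev i. Proof. by have [h _ _ _] := ge; exact: h. Qed.
Let eo i j : i != j -> ev i *m ev j = 0. Proof. by move=> ij; have [_ h _ _] := ge; exact: h. Qed.

Lemma ev_pr m X : ev m *m pr X = if X m then ev m else 0.
Proof.
rewrite prM; case: ifP => h.
  by apply: eq_pr => j _; case: eqP => // ->.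
by apply: pr0 => j _; case: eqP => // ->.
Qed.

Lemma pr_ev m X : pr X *m ev m = if X m then ev m else 0.
Proof.
rewrite prM; case: ifP => h.
  by apply: eq_pr => j _; case: eqP => [->|]; rewrite ?h ?andbF.
by apply: pr0 => j _; case: eqP => [->|]; rewrite ?h ?andbF.
Qed.

Lemma gen_prE W m X : gen W m *m pr X =
  (if X (esrc m) then ev (esrc m) else 0) +
  (if X (etrg m) then ev (esrc m) *m W *m ev (etrg m) else 0).
Proof.
rewrite mulmxDl ev_pr -(mulmxA (_ *m W)) ev_pr; congr (_ + _).
by case: ifP; rewrite ?mulmx0.
Qed.

Lemma rho_drop W Z G m : m \in G -> ~~ Z (esrc m) -> ~~ Z (etrg m) ->
  rho W Z G = rho W Z (G :\ m).
Proof.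
move=> mG /negPf s /negPf t; rewrite /rho /gspan (big_setD1 m) //= gen_prE s t addr0.
by rewrite adds0mx.
Qed.

(** Elimination of a coordinate [esrc m]: either the row of [m] is cut down to
    that coordinate, or no other row meets it. *)
Lemma rho_pivot W Z G m : m \in G -> Z (esrc m) ->
  ~~ Z (etrg m) || [forall m' in G :\ m, (esrc m' != esrc m) && (etrg m' != esrc m)] ->
  rho W Z G = (\rank (ev (esrc m)) +
               rho W (fun z => Z z && (z != esrc m)) (G :\ m))%N.
Proof.
move=> mG Zs h; set s := esrc m; set Z' := fun z => _.
have st : etrg m != s by rewrite /s /esrc /etrg; case: ifP => _; apply/eqP; lia.
pose P := gen W m *m pr Z; pose S := gspan W Z (G :\ m).
have PE : P = ev s + (if Z (etrg m) then ev s *m W *m ev (etrg m) else 0).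
  by rewrite /P gen_prE Zs.
have Pe : P *m ev s = ev s.
  rewrite PE mulmxDl ee; case: ifP => _; last by rewrite mul0mx addr0.
  by rewrite -mulmxA eo // mulmx0 addr0.
have eP : ev s *m P = P.
  by rewrite PE mulmxDr ee; case: ifP => _; rewrite ?mulmx0 // !mulmxA ee.
have PP : P *m P = P by rewrite -{2}eP mulmxA Pe eP.
have -> : rho W Z G = \rank (P + S)%MS by rewrite /rho /gspan (big_setD1 m).
rewrite rank_add_idem // (rank_idem_eq Pe eP); congr addn.
rewrite /rho /gspan (sumsmxMr _ _ (1%:M - P)); apply: eqmx_rank.
apply/eqmxP; apply: eqmx_sums => m' m'G.
have -> : gen W m' *m pr Z *m (1%:M - P) = gen W m' *m pr Z'; last by [].
case: (boolP (Z (etrg m))) h => /= [Zt /forallP/(_ m')|nZt _].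
  rewrite m'G /= => /andP[/negPf s1 /negPf t1].
  have g0 : gen W m' *m pr Z *m P = 0.
    rewrite -eP mulmxA gen_prE mulmxDl.
    rewrite (_ : (if _ then _ else 0) *m ev s = 0); last first.
      by case: ifP => _; rewrite ?mul0mx // eo // s1.
    rewrite (_ : (if _ then _ else 0) *m ev s = 0) ?addr0 ?mul0mx //.
    by case: ifP => _; rewrite ?mul0mx // -mulmxA eo ?mulmx0 // t1.
  by rewrite mulmxBr mulmx1 g0 subr0 !gen_prE /Z' s1 t1 !andbT.
have -> : P = ev s by rewrite PE (negPf nZt) addr0.
rewrite -mulmxA; congr (_ *m _); rewrite mulmxBr mulmx1 pr_ev Zs.
apply/matrixP => p q; rewrite !mxE /Z'; case: (p == q); last by rewrite !mulr0n subr0.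
by case: eqP => [->|_]; case: (Z _) Zs => // _; rewrite ?andbT ?andbF ?mulr1n ?subr0 ?subrr.
Qed.

(** Arrows without common vertices in [Z] contribute independently. *)
Lemma rho_split W Z G1 G2 (X : pred nat) :
  [disjoint G1 & G2] ->
  (forall m : 'I_n, m \in G1 -> (Z m -> X m) /\ (Z m.+1 -> X m.+1)) ->
  (forall m : 'I_n, m \in G2 -> (Z m -> ~~ X m) /\ (Z m.+1 -> ~~ X m.+1)) ->
  rho W Z (G1 :|: G2) = (rho W Z G1 + rho W Z G2)%N.
Proof.
move=> dis h1 h2; rewrite /rho /gspan.
rewrite (eq_bigl (fun i => i \in [predU G1 & G2])); last by move=> i; rewrite !inE.
rewrite bigU // mxrank_disjoint_sum //; apply/eqP; rewrite -submx0.
have s1 : (gspan W Z G1 <= pr X)%MS.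
  apply/sumsmx_subP => m /h1[a b].
  have -> : gen W m *m pr Z = gen W m *m pr Z *m pr X; last exact: submxMl.
  rewrite -mulmxA prM !gen_prE /=.
  have -> : Z (esrc m) && X (esrc m) = Z (esrc m).
    by rewrite /esrc; case: (rt m); [case: (Z m) a|case: (Z m.+1) b] => //= ->.
  have -> : Z (etrg m) && X (etrg m) = Z (etrg m).
    by rewrite /etrg; case: (rt m); [case: (Z m.+1) b|case: (Z m) a] => //= ->.
  by [].
have s2 : (gspan W Z G2 <= pr (fun z => ~~ X z))%MS.
  apply/sumsmx_subP => m /h2[a b].
  have -> : gen W m *m pr Z = gen W m *m pr Z *m pr (fun z => ~~ X z); last exact: submxMl.
  rewrite -mulmxA prM !gen_prE /=.
  have -> : Z (esrc m) && ~~ X (esrc m) = Z (esrc m).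
    by rewrite /esrc; case: (rt m); [case: (Z m) a|case: (Z m.+1) b] => //= ->.
  have -> : Z (etrg m) && ~~ X (etrg m) = Z (etrg m).
    by rewrite /etrg; case: (rt m); [case: (Z m.+1) b|case: (Z m) a] => //= ->.
  by [].
apply: submx_trans (capmxS s1 s2) _; apply/rV_subP => u.
rewrite sub_capmx => /andP[/submxP[x ux] /submxP[y uy]].
have -> : u = u *m pr X by rewrite [in RHS]ux -mulmxA pr_id -ux.
by rewrite uy -mulmxA prM pr0 ?mulmx0 ?sub0mx // => m _; rewrite andNb.
Qed.

Lemma incident_edge m z : (esrc m != z) && (etrg m != z) = (m != z) && (m.+1 != z).
Proof. by rewrite /esrc /etrg; case: (rt m) => //; rewrite andbC. Qed.

Definition edges a b : {set 'I_n} := [set m : 'I_n | (a <= m < b)%N].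

(** The ranks [rho] are determined by those of intervals that keep all their
    vertices except for the ends that are sources. Otherwise some arrow can be
    split off, is a pivot, or has a removed end. *)
Lemma rho_reduction W1 W2 :
  (forall (Z : pred nat) a b, (a < b <= n)%N -> (forall z, (a < z < b)%N -> Z z) ->
     Z a = ~~ rt a -> Z b = rt b.-1 -> rho W1 Z (edges a b) = rho W2 Z (edges a b)) ->
  forall Z G, rho W1 Z G = rho W2 Z G.
Proof.
move=> base Z G; have [c0] := ubnP #|G|; elim: c0 G Z => // c0 IH G Z; rewrite ltnS => leG.
have IH' G' Z' m : m \in G -> G' = G :\ m -> rho W1 Z' G' = rho W2 Z' G'.
  by move=> mG ->; apply: IH; apply: leq_trans leG; rewrite [X in (_ < X)%N](cardsD1 m) mG.
have [a0 a0G|G0] := pickP (mem G); last first.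
  have -> : G = set0 by apply/setP => m; rewrite inE; exact: G0.
  by rewrite /rho /gspan !big_set0.
case: (@arg_minnP _ a0 (mem G) (@nat_of_ord n) a0G) => {a0 a0G} /= a aG mina.
(* The interval from [a] to [b] is the longest one that begins at the first
   arrow of [G], all of whose arrows are in [G] and all of whose inner
   vertices are in [Z]. *)
pose stop b := (a < b)%N && (~~ Z b || ~~ [exists m : 'I_n, (m \in G) && (m == b :> nat)]).
have stopn : exists b, stop b.
  exists n; rewrite /stop ltn_ord; apply/orP; right; apply/existsP => -[m /andP[_ /eqP e]].
  by have := ltn_ord m; rewrite e ltnn.
case: (ex_minnP stopn) => b /andP[ab bstop] minb.
have bn : (b <= n)%N.
  apply: minb; rewrite /stop ltn_ord; apply/orP; right; apply/existsP => -[m /andP[_ /eqP e]].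
  by have := ltn_ord m; rewrite e ltnn.
have inner z : (a < z < b)%N -> Z z /\ [exists m : 'I_n, (m \in G) && (m == z :> nat)].
  move=> /andP[az zb]; have := contra (minb z); rewrite -ltnNge zb /stop az /= => /(_ isT).
  by rewrite negb_or !negbK => /andP.
have sub : edges a b \subset G.
  apply/subsetP => m; rewrite inE => /andP[]; rewrite leq_eqVlt => /orP[/eqP/val_inj<-//|am mb].
  have amb : (a < m < b)%N by rewrite am.
  by have [_ /existsP[m' /andP[m'G /eqP/val_inj <-]]] := inner m amb.
have [eG|neG] := eqVneq G (edges a b); last first.
  have GE : G = edges a b :|: (G :\: edges a b) by rewrite setDE setUIr setUCr setIT (setUidPr sub).
  have aE : a \in edges a b by rewrite inE leqnn.
  have lt1 : (#|edges a b| < #|G|)%N by apply: proper_card; rewrite properEneq eq_sym neG.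
  have lt2 : (#|G :\: edges a b| < #|G|)%N.
    rewrite -(cardsID (edges a b) G) (setIidPr sub).
    have e0 : (0 < #|edges a b|)%N by rewrite card_gt0; apply/set0Pn; exists a.
    by rewrite -[X in (X < _)%N]add0n ltn_add2r.
  have spl W : rho W Z G = (rho W Z (edges a b) + rho W Z (G :\: edges a b))%N.
    rewrite {1}GE; apply: (@rho_split W Z _ _ (fun z => (z < b)%N || (z == b) && Z b)).
    - by rewrite disjoints_subset; apply/subsetP => m mE; rewrite !inE; move: mE; rewrite inE => ->.
    - move=> m; rewrite inE => /andP[_ mb]; rewrite mb; split=> // h.
      by move: mb; rewrite leq_eqVlt => /orP[/eqP e|->//]; rewrite -e eqxx h orbT.
    move=> m; rewrite in_setD [m \in edges _ _]inE => /andP[nm mG].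
    have am : (a <= m)%N := mina _ mG.
    have bm : (b <= m)%N by move: nm; rewrite am /= -leqNgt.
    split=> h; last by rewrite negb_or -leqNgt leqW // negb_and gtn_eqF.
    rewrite negb_or -leqNgt bm /=; case: eqP => //= e.
    by move: bstop; rewrite -e h /= => /existsP []; exists m; rewrite mG eqxx.
  by rewrite !spl (IH _ _ (leq_trans lt1 leG)) (IH _ _ (leq_trans lt2 leG)).
have bG (m : 'I_n) : (m \in G) = (a <= m < b)%N by rewrite eG inE.
have b1n : (b.-1 < n)%N by lia.
have b1G : Ordinal b1n \in G by rewrite bG /=; lia.
have piv (m : 'I_n) (Zx : pred nat) : m \in G -> Zx (esrc m) ->
    ~~ Zx (etrg m) || [forall m' in G :\ m, (esrc m' != esrc m) && (etrg m' != esrc m)] ->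
    rho W1 Zx G = rho W2 Zx G.
  by move=> mG Zs h; rewrite !(rho_pivot _ mG Zs h) (IH' _ _ m mG erefl).
have cut (m : 'I_n) : m \in G -> ~~ Z (etrg m) -> rho W1 Z G = rho W2 Z G.
  move=> mG nt; have [Zs|nZs] := boolP (Z (esrc m)); first by apply: (piv m) => //; rewrite nt.
  by rewrite !(rho_drop _ mG nZs nt) (IH' _ _ m mG erefl).
have alone (m : 'I_n) : m \in G -> Z (esrc m) -> (forall m' : 'I_n, m' \in G -> m' != m ->
    (m' != esrc m :> nat) && (m'.+1 != esrc m)) -> rho W1 Z G = rho W2 Z G.
  move=> mG Zs h; apply: (piv m) => //; apply/orP; right; apply/forallP => m'; apply/implyP.
  by rewrite in_setD1 => /andP[ne m'G]; rewrite incident_edge h.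
(* An end of the interval that is a source and is in [Z] belongs to one arrow
   only, a pivot; an arrow with a removed target either is a pivot or drops
   out. *)
have [rta|nrta] := boolP (rt a).
  have [Za|nZa] := boolP (Z a).
    apply: (alone a aG); rewrite /esrc rta // => m' m'G ne.
    have := mina _ m'G; have : (m' != a :> nat) by [].
    by move=> h1 h2; rewrite h1 /= gtn_eqF.
  have [rtb|nrtb] := boolP (rt b.-1).
    have [Zb|nZb] := boolP (Z b); last by apply: (cut _ b1G); rewrite /etrg /= rtb prednK // (leq_trans _ ab).
    rewrite eG; apply: base; rewrite ?ab ?bn ?rta ?rtb //; last exact: negbTE.
    by move=> z /inner[].
  have [Zb|nZb] := boolP (Z b).
    have eb : b.-1.+1 = b by rewrite prednK // (leq_ltn_trans (leq0n a) ab).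
    apply: (alone _ b1G); rewrite /esrc /= (negPf nrtb) eb // => m'; rewrite bG => /andP[_ mb] ne.
    have : (m' != b.-1 :> nat) by apply: contra ne => /eqP e; apply/eqP/val_inj.
    by move=> h1; rewrite (ltn_eqF mb) -eb eqSS h1.
  rewrite eG; apply: base; rewrite ?ab ?bn ?rta ?(negPf nrtb) //; try exact: negbTE.
  by move=> z /inner[].
have [Za|nZa] := boolP (Z a); last by apply: (cut _ aG); rewrite /etrg (negPf nrta).
have [rtb|nrtb] := boolP (rt b.-1).
  have [Zb|nZb] := boolP (Z b); last by apply: (cut _ b1G); rewrite /etrg /= rtb prednK // (leq_trans _ ab).
  rewrite eG; apply: base; rewrite ?ab ?bn ?(negPf nrta) ?rtb //.
  by move=> z /inner[].
have [Zb|nZb] := boolP (Z b).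
  have eb : b.-1.+1 = b by rewrite prednK // (leq_ltn_trans (leq0n a) ab).
  apply: (alone _ b1G); rewrite /esrc /= (negPf nrtb) eb // => m'; rewrite bG => /andP[_ mb] ne.
  have : (m' != b.-1 :> nat) by apply: contra ne => /eqP e; apply/eqP/val_inj.
  by move=> h1; rewrite (ltn_eqF mb) -eb eqSS h1.
rewrite eG; apply: base; rewrite ?ab ?bn ?(negPf nrta) ?(negPf nrtb) //; try exact: negbTE.
by move=> z /inner[].
Qed.

End Incidence.

(** * Path operators on an interval *)

Section Paths.
Variables (k : closedFieldType) (n : nat) (d : 'I_n.+1 -> nat) (Q : quiverA n).
Local Notation N := (dimtot d).
Local Notation colv := (@colv n d Q).
Local Notation ev := (ev k colv).
Local Notation pr := (pr k colv).
Variable V : rep Q d k.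

Let ge : graded n ev := graded_ev k colv.
Local Notation NR := (rightop V).
Local Notation NL := (leftop V).

(** The matrix of all paths: the geometric series of the sum of the arrows. *)
Definition pathop : 'M[k]_N := \sum_(m < n.+1) (NR + NL) ^+ m.

Lemma pathop_walk : pathop = opm Q (path_mx V).
Proof.
apply/matrixP => p q; rewrite summxE [RHS]mxE /path_mx.
set x := colv p; set y := colv q.
have E (m : nat) : ((NR + NL) ^+ m : 'M_N) p q = if m == ((x - y) + (y - x))%N then
    walk_mx V m x y (tagged (collab Q p)) (tagged (collab Q q)) else 0.
  case: ifP => [_|ne]; first by rewrite -walk_op mxE.
  case: m ne => [|m] ne.
    rewrite expr0 mxE; case: eqP => // e; move: ne; rewrite /x /y e subnn //.
  rewrite walk_op_split mxE (supp_entry (@supp_rightop_exp _ _ _ _ V m.+1)) ?add0r.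
    rewrite (supp_entry (@supp_leftop_exp _ _ _ _ V m.+1)) //.
    by apply: contraFN ne => /eqP; rewrite -/x -/y; lia.
  by apply: contraFN ne => /eqP; rewrite -/x -/y; lia.
have lt : ((x - y) + (y - x) < n.+1)%N by have := ltn_ord x; have := ltn_ord y; lia.
rewrite (bigD1 (Ordinal lt)) //= E eqxx big1 ?addr0 // => m /eqP nm.
by rewrite E; case: eqP => // e; case: nm; apply: val_inj.
Qed.

Lemma pathopK : (1 - (NR + NL)) * pathop = 1.
Proof.
apply: nil_sumK; rewrite walk_op_split rightop_nil leftop_nil addr0 //.
Qed.

Definition pathrel (i j : nat) := [|| i == j, (j < i)%N && ri Q i | (i < j)%N && lt Q i].

Lemma supp_pathop : supp n ev pathop pathrel.
Proof.
apply: supp_sum => m; case: (nat_of_ord m) => [|a].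
  by rewrite expr0; apply: (supp1 ge) => i; rewrite /pathrel eqxx.
rewrite walk_op_split; apply: suppD; rewrite exprS.
  apply: (suppM ge (@supp_rightop _ _ _ _ V) (@supp_rightop_exp _ _ _ _ V a)) => i b j _ _ _.
  case/andP => /eqP-> r /eqP eb; rewrite /pathrel; apply/orP; right; apply/orP; left.
  by case/andP: r => _; rewrite /ri /= => ->; rewrite andbT; lia.
apply: (suppM ge (@supp_leftop _ _ _ _ V) (@supp_leftop_exp _ _ _ _ V a)) => i b j _ _ _.
case/andP => /eqP eb l /eqP ->; rewrite /pathrel; apply/orP; right; apply/orP; right.
by rewrite l andbT; lia.
Qed.

Section Interval.
Variables (a b : 'I_n.+1) (ab : (a < b)%N).
Let inI (z : nat) := (a <= z <= b)%N.
Local Notation E := (pr inI).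

Definition insnk (z : nat) := inI z && ((z == b) || lt Q z) && ((z == a) || ri Q z).
Definition insrc (z : nat) := inI z && ((z == b) || rt Q z) && ((z == a) || li Q z).

(** A path that leaves an interval does not come back. *)
Lemma interval_path_inv :
  (1 - E * (NR + NL) * E) * (E * pathop * E + (1 - E)) = 1.
Proof.
have EE : E * E = E := pr_id _ _ _.
have no : E * (NR + NL) * (1 - E) * pathop * E = 0.
  have sE : supp n ev E (fun i j => (i == j) && inI i).
    apply/supp_evP => p q ; rewrite prE; case: (p =P q) => [->|//].
    by rewrite eqxx /= => /negPf ->.
  have sE' : supp n ev (1 - E) (fun i j => (i == j) && ~~ inI i).
    rewrite prC; apply/supp_evP => p q ; rewrite prE; case: (p =P q) => [->|//].
    by rewrite eqxx /= => /negPf ->.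
  have sN : supp n ev (NR + NL) (fun i j => rarrow Q i j || larrow Q i j).
    apply: suppD.
      by apply: (supp_sub (@supp_rightop _ _ _ _ V)) => i j _ _ ->.
    by apply: (supp_sub (@supp_leftop _ _ _ _ V)) => i j _ _ ->; rewrite orbT.
  apply: (supp0 ge (r := fun _ _ => false)) => //.
  apply: (suppM ge (suppM ge (suppM ge (suppM ge sE sN (t := fun i j => inI i && (rarrow Q i j || larrow Q i j)) _) sE'
    (t := fun i j => [&& inI i, ~~ inI j & (rarrow Q i j || larrow Q i j)]) _) supp_pathop
    (t := fun i j => [exists m : 'I_n.+1, [&& inI i, ~~ inI m, (rarrow Q i m || larrow Q i m) & pathrel m j]]) _) sE).
  - by move=> i m j _ _ _ /andP[/eqP<- ->].
  - by move=> i m j _ _ _ /andP[-> h] /andP[/eqP<- ->].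
  - move=> i m j _ lm _ /and3P[h1 h2 h3] h4; apply/existsP; exists (Ordinal (lm : (m < n.+1)%N)).
    by rewrite /= h1 h2 h3 h4.
  move=> i m j _ _ _ /existsP[[l lln] /= /and4P[h1 h2 h3 h4]] /andP[/eqP e h5]; subst m.
  move: h1 h2 h5; rewrite /inI => h1 h2 h5.
  case/orP: h3 => /andP[/eqP e r].
    have la : (l < a)%N by lia.
    move: h4; rewrite /pathrel (ltn_eqF (leq_trans la _)); last by case/andP: h5.
    have -> : (j < l)%N = false by lia.
    by rewrite /= andbC => /andP[]; rewrite (negPf (rt_nlt r)).
  have lb : (b < l)%N by lia.
  move: h4; rewrite /pathrel.
  have -> : (l == j) = false by apply/eqP; lia.
  have -> : (l < j)%N = false by lia.
  rewrite orbF /= => /andP[_]; rewrite e /ri /=.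
  by case/andP: r => _ /negPf ->.
have PK : (NR + NL) * pathop = pathop - 1.
  by apply/eqP; rewrite eq_sym subr_eq addrC -subr_eq -{1}[pathop]mul1r -mulrBl pathopK.
have no' : E * (NR + NL) * (E * pathop * E) = E * pathop * E - E.
  have -> : E * (NR + NL) * (E * pathop * E) =
      E * ((NR + NL) * pathop) * E - E * (NR + NL) * (1 - E) * pathop * E.
    by rewrite mulrBr mulr1 !mulrBl !mulrA subKr.
  by rewrite no subr0 PK mulrBr mulr1 mulrBl EE.
rewrite mulrBl mul1r [E * _ * E * (_ + _)]mulrDr.
have -> : E * (NR + NL) * E * (E * pathop * E) = E * pathop * E - E.
  by rewrite -no' -!mulrA (mulrA E E) EE.
have -> : E * (NR + NL) * E * (1 - E) = 0 by rewrite -mulrA mulrBr mulr1 EE subrr mulr0.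
by rewrite addr0 [X in X - _]addrC -addrA subKr subrK.
Qed.

(** The blocks of [rank_mx] are those of [pathop] at the sinks and the sources
    of the interval. *)
Lemma rank_pathop_inner :
  \rank (pr insnk *m pathop *m pr insrc) = \rank (rank_mx V a b).
Proof.
pose snk := sub_sinks Q a b; pose so := sub_sources Q a b.
have us : uniq snk by rewrite rev_uniq filter_uniq ?enum_uniq.
have uo : uniq so by rewrite rev_uniq filter_uniq ?enum_uniq.
pose f (s : 'I_(\sum_(i < size snk) d (tnth (in_tuple snk) i))) : 'I_N :=
  colpos Q (tagnat.sig2 s).
pose g (s : 'I_(\sum_(i < size so) d (tnth (in_tuple so) i))) : 'I_N :=
  colpos Q (tagnat.sig2 s).
have lab (S : seq 'I_n.+1) (s : 'I_(\sum_(i < size S) d (tnth (in_tuple S) i))) :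
    colv (colpos Q (tagnat.sig2 s)) = tnth (in_tuple S) (tagnat.sig1 s).
  exact: colv_colpos.
have -> : rank_mx V a b = mxsub f g pathop.
  by apply/matrixP => s t; rewrite mxE [RHS]mxE pathop_walk opmE.
have inj (S : seq 'I_n.+1) : uniq S ->
    injective (fun s : 'I_(\sum_(i < size S) d (tnth (in_tuple S) i)) => colpos Q (tagnat.sig2 s)).
  move=> uS s t e; have e1 : tagnat.sig1 s = tagnat.sig1 t.
    apply/val_inj/eqP; have := congr1 colv e; rewrite !lab !(tnth_nth ord0) => /eqP.
    by rewrite nth_uniq.
  apply: tagnat.sig_inj; rewrite !tagnat.sigE12.
  have := congr1 (@collab n d Q) e; rewrite !colposE.
  move: (tagnat.sig2 s) (tagnat.sig2 t); rewrite -e1 => i j e2.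
  congr Tagged; apply: val_inj.
  by have := congr1 (fun u : {x : 'I_n.+1 & 'I_(d x)} => nat_of_ord (tagged u)) e2.
have cod (S : seq 'I_n.+1) p :
    (p \in codom (fun s : 'I_(\sum_(i < size S) d (tnth (in_tuple S) i)) => colpos Q (tagnat.sig2 s)))
    = (colv p \in S).
  apply/codomP/idP => [[s ->]|pS]; first by rewrite lab mem_tnth.
  have lt : (index (colv p) S < size S)%N by rewrite index_mem.
  have e : colv p = tnth (in_tuple S) (Ordinal lt) by rewrite (tnth_nth ord0) /= nth_index.
  have ed : d (colv p) = d (tnth (in_tuple S) (Ordinal lt)) by exact: congr1 e.
  exists (@tagnat.Rank _ (fun i => d (tnth (in_tuple S) i)) (Ordinal lt) (cast_ord ed (tagged (collab Q p)))).
  apply: (@collab_inj n d Q); rewrite colposE; apply: eq_label => /=.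
    by rewrite tagnat.Rank1K; exact: e.
  by rewrite tagnat.Rank2K.
rewrite rank_mxsub; [|exact: inj|exact: inj].
have vx (x y : 'I_n.+1) : arrow Q x y = rarrow Q y x || larrow Q y x by rewrite arrowE.
congr (\rank (_ *m _ *m _)); apply: eq_ind => p /=; rewrite cod mem_rev mem_filter mem_enum andbT; apply/esym.
  rewrite /insnk -andbA /inI; case ap: (a <= colv p)%N => //=; case pb: (colv p <= b)%N => //=.
  move: (colv p) ap pb => x ax xb; apply/forallP/andP => [h|[h1 h2] y].
    split.
      case: (eqVneq (x : nat) b) => //= ne; have xb' : (x < b)%N by rewrite ltn_neqAle ne.
      have xn : (x.+1 < n.+1)%N by rewrite (leq_ltn_trans xb').
      have := h (Ordinal xn); rewrite /= (leqW ax) xb' /= vx /rarrow eqxx /= negb_or.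
      by case/andP => nr _; rewrite lt_rt.
    case: (eqVneq (x : nat) a) => //= ne; have ax' : (a < x)%N by rewrite ltn_neqAle eq_sym ne.
    have xn : (x.-1 < n.+1)%N by rewrite (leq_ltn_trans (leq_pred _)).
    have e1 : x.-1.+1 = x by rewrite prednK // (leq_ltn_trans _ ax').
    have := h (Ordinal xn); rewrite /= -ltnS e1 ax' (leq_trans (leq_pred _) xb) /= vx.
    rewrite negb_or /larrow /= e1 eqxx /= => /andP[_].
    by rewrite /lt /ri -ltnS e1 ltn_ord negbK => ->; rewrite (leq_ltn_trans _ ax').
  apply/implyP => /andP[ay yb]; rewrite vx; apply/negP => /orP[]/andP[/eqP e r].
    move: h1; rewrite (ltn_eqF (leq_trans _ yb)) ?e //= => l.
    by move: (lt_nrt l); rewrite r.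
  move: h2; rewrite gtn_eqF ?e //= /ri /=.
  by case/andP: r => _ /negPf ->.
rewrite /insrc -andbA /inI; case ap: (a <= colv p)%N => //=; case pb: (colv p <= b)%N => //=.
move: (colv p) ap pb => x ax xb; apply/forallP/andP => [h|[h1 h2] y].
  split.
    case: (eqVneq (x : nat) b) => //= ne; have xb' : (x < b)%N by rewrite ltn_neqAle ne.
    have xn : (x.+1 < n.+1)%N by rewrite (leq_ltn_trans xb').
    have := h (Ordinal xn); rewrite /= (leqW ax) xb' /= vx /larrow eqxx /= negb_or.
    by case/andP => _; rewrite lt_rt ?negbK.
  case: (eqVneq (x : nat) a) => //= ne; have ax' : (a < x)%N by rewrite ltn_neqAle eq_sym ne.
  have xn : (x.-1 < n.+1)%N by rewrite (leq_ltn_trans (leq_pred _)).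
  have e1 : x.-1.+1 = x by rewrite prednK // (leq_ltn_trans _ ax').
  have := h (Ordinal xn); rewrite /= -ltnS e1 ax' (leq_trans (leq_pred _) xb) /= vx.
  rewrite negb_or /rarrow /= e1 eqxx /= => /andP[+ _].
  by rewrite /rt /li -ltnS e1 ltn_ord => ->; rewrite (leq_ltn_trans _ ax').
apply/implyP => /andP[ay yb]; rewrite vx; apply/negP => /orP[]/andP[/eqP e r].
  move: h2; rewrite gtn_eqF ?e //= /li /=.
  by case/andP: r => _ ->.
move: h1; rewrite (ltn_eqF (leq_trans _ yb)) ?e //= => l.
by move: (lt_nrt r); rewrite l.
Qed.
End Interval.
End Paths.

(** * Ranks of the rows of arrows on an interval *)

Section Twist.
Variables (k : fieldType) (n N : nat) (c : 'I_N -> 'I_n.+1) (Q : quiverA n).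
Local Notation ev := (ev k c).
Local Notation pr := (pr k c).
Local Notation rho := (@rho k n N c Q).
Local Notation gen := (@gen k n N c Q).
Let ge := graded_ev k c.

Lemma rho_conj (f g W : 'M[k]_N) Z G : supp n ev f eq_op -> f *m g = 1%:M ->
  rho (f *m W *m g) Z G = rho W Z G.
Proof.
move=> sf fg; have [fu gu] := mulmx1_unit fg.
have cf z : ev z *m f = f *m ev z := supp_diagC ge z sf.
have gf := mulmx1C fg.
have cg z : ev z *m g = g *m ev z.
  rewrite -[LHS]mul1mx -gf -!mulmxA (mulmxA f) -cf -!mulmxA fg mulmx1 //.
have cp X : pr X *m g = g *m pr X.
  rewrite [LHS](e_suml ge) [RHS](e_suml ge); apply: eq_bigr => i _.
  rewrite -[LHS]/(ev i *m (pr X *m g)) -[RHS]/(ev i *m (g *m pr X)).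
  rewrite !mulmxA cg -(mulmxA g) !ev_pr; case: ifP => _; first by rewrite cg.
  by rewrite mul0mx mulmx0.
have ge' m : gen (f *m W *m g) m *m pr Z = f *m (gen W m *m pr Z) *m g.
  rewrite -!mulmxA (cp Z) !mulmxA; congr (_ *m _).
  have e1 z : f *m ev z *m g = ev z by rewrite -cf -mulmxA fg mulmx1.
  have e2 z z' : f *m (ev z *m W *m ev z') *m g = ev z *m (f *m W *m g) *m ev z'.
    by rewrite !mulmxA -cf -!mulmxA cg.
  by rewrite /gen mulmxDr mulmxDl e1 e2.
rewrite /rho -(mxrankMfree (gspan c Q W Z G) (_ : row_free g)); last by rewrite row_free_unit.
apply: eqmx_rank; apply/eqmxP; apply: eqmx_trans (eqmx_sym (sumsmxMr _ _ g)).
apply: eqmx_sums => m _; rewrite ge' -mulmxA.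
by apply: eqmxMfull; rewrite row_full_unit.
Qed.

(** Signs on the arrows of a tree can be moved to the vertices. *)
Lemma sign_twist (s : nat -> k) (W : 'M[k]_N) : (forall m, s m * s m = 1) ->
  exists f : 'M[k]_N, [/\ supp n ev f eq_op, f *m f = 1%:M &
    forall m, ev m *m (f *m W *m f) *m ev m.+1 = s m *: (ev m *m W *m ev m.+1) /\
              ev m.+1 *m (f *m W *m f) *m ev m = s m *: (ev m.+1 *m W *m ev m)].
Proof.
move=> s2; pose t x := \prod_(m < x) s m.
have t2 x : t x * t x = 1.
  by rewrite -big_split /= big1.
have tS x : t x * t x.+1 = s x.
  by rewrite /t big_ord_recr /= mulrA t2 mul1r.
pose f : 'M[k]_N := diag_mx (\row_p t (c p)).
have fW p q : (f *m W *m f) p q = t (c p) * W p q * t (c q).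
  by rewrite mul_mx_diag mul_diag_mx !mxE.
exists f; split.
- apply/supp_evP => p q ne; rewrite !mxE; case: eqP => [e|]; last by rewrite mulr0n.
  by rewrite e eqxx in ne.
- by apply/matrixP => p q; rewrite mul_diag_mx !mxE; case: eqP => [->|]; rewrite ?mulr1n ?t2 ?mulr0n ?mulr0.
move=> m; split; apply/matrixP => p q; rewrite mulmx_prE mul_prE fW [RHS]mxE [in RHS]mulmx_prE mul_prE.
  case: eqP => [->|_]; last by rewrite !mul0r mulr0.
  case: eqP => [->|_]; last by rewrite !mulr0.
  by rewrite !mul1r !mulr1 mulrAC tS.
case: eqP => [->|_]; last by rewrite !mul0r mulr0.
case: eqP => [->|_]; last by rewrite !mulr0.
by rewrite !mul1r !mulr1 mulrAC [t _ * _]mulrC tS.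
Qed.
End Twist.

Section IntervalRank.
Variables (k : fieldType) (n N : nat) (c : 'I_N -> 'I_n.+1) (Q : quiverA n).
Local Notation ev := (ev k c).
Local Notation pr := (pr k c).
Local Notation rho := (@rho k n N c Q).
Local Notation gen := (@gen k n N c Q).
Local Notation esrc := (esrc Q).
Local Notation etrg := (etrg Q).
Let ge := graded_ev k c.
Variables (W B : 'M[k]_N) (a b : nat) (Z : pred nat).
Hypothesis sB : supp n ev B (fun i j => rarrow Q j i || larrow Q j i).
Hypothesis WB : forall m, (m < n)%N -> ev (esrc m) *m W *m ev (etrg m) =
  (-1) ^+ (rt Q m || ~~ rt Q m.+1) *: (ev (esrc m) *m B *m ev (etrg m)).
Hypotheses (ab : (a < b)%N) (bn : (b <= n)%N).
Hypothesis inner : forall z, (a < z < b)%N -> Z z.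
Hypotheses (Za : Z a = ~~ rt Q a) (Zb : Z b = rt Q b.-1).

Let inI (z : nat) := (a <= z <= b)%N.
Let snk (z : nat) := inI z && ((z == b) || lt Q z) && ((z == a) || ri Q z).
Let src (z : nat) := inI z && ((z == b) || rt Q z) && ((z == a) || li Q z).
Definition isrc (z : nat) := [&& (a < z < b)%N, rt Q z & li Q z].
Definition nonsnk (z : nat) := inI z && ~~ snk z.
Definition nonsrc (z : nat) := inI z && ~~ src z.

Definition incidence : 'M[k]_N := pr nonsnk *m (1%:M - B) *m pr nonsrc.

(** A vertex of the interval that is not a sink has an arrow that leaves it.
    At an inner source there are two; one of their rows serves as a pivot for
    this vertex and their difference is a row of [incidence]. All other
    vertices have one, whose row is a row of [incidence] up to the sign. *)
Lemma rho_interval : rho W Z (edges n a b) = (\rank (pr isrc) + \rank incidence)%N.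
Proof.
pose P : 'M[k]_N := \sum_(z < n.+1 | isrc z) gen W z *m pr Z.
have [ee' eo' _ _] := ge.
have ee z : ev z *m ev z = ev z := ee' z.
have eo y z : y != z -> ev y *m ev z = 0 := eo' y z.
have eprI X : pr X = \sum_(z < n.+1 | X z) ev z.
  rewrite [pr X](e_suml ge) big_mkcond [RHS]big_mkcond /=; apply: eq_bigr => z _.
  exact: ev_pr.
have trgZ m : (a <= m < b)%N -> Z (etrg m) && nonsrc (etrg m).
  move=> /andP[am mb]; have mn : (m < n)%N by apply: leq_trans mb bn.
  rewrite /etrg /nonsrc /src /inI; case: ifP => rm.
    have -> : li Q m.+1 = false by move: rm; rewrite /li /rt /= => /andP[_ ->].
    rewrite orbF (gtn_eqF (am : (a < m.+1)%N)) andbF mb (leqW am) /= !andbT.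
    move: mb; rewrite leq_eqVlt => /orP[/eqP e|mb']; first by rewrite e Zb -e.
    by apply: inner; rewrite mb' ltnS am.
  rewrite (ltn_eqF mb) rm /= andbF (ltnW mb) am /= andbT.
  move: am; rewrite leq_eqVlt => /orP[/eqP e|am']; first by rewrite -e Za e rm.
  by apply: inner; rewrite mb am'.
have li_rt m : (m < n)%N -> li Q m.+1 = ~~ rt Q m.
  by move=> mn; rewrite /li /rt mn.
pose h m := ev (esrc m) *m B *m ev (etrg m).
have genE m : (a <= m < b)%N -> gen W m *m pr Z =
    (if Z (esrc m) then ev (esrc m) else 0) + (-1) ^+ (rt Q m || ~~ rt Q m.+1) *: h m.
  move=> mab; rewrite gen_prE; have /andP[-> _] := trgZ m mab.
  by rewrite WB //; case/andP: mab => _ mb; apply: leq_trans mb bn.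
have evB z X : ev z *m B *m pr X =
    (if rt Q z && X z.+1 then ev z *m B *m ev z.+1 else 0) +
    (if li Q z && X z.-1 then ev z *m B *m ev z.-1 else 0).
  apply/matrixP => p q; rewrite mulmx_prE mul_prE mxE.
  rewrite !(fun_if (fun M : 'M[k]_N => M p q)) !mulmx_prE !mul_prE !mxE.
  case: (eqVneq (c p : nat) z) => [e|_]; last by rewrite !mul0r !if_same addr0.
  rewrite !mul1r -e; have [->|B0] := eqVneq (B p q) 0.
    by rewrite !mul0r !if_same addr0.
  have : rarrow Q (c q) (c p) || larrow Q (c q) (c p).
    by apply: contraNT B0 => nr; apply/eqP/(supp_entry sB).
  case/orP => /andP[/eqP e1 r].
    have -> : ((c q : nat) == (c p).-1) = false by rewrite e1; apply/eqP; lia.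
    rewrite mulr0 if_same addr0 r e1 eqxx mulr1 /=.
    by case: (X _); rewrite ?mulr1 ?mulr0.
  have lc : li Q (c p) by rewrite e1 li_rt ?(ltW r) // (lt_nrt r).
  have -> : ((c q : nat) == (c p).+1) = false by apply/eqP; lia.
  have -> : (c p).-1 = c q by rewrite e1.
  rewrite mulr0 if_same add0r lc eqxx mulr1 /=.
  by case: (X _); rewrite ?mulr1 ?mulr0.
have evBI z : inI z -> ev z *m B *m pr nonsrc =
    (if rt Q z && (z < b)%N then h z else 0) + (if li Q z && (a < z)%N then h z.-1 else 0).
  move=> /andP[az zb]; rewrite evB; congr (_ + _).
    case rz: (rt Q z) => //=; rewrite /h /esrc /etrg rz.
    case: (ltnP z b) => zb'.
      have /andP[_] := trgZ z (introT andP (conj az zb')).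
      by rewrite /etrg rz => ->.
    by rewrite /nonsrc /inI (leqNgt z.+1) ltnS zb' andbF.
  case lz: (li Q z) => //=; have z0 : (0 < z)%N by case/andP: lz.
  have zn : (z.-1 < n)%N by rewrite (leq_trans _ bn) // (leq_trans _ zb) // ltn_predL.
  have rz : rt Q z.-1 = false by apply/negbTE; rewrite -li_rt // prednK.
  rewrite /h /esrc /etrg rz prednK //.
  case: (ltnP a z) => az'.
    have mab : (a <= z.-1 < b)%N by rewrite -ltnS prednK // az' (leq_trans _ zb) // ltn_predL.
    by have /andP[_] := trgZ _ mab; rewrite /etrg rz => ->.
  by rewrite /nonsrc /inI -[(a <= z.-1)%N]ltnS prednK // (ltnNge a) az'.
have HE z : ev z *m incidence = if nonsnk z then
    (if nonsrc z then ev z else 0) - ((if rt Q z && (z < b)%N then h z else 0) +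
    (if li Q z && (a < z)%N then h z.-1 else 0)) else 0.
  rewrite /incidence !mulmxA ev_pr; case: ifP => [nz|_]; last by rewrite !mul0mx.
  by rewrite mulmxBr mulmx1 mulmxBl ev_pr evBI //; case/andP: nz.
have inE' z : inI z = (a <= z <= b)%N by [].
have PE z : ev z *m P = if isrc z then gen W z *m pr Z else 0.
  rewrite /P mulmx_sumr big_mkcond /=.
  have es m : isrc m -> esrc m = m by case/and3P => _ r _; rewrite /esrc r.
  have ge0 m y : ev y *m (gen W m *m pr Z) = if y == esrc m then gen W m *m pr Z else 0.
    rewrite mulmxA /gen mulmxDr !mulmxA; case: eqP => [->|/eqP ne]; first by rewrite !ee.
    by rewrite (eo _ _ ne) !mul0mx addr0 mul0mx.
  case iz: (isrc z); last first.
    rewrite big1 // => m _; case: ifP => // im; rewrite ge0 (es _ im).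
    by case: eqP => // e; rewrite e im in iz.
  have zn : (z < n.+1)%N by case/and3P: iz => _ /rtW /leqW.
  rewrite (bigD1 (Ordinal zn)) //= iz ge0 (es _ iz) eqxx big1 ?addr0 // => m nm.
  case: ifP => // im; rewrite ge0 (es _ im); case: eqP => // e.
  by case/eqP: nm; apply: val_inj.
have isN z : isrc z -> (z < n)%N by case/and3P => _ /rtW.
have isE z : isrc z -> esrc z = z by case/and3P => _ r _; rewrite /esrc r.
(* The sum [P] of the chosen pivot rows is a projection with the same rank as
   [pr isrc]. *)
have PS : P *m pr isrc = pr isrc.
  rewrite eprI mulmx_suml; apply: eq_bigr => z iz.
  have zab : (a <= z < b)%N by case/and3P: iz => /andP[/ltnW-> ->].
  rewrite -eprI -mulmxA prM gen_prE (isE _ iz) iz inner ?addr0 //; last by case/and3P: iz.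
  case: ifP; last by rewrite addr0.
  case/and3P: iz => _ rz _; rewrite /etrg rz => /andP[_ /and3P[_ _]].
  by rewrite li_rt ?rz //; apply: rtW rz.
have SP : pr isrc *m P = P.
  rewrite [RHS](e_suml ge) eprI mulmx_suml big_mkcond; apply: eq_bigr => z _.
  rewrite -[RHS]/(ev z *m P) -[LHS]/(if isrc z then ev z *m P else 0) PE; by case: (isrc z).
have PP : P *m P = P by rewrite -{2}SP mulmxA PS SP.
have HP : incidence *m P = 0.
  have N0 : pr nonsrc *m pr isrc = 0.
    rewrite prM pr0 // => z _; apply/negP => /andP[/andP[_ ns] /and3P[/andP[az zb] rz lz]].
    by move: ns; rewrite /src /inI (ltnW az) (ltnW zb) rz lz !orbT.
  by rewrite -SP mulmxA /incidence -(mulmxA _ _ (pr isrc)) N0 mulmx0 mul0mx.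
rewrite -(rank_idem_eq PS SP) /rho.
have -> : \rank incidence = \rank (incidence *m (1%:M - P)) by rewrite mulmxBr mulmx1 HP subr0.
rewrite -rank_add_idem //.
have genR m : (a <= m < b)%N -> rt Q m -> ~~ isrc m -> gen W m *m pr Z = ev m *m incidence.
  move=> mab rm ni; rewrite genE // rm /esrc rm HE rm; have [am mb] := andP mab.
  have nl : lt Q m = false by apply/negP => /lt_nrt; rewrite rm.
  have nk : nonsnk m by rewrite /nonsnk /snk /inI am (ltnW mb) (ltn_eqF mb) nl.
  rewrite nk mb /= expr1 scaleN1r; move: am; rewrite leq_eqVlt => /orP[/eqP am|am].
    by rewrite -am Za am rm ltnn andbF addr0 /nonsrc /src /inI -am leqnn (ltnW ab) am rm eqxx orbT.
  have nlm : li Q m = false by move: ni; rewrite /isrc am mb rm; case: (li Q m).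
  have nr : nonsrc m by rewrite /nonsrc /src /inI (ltnW am) (ltnW mb) nlm (gtn_eqF am) !andbF.
  by rewrite nr inner ?am // nlm addr0.
have genL m : (a <= m < b)%N -> ~~ rt Q m -> gen W m *m pr Z =
    if isrc m.+1 then ev m.+1 *m P - ev m.+1 *m incidence
    else (-1) ^+ rt Q m.+1 *: (ev m.+1 *m incidence).
  move=> mab nr; rewrite genE // /esrc (negPf nr) HE PE /=; have [am mb] := andP mab.
  have mn : (m < n)%N by apply: leq_trans mb bn.
  have lz : li Q m.+1 by rewrite li_rt.
  have nri : ri Q m.+1 = false by move: nr; rewrite /ri /rt mn /= => /negPf.
  have am' : (a < m.+1)%N by [].
  have nk : nonsnk m.+1 by rewrite /nonsnk /snk /inI (ltnW am') mb nri (gtn_eqF am') andbF.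
  rewrite nk lz am'; move: mb; rewrite leq_eqVlt => /orP[/eqP e|mb'].
    have -> : isrc m.+1 = false by rewrite /isrc e ltnn andbF.
    have -> : nonsrc m.+1 = false by rewrite /nonsrc /src /inI (ltnW am') e leqnn eqxx -e lz orbT.
    rewrite e Zb -e /= (negPf nr) ltnn andbF !add0r scalerN.
    by case: (rt Q m.+1); rewrite ?expr1 ?expr0 ?scaleN1r ?opprK ?scale1r.
  have zab : (a <= m.+1 < b)%N by rewrite mb' (ltnW am').
  rewrite inner ?am' //; case rz: (rt Q m.+1).
    have -> : isrc m.+1 by rewrite /isrc am' mb' rz lz.
    have -> : nonsrc m.+1 = false by rewrite /nonsrc /src /inI (ltnW am') (ltnW mb') rz lz !orbT.
    by rewrite genE // /esrc rz inner ?am' //= mb' expr1 scaleN1r scale1r sub0r opprK addrA subrK.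
  have -> : isrc m.+1 = false by rewrite /isrc rz andbF.
  have -> : nonsrc m.+1 by rewrite /nonsrc /src /inI (ltnW am') (ltnW mb') (ltn_eqF mb') rz.
  by rewrite expr0 scale1r add0r scaleN1r.
apply/eqmx_rank/andP; split.
  apply/sumsmx_subP => m; rewrite inE => mab.
  have inP z : (ev z *m P <= P + incidence)%MS.
    by apply: submx_trans (addsmxSl _ _); exact: submxMl.
  have inH z : (ev z *m incidence <= P + incidence)%MS.
    by apply: submx_trans (addsmxSr _ _); exact: submxMl.
  have [rm|nr] := boolP (rt Q m).
    have [im|ni] := boolP (isrc m); last by rewrite genR.
    by have := inP m; rewrite PE im.
  rewrite genL //; case: ifP => _; last by rewrite scalemx_sub.
  by rewrite addmx_sub // eqmx_opp.
have inG m : (a <= m < b)%N -> (gen W m *m pr Z <= gspan c Q W Z (edges n a b))%MS.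
  move=> mab; have mn : (m < n)%N by case/andP: mab => _ mb; apply: leq_trans mb bn.
  by apply: (sumsmx_sup (Ordinal mn)); rewrite ?inE.
have inP z : (ev z *m P <= gspan c Q W Z (edges n a b))%MS.
  rewrite PE; case: ifP => iz; last exact: sub0mx.
  by apply: inG; case/and3P: iz => /andP[/ltnW-> ->].
rewrite addsmx_sub; apply/andP; split.
  by rewrite /P summx_sub // => z iz; apply: inG; case/and3P: iz => /andP[/ltnW-> ->].
have -> : incidence = \sum_(z < n.+1) ev z *m incidence by exact: (e_suml ge).
apply: summx_sub => -[z zn] _ /=.
have [nz|] := boolP (nonsnk z); last by rewrite HE => /negPf->; exact: sub0mx.
have [az zb] : (a <= z)%N /\ (z <= b)%N by case/andP: nz => /andP.
have [/andP[rz zb']|nrz] := boolP (rt Q z && (z < b)%N).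
  have zab : (a <= z < b)%N by rewrite az.
  have [iz|niz] := boolP (isrc z); last by rewrite -genR // inG.
  have [/andP[az' _] _ lz] := and3P iz.
  have z0 : (0 < z)%N by apply: leq_ltn_trans az'.
  have nr : ~~ rt Q z.-1 by rewrite -li_rt ?prednK // (leq_trans _ bn) // (leq_trans (ltnW zb')).
  have := genL z.-1; rewrite prednK // iz -ltnS prednK // az' zb /= => /(_ isT nr) e.
  have -> : ev z *m incidence = ev z *m P - gen W z.-1 *m pr Z by rewrite e subKr.
  rewrite addmx_sub // eqmx_opp inG // -ltnS prednK // az'; exact: zb.
have niz : isrc z = false.
  by apply/negbTE; apply: contra nrz => /and3P[/andP[_ ->] -> _].
have sk : (z == b) || lt Q z.
  case: eqVneq => //= ne; have zb' : (z < b)%N by rewrite ltn_neqAle ne.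
  by rewrite lt_rt ?(leq_trans zb') //; move: nrz; rewrite zb' andbT.
have [/eqP zna nri] : z != a /\ ~~ ri Q z.
  by apply/andP; move: nz; rewrite /nonsnk /snk /inI az zb sk /= negb_or.
have az' : (a < z)%N by rewrite ltn_neqAle az andbT eq_sym; apply/eqP.
have z0 : (0 < z)%N by apply: leq_ltn_trans az'.
have nr : ~~ rt Q z.-1 by move: nri; rewrite /ri /rt z0 /= => /negPf->; rewrite andbF.
have mab : (a <= z.-1 < b)%N by rewrite -ltnS prednK // az'; exact: zb.
have := genL z.-1 mab nr; rewrite prednK // niz => e.
have := inG z.-1 mab; rewrite e.
by case: (rt Q z); rewrite ?scaleN1r ?eqmx_opp ?expr0 ?scale1r.
Qed.
End IntervalRank.

Section IntervalIncidence.
Variables (k : closedFieldType) (n : nat) (d : 'I_n.+1 -> nat) (Q : quiverA n).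
Local Notation N := (dimtot d).
Local Notation colv := (@colv n d Q).
Local Notation pr := (pr k colv).
Variables (V : rep Q d k) (a b : 'I_n.+1).
Hypothesis ab : (a < b)%N.
Local Notation inI := (fun z : nat => (a <= z <= b)%N).
Local Notation E := (pr inI).
Local Notation nonsnk := (nonsnk Q a b).
Local Notation nonsrc := (nonsrc Q a b).
Local Notation insnk := (insnk Q a b).
Local Notation insrc := (insrc Q a b).

(** The nullity theorem: complementary blocks of two inverse matrices have the
    same nullity. Here the matrices are [1 - B] and the matrix of the paths in
    the interval. *)
Lemma rank_incidence :
  (\rank (incidence colv Q (rightop V + leftop V)^T a b) + \rank (pr insrc) =
   \rank (pr nonsnk) + \rank (rank_mx V a b))%N.
Proof.
set Nn := (_ + _); pose T : 'M[k]_N := 1%:M - E *m Nn^T *m E.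
pose K : 'M[k]_N := E *m (pathop V)^T *m E + (1%:M - E).
have EE : E *m E = E := pr_id _ _ _.
have trE (X Y F : 'M[k]_N) : ((1%:M - X) *m (Y + (1%:M - F)))^T =
    (Y^T + (1%:M - F^T)) *m (1%:M - X^T).
  by rewrite trmx_mul; congr (_ *m _); apply/matrixP => p q; rewrite !mxE eq_sym.
have TK : K *m T = 1%:M.
  have := congr1 trmx (interval_path_inv V ab).
  rewrite -[X in X^T = _]/((1%:M - E *m Nn *m E) *m (E *m pathop V *m E + (1%:M - E))).
  by rewrite trE trmx1 !trmx_mul !tr_pr !mulmxA.
have KT : T *m K = 1%:M := mulmx1C TK.
have TE : T *m E = E *m T by rewrite mulmxBl mulmxBr mulmx1 mul1mx -!mulmxA EE !mulmxA EE.
have prsub (X Y : pred nat) : (forall z, X z -> Y z) -> pr X *m pr Y = pr X.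
  move=> XY; rewrite prM; apply: eq_pr => z _.
  by case: (X z) (XY z) => //= ->.
have sE : pr insrc *m E = pr insrc by apply: prsub => z /andP[/andP[]].
have kE : pr nonsnk *m E = pr nonsnk by apply: prsub => z /andP[].
have pT : pr nonsnk *m T *m E = pr nonsnk *m T by rewrite -mulmxA TE mulmxA kE.
have Es : E *m (1%:M - pr insrc) = pr nonsrc by rewrite prC prM.
have Ek : E *m (1%:M - pr nonsnk) = pr insnk.
  rewrite prC prM; apply: eq_pr => z _; rewrite /nonsnk /insnk.
  by case: (a <= z <= b)%N => //=; rewrite negbK.
have kT : pr nonsnk *m T *m (1%:M - pr insrc) = incidence colv Q Nn^T a b.
  have TEE : pr nonsnk *m T *m E = pr nonsnk *m (1%:M - Nn^T) *m E.
    rewrite -!mulmxA mulmxBl mul1mx -!mulmxA EE [RHS](_ : _ = pr nonsnk *m (E *m ((1%:M - Nn^T) *m E))).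
      by rewrite mulmxBl mul1mx [E *m (E - _)]mulmxBr EE.
    by rewrite [RHS]mulmxA kE.
  by rewrite -pT TEE -(mulmxA _ E) Es.
have sK : pr insrc *m K *m (1%:M - pr nonsnk) = (pr insnk *m pathop V *m pr insrc)^T.
  rewrite !trmx_mul !tr_pr -{1}sE -(mulmxA (pr insrc)).
  have -> : E *m K = E *m (pathop V)^T *m E.
    by rewrite mulmxDr mulmxBr mulmx1 EE subrr addr0 !mulmxA EE.
  by rewrite !mulmxA sE -!mulmxA Ek.
(* The rank of one sum of row spaces, computed modulo each of its two
   summands. *)
have step1 : \rank (pr insrc + pr nonsnk *m T)%MS =
    (\rank (pr insrc) + \rank (incidence colv Q Nn^T a b))%N.
  by rewrite rank_add_idem ?pr_id // kT.
have step2 : \rank (pr insrc + pr nonsnk *m T)%MS =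
    (\rank (pr nonsnk) + \rank (rank_mx V a b))%N.
  rewrite -(mxrankMfree (pr insrc + pr nonsnk *m T)%MS (_ : row_free K)); last first.
    by rewrite row_free_unit; case: (mulmx1_unit TK).
  rewrite (addsmxMr _ _ K) -(mulmxA _ T) KT mulmx1 addsmxC.
  by rewrite rank_add_idem ?pr_id // sK mxrank_tr (rank_pathop_inner V a b).
by rewrite addnC -step1 step2.
Qed.
End IntervalIncidence.

Section RhoParameter.
Variables (k : closedFieldType) (n : nat) (d : 'I_n.+1 -> nat) (Q : quiverA n).
Local Notation N := (dimtot d).
Local Notation colv := (@colv n d Q).
Local Notation ev := (ev k colv).
Local Notation pr := (pr k colv).

(** With these signs the rows of [(1 - rightop)^T] and [(1 + leftop)^T] are
    block rows of arrows ([gen_right], [gen_left]). *)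
Definition incop (V : rep Q d k) : 'M[k]_N := (leftop V)^T - (rightop V)^T.

Let tE (A B : 'M[k]_N) p q : ((A^T - B^T) p q = A q p - B q p) * ((B + A)^T p q = B q p + A q p).
Proof. by rewrite !mxE. Qed.

Lemma incop_blk V m : (m < n)%N -> ev (esrc Q m) *m incop V *m ev (etrg Q m) =
  (-1) ^+ rt Q m *: (ev (esrc Q m) *m (rightop V + leftop V)^T *m ev (etrg Q m)).
Proof.
move=> mn; apply/matrixP => p q; rewrite [RHS]mxE !mulmx_prE !mul_prE.
case: (eqVneq (colv p : nat) (esrc Q m)) => [ep|_]; last by rewrite !mul0r mulr0.
case: (eqVneq (colv q : nat) (etrg Q m)) => [eq|_]; last by rewrite !mulr0.
rewrite !mul1r !mulr1 /incop !tE; move: ep eq; rewrite /esrc /etrg; case rm: (rt Q m) => ep eq.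
  rewrite (supp_entry (@supp_leftop _ _ _ _ V)) ?addr0 ?sub0r ?mulN1r //.
  by rewrite /larrow ep eq; lia.
rewrite (supp_entry (@supp_rightop _ _ _ _ V)) ?add0r ?subr0 ?mul1r //.
by rewrite /rarrow ep eq; lia.
Qed.

(** The signs of [incop] and those required by [rho_interval] differ by a
    twist. *)
Lemma rho_parameter V U :
  (forall a b : 'I_n.+1, (a < b)%N -> \rank (rank_mx V a b) = \rank (rank_mx U a b)) ->
  forall Z G, rho colv Q (incop V) Z G = rho colv Q (incop U) Z G.
Proof.
move=> VU; apply: rho_reduction => Z a b /andP[ab bn] inner Za Zb.
(* The ratio of the signs of [incop] and of those required by
   [rho_interval]. *)
pose s m : k := if rt Q m then 1 else (-1) ^+ (~~ rt Q m.+1).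
have s2 m : s m * s m = 1.
  rewrite /s; case: (rt Q m); first by rewrite mul1r.
  by rewrite -expr2 sqrr_sign.
have an : (a < n.+1)%N by rewrite ltnS (leq_trans (ltnW ab)).

have main X : rho colv Q (incop X) Z (edges n a b) =
    (\rank (pr (isrc Q a b)) + \rank (incidence colv Q (rightop X + leftop X)^T a b))%N.
  have [f [sf ff fE]] := sign_twist colv (incop X) s2.
  rewrite -(rho_conj Q (incop X) Z (edges n a b) sf ff).
  apply: rho_interval => //.
    apply/supp_evP => p q nr; rewrite tE.
    rewrite (supp_entry (@supp_leftop _ _ _ _ X)) ?(supp_entry (@supp_rightop _ _ _ _ X)) ?addr0 //.
      by apply: contra nr => ->.
    by apply: contra nr => ->; rewrite orbT.
  move=> m mn; have [e1 e2] := fE m; have := incop_blk X mn.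
  rewrite /esrc /etrg /s in e1 e2 *; case: (rt Q m) e1 e2 => e1 e2 e3.
    by rewrite e1 e3 scale1r.
  by rewrite e2 e3 /= expr0 scale1r.
have bn' : (b < n.+1)%N by [].
have r1 := @rank_incidence k n d Q V (Ordinal an) (Ordinal bn') ab.
have r2 := @rank_incidence k n d Q U (Ordinal an) (Ordinal bn') ab.
move: r1 r2; rewrite (VU (Ordinal an) (Ordinal bn') ab) /= => r1 r2.
have cancel x1 x2 y z : (x1 + y = z -> x2 + y = z -> x1 = x2)%N.
  by move=> <- /eqP; rewrite eqn_add2r => /eqP.
exact: etrans (main V) (etrans (f_equal (addn _) (cancel _ _ _ _ r1 r2)) (esym (main U))).
Qed.
End RhoParameter.

(** * South-west ranks of zeta V *)

Section SouthwestRank.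
Variables (k : closedFieldType) (n : nat) (d : 'I_n.+1 -> nat) (Q : quiverA n).
Local Notation N := (dimtot d).
Local Notation colv := (@colv n d Q).
Local Notation rowv := (@rowv n d Q).
Local Notation ev := (ev k colv).
Local Notation pr := (pr k colv).
Local Notation gen := (@gen k n N colv Q).
Local Notation v := (rowperm_mx k Q d).
Implicit Types (V U : rep Q d k).
Let ge : graded n ev := graded_ev k colv.

Lemma gen_right V z : ev z *m (1%:M - rightop V)^T = if rt Q z then gen (incop V) z else ev z.
Proof.
have [L LE] : exists L, L = leftop V by exists (leftop V).
have [R RE] : exists R, R = rightop V by exists (rightop V).
have sL p q : ~~ larrow Q (colv p) (colv q) -> L p q = 0.
  by rewrite LE => h; exact: (supp_entry (@supp_leftop _ _ _ _ V)).
have sR p q : ~~ rarrow Q (colv p) (colv q) -> R p q = 0.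
  by rewrite RE => h; exact: (supp_entry (@supp_rightop _ _ _ _ V)).
rewrite /incop -LE -RE; apply/matrixP => p q; rewrite mul_prE.
have -> : ((1%:M - R)^T) p q = (p == q)%:R - R q p by rewrite !mxE eq_sym.
case rz: (rt Q z); last first.
  rewrite prE; case: eqP => [e|_]; last by rewrite mul0r andbF.
  by rewrite mul1r andbT sR ?subr0 // /rarrow e rz andbF.
rewrite /gen /esrc /etrg rz [RHS]mxE prE mulmx_prE mul_prE.
case: eqP => [e|_]; last by rewrite !mul0r andbF addr0.
have -> : (L^T - R^T) p q = L q p - R q p by rewrite !mxE.
rewrite !mul1r andbT; congr (_ + _); case: eqP => [e2|ne].
  by rewrite mulr1 sL ?sub0r // /larrow e2 e; lia.
by rewrite mulr0 sR ?oppr0 // /rarrow e; case: eqP.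
Qed.

Lemma gen_left V z : ev z *m (1%:M + leftop V)^T = if li Q z then gen (incop V) z.-1 else ev z.
Proof.
have [L LE] : exists L, L = leftop V by exists (leftop V).
have [R RE] : exists R, R = rightop V by exists (rightop V).
have sL p q : ~~ larrow Q (colv p) (colv q) -> L p q = 0.
  by rewrite LE => h; exact: (supp_entry (@supp_leftop _ _ _ _ V)).
have sR p q : ~~ rarrow Q (colv p) (colv q) -> R p q = 0.
  by rewrite RE => h; exact: (supp_entry (@supp_rightop _ _ _ _ V)).
rewrite /incop -LE -RE; apply/matrixP => p q; rewrite mul_prE.
have -> : ((1%:M + L)^T) p q = (p == q)%:R + L q p by rewrite !mxE eq_sym.
have li_lt (i : nat) : i.+1 = z -> lt Q i -> li Q z.
  by move=> <-; rewrite /lt /li /= => /andP[].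
case lz: (li Q z); last first.
  rewrite prE; case: eqP => [e|_]; last by rewrite mul0r andbF.
  rewrite mul1r andbT sL ?addr0 // /larrow e; apply/negP => /andP[/eqP e2].
  by move=> /(li_lt _ (esym e2)); rewrite lz.
have z0 : (0 < z)%N by case/andP: lz.
have rz : rt Q z.-1 = false.
  by apply/negbTE; rewrite /rt negb_and; case/andP: lz => _ ->; rewrite orbT.
rewrite /gen /esrc /etrg rz prednK // [RHS]mxE prE mulmx_prE mul_prE.
case: eqP => [e|_]; last by rewrite !mul0r andbF addr0.
have -> : (L^T - R^T) p q = L q p - R q p by rewrite !mxE.
rewrite !mul1r andbT; congr (_ + _); case: eqP => [e2|ne].
  rewrite mulr1 sR ?subr0 // /rarrow e2 e; lia.
rewrite mulr0 sL // /larrow e; apply/negP => /andP[/eqP e2 _]; apply: ne.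
by rewrite e2.
Qed.

(** Multiplication by [(1 - rightop)^T] turns the rank into that of the sum of
    two row spaces: one for the vertices [z] outside the block rows, spanned
    by rows of [(1 - rightop)^T], and one for those inside the block columns,
    spanned by rows of [(1 + leftop)^T]. Each of these rows belongs to an
    arrow or is a unit vector. *)
Lemma rank_swsub_zeta x y : exists Z G c0 c1, forall V,
  (\rank (swsub Q (zeta V) x y) + c0 = c1 + rho colv Q (incop V) Z G)%N.
Proof.
pose X m := (rkey Q x <= rkey Q m)%N; pose Y m := (ckey Q m <= ckey Q y)%N.
(* [F] and [Y] are the vertices outside the block rows and inside the block
   columns, [G] the arrows among the rows that appear, and [U] the unit
   vectors among them. *)
pose F m := ~~ X m.
pose U m := F m && ~~ rt Q m || Y m && ~~ li Q m.
pose G := [set m : 'I_n | F m && rt Q m || Y m.+1 && ~~ rt Q m].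
exists (fun m => ~~ U m), G, (\rank (pr F)), (\rank (pr U)) => V.
pose DT : 'M[k]_N := (1%:M - rightop V)^T; pose CT : 'M[k]_N := (1%:M + leftop V)^T.
have DR : DT *m (right_sum V)^T = 1%:M.
  rewrite -trmx_mul -[X in X^T = _]/(right_sum V * (1 - rightop V)) right_sumKl; exact: trmx1.
have RD := mulmx1C DR.
have [v1 v2] := mulmx1_unit (v_tr k d Q).
have -> : \rank (swsub Q (zeta V) x y) = \rank (pr Y *m (CT *m (right_sum V)^T) *m pr X).
  rewrite rank_swsub zeta_zetaop -(pr_ind k colv Y) -(pr_ind k rowv X) mulmxA -v_pr.
  have vf : row_full v by rewrite row_full_unit.
  rewrite -!mulmxA (eqmxMfull _ vf) -mxrank_tr !trmx_mul !tr_pr zetaopE.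
  rewrite -[(_ * _)^T]/((right_sum V *m (1%:M + leftop V))^T) trmx_mul.
  by rewrite !mulmxA.
have -> : (\rank (pr Y *m (CT *m (right_sum V)^T) *m pr X) + \rank (pr F))%N =
    \rank (pr F + pr Y *m (CT *m (right_sum V)^T))%MS.
  have FX : 1%:M - pr F = pr X by rewrite prC; apply: eq_pr => z _; rewrite /F negbK.
  by rewrite rank_add_idem ?pr_id // FX addnC.
have fD : row_free DT by rewrite row_free_unit; case: (mulmx1_unit DR).
rewrite -(mxrankMfree _ fD) (addsmxMr _ _ DT) -!mulmxA RD mulmx1.
have eprI T : pr T = \sum_(z < n.+1) if T z then ev z else 0.
  rewrite [pr T](e_suml ge); apply: eq_bigr => z _; exact: ev_pr.
have -> : rho colv Q (incop V) (fun m => ~~ U m) G =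
    \rank ((\sum_(m in G) gen (incop V) m)%MS *m (1%:M - pr U)).
  by rewrite /rho /gspan (sumsmxMr _ _ (1%:M - pr U)) prC.
rewrite -rank_add_idem ?pr_id //.
have evU z : U z -> (ev z <= pr U)%MS.
  by move=> Uz; have := ev_pr k colv z U; rewrite Uz => <-; exact: submxMl.
have evF z : F z -> (ev z *m DT <= pr F *m DT)%MS.
  by move=> Fz; have := ev_pr k colv z F; rewrite Fz => {1}<-; rewrite -mulmxA submxMl.
have evY z : Y z -> (ev z *m CT <= pr Y *m CT)%MS.
  by move=> Yz; have := ev_pr k colv z Y; rewrite Yz => {1}<-; rewrite -mulmxA submxMl.
have rt_pred z : li Q z -> ~~ rt Q z.-1.
  by case/andP => z0; rewrite /rt negb_and => ->; rewrite orbT.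
apply/eqmx_rank/andP; split; rewrite addsmx_sub; apply/andP; split.
- rewrite {1}eprI mulmx_suml; apply: summx_sub => -[z zn] _ /=.
  case: ifP => Fz; last by rewrite mul0mx sub0mx.
  rewrite /DT gen_right; case rz: (rt Q z); last first.
    by apply: submx_trans (addsmxSl _ _); apply: evU; rewrite /U Fz rz.
  apply: submx_trans (addsmxSr _ _); have zn' : (z < n)%N by case/andP: rz.
  by apply: (sumsmx_sup (Ordinal zn')); rewrite // inE /= Fz rz.
- rewrite {1}eprI mulmx_suml; apply: summx_sub => -[z zn] _ /=.
  case: ifP => Yz; last by rewrite mul0mx sub0mx.
  rewrite /CT gen_left; case lz: (li Q z); last first.
    by apply: submx_trans (addsmxSl _ _); apply: evU; rewrite /U Yz lz orbT.
  apply: submx_trans (addsmxSr _ _); have z0 : (0 < z)%N by case/andP: lz.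
  have zn' : (z.-1 < n)%N by rewrite -ltnS prednK.
  apply: (sumsmx_sup (Ordinal zn')); rewrite // inE /= prednK // Yz rt_pred //.
  by rewrite orbT.
- rewrite eprI; apply: summx_sub => -[z zn] _ /=.
  case: ifP => Uz; last exact: sub0mx.
  case/orP: Uz => /andP[h1 h2].
    have := evF z h1; rewrite /DT gen_right (negPf h2) => h.
    by apply: submx_trans (addsmxSl _ _).
  have := evY z h1; rewrite /CT gen_left (negPf h2) => h.
  by apply: submx_trans (addsmxSr _ _).
apply/sumsmx_subP => m; rewrite inE => /orP[]/andP[h1 h2].
  have := evF m h1; rewrite /DT gen_right h2 => h.
  by apply: submx_trans (addsmxSl _ _).
have lm : li Q m.+1 by move: h2; rewrite /li /rt ltn_ord.
have := evY m.+1 h1; rewrite /CT gen_left lm => h.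
by apply: submx_trans (addsmxSr _ _).
Qed.

Lemma swsub_zeta_parameter V U :
  (forall a b : 'I_n.+1, (a < b)%N -> \rank (rank_mx V a b) = \rank (rank_mx U a b)) ->
  forall x y, \rank (swsub Q (zeta V) x y) = \rank (swsub Q (zeta U) x y).
Proof.
move=> VU x y; have [Z [G [c0 [c1 h]]]] := rank_swsub_zeta x y.
by apply/eqP; rewrite -(eqn_add2r c0) !h (rho_parameter VU).
Qed.
End SouthwestRank.

(** * The Zelevinsky permutation *)

Section ZelevinskyPermutation.
Variables (k : closedFieldType) (n : nat) (d : 'I_n.+1 -> nat) (Q : quiverA n).
Local Notation N := (dimtot d).
Local Notation colv := (@colv n d Q).
Local Notation rowv := (@rowv n d Q).
Local Notation rk p := (rkey Q (rowv p)).
Local Notation ck q := (ckey Q (colv q)).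
Local Notation blkcount := (@blkcount n d Q).
Local Notation zorder := (@zorder n d Q).
Local Notation v := (rowperm_mx k Q d).
Implicit Types (V U : rep Q d k) (u w : 'S_N).

Lemma rank_swsub_blkcount u w : (forall x y, blkcount u x y = blkcount w x y) ->
  forall x y, \rank (swsub Q (pm k u) x y) = \rank (swsub Q (pm k w) x y).
Proof.
move=> e x y; rewrite !rank_swsub !rank_pm_ind.
have E (s : 'S_N) : #|[set q | (rkey Q x <= rk (s q))%N && (ck q <= ckey Q y)%N]| =
   (\sum_(z : 'I_n.+1 * 'I_n.+1 | (rkey Q x <= rkey Q z.1)%N && (ckey Q z.2 <= ckey Q y)%N)
     blkcount s z.1 z.2)%N.
  rewrite -sum1_card (partition_big (fun q => (rowv (s q), colv q))
    (fun z => (rkey Q x <= rkey Q z.1)%N && (ckey Q z.2 <= ckey Q y)%N)) => [|q]; last by rewrite inE.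
  apply: eq_bigr => -[x' y'] /= h; rewrite /blkcount -sum1_card; apply: eq_bigl => q.
  rewrite !inE -pair_eqE /pair_eq /=; case: eqP => [->|_]; last by rewrite andbF.
  by case: eqP => [->|_]; rewrite ?andbF // h.
by rewrite !E; apply: eq_bigr => z _; rewrite e.
Qed.

Lemma v_unit : v \in unitmx.
Proof. by have [] := mulmx1_unit (v_tr k d Q). Qed.

Lemma zeta_unit V : zeta V \in unitmx.
Proof. by rewrite zeta_zetaop unitmx_mul v_unit zetaop_unit. Qed.

(** The permutation [u] of a Bruhat decomposition of [zeta V] has the required
    ranks. It is reordered inside the blocks. *)
Lemma zelevinsky_perm_exists V r : rank_parameter V r -> exists w u b b',
  [/\ unique (zelevinsky_perm k Q r) w, zorder w /\ (forall x y, blkcount u x y = blkcount w x y),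
     b \in unitmx /\ uptrig b, b' \in unitmx /\ uptrig b' & zeta V = b *m pm k u *m b'].
Proof.
move=> rV; have [b [b' [u [bu ub bu' ub' E]]]] := bruhat (zeta_unit V).
have [w zw ew] := zorder_exists Q u.
have ew' x y : blkcount u x y = blkcount w x y by rewrite ew.
exists w, u, b, b'; split=> //; split.
  split=> [|U rU x y]; first exact/z_typeP.
  have -> : \rank (swsub Q (zeta U) x y) = \rank (swsub Q (zeta V) x y).
    by apply: swsub_zeta_parameter => a c ac; rewrite rU // rV.
  rewrite E rank_swsub_mul //; [|exact: uptrig_rowupper|exact: uptrig_colupper].
  exact: esym (rank_swsub_blkcount ew' x y).
move=> w' [/z_typeP zw' rw']; apply: (zorder_unique zw zw'); apply: (@blkcount_rank k) => x y.
rewrite -(rank_swsub_blkcount ew') (rw' V rV).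
by rewrite E rank_swsub_mul //; [exact: uptrig_rowupper|exact: uptrig_colupper].
Qed.
End ZelevinskyPermutation.

(** * The Schubert variety *)

Section Curves.
Variable k : closedFieldType.

(** A closed field has enough elements to determine a polynomial. *)
Lemma punctured_line_zero (g : {poly k}) : (forall c, c != 0 -> g.[c] = 0) -> g = 0.
Proof.
move=> g0; have [sz|/closed_rootP[c /rootP]] := boolP (size ('X * g + 1) == 1%N); last first.
  rewrite hornerD hornerM hornerX hornerC; have [->|/g0->] := eqVneq c 0.
    by rewrite mul0r add0r => /eqP; rewrite oner_eq0.
  by rewrite mulr0 add0r => /eqP; rewrite oner_eq0.
apply/eqP; apply: contraTT sz => gn0.
by rewrite mulrC -[1]polyC1 size_MXaddC (negPf gn0) /= eqSS size_poly_eq0.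
Qed.

Lemma meval_curve s (p : {mpoly k[s]}) (h : 'I_s -> {poly k}) :
  exists g : {poly k}, forall c, p.@[fun j => (h j).[c]] = g.[c].
Proof.
exists (mmap polyC h p) => c; rewrite /meval /mmap horner_sum; apply: eq_bigr => m _.
rewrite hornerM hornerC /mmap1 horner_prod; congr (_ * _).
by apply: eq_bigr => j _; rewrite horner_exp.
Qed.

Lemma evalat_line n (d : 'I_n.+1 -> nat) (p : {mpoly k[#|mx_index d|]}) (A B : 'M[k]_(dimtot d)) :
  exists g : {poly k}, forall c, evalat (@mx_coord k n d) p (A + c *: B) = g.[c].
Proof.
have [g gE] := meval_curve p (fun j => (mx_coord A (enum_val j))%:P + (mx_coord B (enum_val j)) *: 'X).
exists g => c; rewrite -gE; apply: meval_eq => j.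
by rewrite hornerD hornerC hornerZ hornerX /mx_coord !mxE mulrC.
Qed.
End Curves.

Section Schubert.
Variables (k : closedFieldType) (n : nat) (d : 'I_n.+1 -> nat) (Q : quiverA n).
Local Notation N := (dimtot d).
Local Notation colv := (@colv n d Q).
Local Notation rowv := (@rowv n d Q).
Local Notation rk p := (rkey Q (rowv p)).
Local Notation ck q := (ckey Q (colv q)).
Local Notation blkcount := (@blkcount n d Q).
Local Notation zorder := (@zorder n d Q).
Local Notation rowupper := (@rowupper k n d Q).
Local Notation colupper := (@colupper k n d Q).
Implicit Types (u w : 'S_N) (A b h : 'M[k]_N).

Lemma colupperP h : parabolic Q h <-> h \in unitmx /\ colupper h.
Proof.
split=> -[hu hh]; split=> // p q; first by rewrite -prec_colseq; exact: hh.
by rewrite prec_colseq; exact: hh.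
Qed.

Lemma colupperM h h' : colupper h -> colupper h' -> colupper (h *m h').
Proof. exact: (@key_upperM _ _ (fun q => ck q)). Qed.

Lemma rowupperM h h' : rowupper h -> rowupper h' -> rowupper (h *m h').
Proof. exact: (@key_upperM _ _ (fun p => rk p)). Qed.

Lemma pm_colupper (t : 'S_N) : (forall q, colv (t q) = colv q) -> colupper (pm k t).
Proof. by move=> ht p q lt; rewrite mxE; case: eqP => // e; rewrite e ht ltnn in lt. Qed.

Lemma pm_rowupper (s : 'S_N) : (forall q, rowv (s q) = rowv q) -> rowupper (pm k s).
Proof. by move=> ht p q lt; rewrite mxE; case: eqP => // e; rewrite e ht ltnn in lt. Qed.

(** Block permutations on the two sides carry the permutation matrix of a
    Zelevinsky permutation to all those with the same block counts. *)
Lemma pm_block_coset w u : zorder w -> (forall x y, blkcount u x y = blkcount w x y) ->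
  exists s t : 'M[k]_N, [/\ s \in unitmx /\ rowupper s, t \in unitmx /\ colupper t &
    pm k u = s *m pm k w *m t].
Proof.
move=> zw; move: u; apply: (zorder_chain zw) => [t ht|u i j _ eij _ [s [t [[su sr] tc e]]]].
  exists 1%:M, (pm k t); split; 
    first by rewrite unitmx1; split=> // p q lt; rewrite mxE; case: eqP => // e; rewrite e ltnn in lt.
    by rewrite pm_unit; split=> //; exact: pm_colupper.
  by rewrite mul1mx pmM.
exists (pm k (tperm i j) *m s), t; split=> //.
  rewrite unitmx_mul pm_unit su; split=> //; apply: rowupperM => //; apply: pm_rowupper => q.
  by case: tpermP => // ->.
by rewrite -!mulmxA (mulmxA s) -e !pmM -mulgA tperm2 mulg1.
Qed.

Lemma elem_unip (i j : 'I_N) (c : k) : i != j ->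
  (1%:M - c *: delta_mx i j) *m (1%:M + c *: delta_mx i j) = 1%:M :> 'M[k]_N.
Proof.
move=> ij; rewrite mulmxDr mulmx1 mulmxBl mul1mx -scalemxAl -scalemxAr.
by rewrite mul_delta_mx_0 1?eq_sym // !scaler0 subr0 subrK.
Qed.

(** In rank two: a lower unipotent matrix other than 1 is in the big Bruhat cell. *)
Lemma elem_unip_swap (i j : 'I_N) (c : k) : (i < j)%N -> c != 0 ->
  exists b : 'M[k]_N, [/\ b \in unitmx, uptrig b &
  1%:M + c *: delta_mx j i = b *m pm k (tperm i j) *m (1%:M + c^-1 *: delta_mx i j)].
Proof.
move=> lij c0; have ij : i != j by apply: contraTneq lij => ->; rewrite ltnn.
have ji : j != i by rewrite eq_sym.
exists ((1%:M + c *: delta_mx j i) *m (1%:M - c^-1 *: delta_mx i j) *m pm k (tperm i j)); split.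
- rewrite !unitmx_mul pm_unit andbT; case: (mulmx1_unit (elem_unip c ji)) => _ ->.
  by case: (mulmx1_unit (elem_unip c^-1 ij)) => ->.
- move=> p q qp; rewrite mul_pmE mulmxBr mulmx1 mulmxDl mul1mx -scalemxAl -!scalemxAr mul_delta_mx.
  rewrite scalerA divff // scale1r !mxE.
  have pq : (p == q) = false by apply/negbTE; apply: contraTneq qp => ->; rewrite ltnn.
  case: tpermP => [ei|ej|/eqP ni /eqP nj].
  + subst q; rewrite (negPf ji) eqxx !andbF !andbT pq.
    by rewrite !mulr0 addr0 add0r subrr.
  + subst q; rewrite (negPf ij) eqxx !andbF !andbT mulr0 !addr0 pq.
    have -> : (p == i) = false by apply/negbTE; apply: contraTneq qp => ->; rewrite -leqNgt ltnW.
    by rewrite mulr0 add0r subr0.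
  by rewrite pq (negPf ni) (negPf nj) !andbF !mulr0 !addr0 subr0.
by rewrite -!mulmxA (mulmxA (pm _ _)) pmM tperm2 pm1 mul1mx elem_unip // mulmx1.
Qed.

Section Closed.
Variables (w : 'S_N) (F : 'M[k]_N -> Prop).
Hypotheses (zw : zorder w) (Fc : flag_closed Q F).
Hypothesis Fw : forall A, schubert_cell Q w A -> F A.

(** For [c != 0] the point [b (1 + c E_ji) u] of a line lies in the double
    coset of [u] with the rows [i] and [j] exchanged; at [c = 0] it is
    [b u]. *)
Lemma flag_closed_pm u : (forall x y, blkcount u x y = blkcount w x y) ->
  forall b, b \in unitmx -> uptrig b -> F (b *m pm k u).
Proof.
have [Fu Fz Fp] := Fc; move: u.
apply: (zorder_chain zw) => [t ht b bu ub|u i j lij eij ec Ps b bu ub].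
  apply: Fw; exists b, (pm k t); split; last by rewrite -mulmxA pmM.
    by split=> //; apply/uptrigP.
  by apply/colupperP; split; [exact: pm_unit|exact: pm_colupper].
have ij : i != j by apply: contraTneq lij => ->; rewrite ltnn.
apply: Fz; first by rewrite unitmx_mul bu pm_unit.
move=> p p0; have [g gE] := evalat_line p (b *m pm k u) (b *m delta_mx j i *m pm k u).
suff g0 : g = 0 by have := gE 0; rewrite g0 horner0 scale0r addr0.
apply: punctured_line_zero => c c0; rewrite -gE; apply: p0.
have [b1 [bu1 ub1 e]] := elem_unip_swap lij c0.
have -> : b *m pm k u + c *: (b *m delta_mx j i *m pm k u) =
    b *m b1 *m pm k (u * tperm i j) *m (1%:M + c^-1 *: delta_mx (u^-1 i)%g (u^-1 j)%g).
  have -> : b *m pm k u + c *: (b *m delta_mx j i *m pm k u) =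
      b *m (1%:M + c *: delta_mx j i) *m pm k u.
    by rewrite mulmxDr mulmx1 mulmxDl -scalemxAr -scalemxAl.
  rewrite e -pmM -!mulmxA; congr (_ *m (_ *m (_ *m _))).
  rewrite mulmxDl mul1mx mulmxDr mulmx1; congr (_ + _).
  rewrite -scalemxAl -scalemxAr; congr (_ *: _); apply/matrixP => p' q'.
  rewrite mul_pmE -[p'](permKV u) pm_mulE !mxE permKV.
  by rewrite (inj_eq perm_inj) -(inj_eq (@perm_inj _ u) q') permKV.
apply: (Fp (b *m b1 *m pm k (u * tperm i j))); last first.
  by apply: Ps; [rewrite unitmx_mul bu|exact: uptrigM].
exists (1%:M + c^-1 *: delta_mx (u^-1 i)%g (u^-1 j)%g) => //.
have nij : (u^-1 i)%g != (u^-1 j)%g by rewrite (inj_eq perm_inj).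
apply/colupperP; split; first by case: (mulmx1_unit (elem_unip c^-1 nij)).
move=> p' q' lt; rewrite !mxE.
have -> : (p' == q') = false by apply/negbTE; apply: contraTneq lt => ->; rewrite ltnn.
case: (eqVneq p' (u^-1 i)%g) => [e1|_]; last by rewrite mulr0 addr0.
case: (eqVneq q' (u^-1 j)%g) => [e2|_]; last by rewrite mulr0 addr0.
by move: lt; rewrite e1 e2 ltnNge ltnW.
Qed.
End Closed.

(** Such a matrix is in the double coset of a permutation with the block
    counts of [w]. *)
Lemma schubert_rank w A : zorder w -> A \in unitmx ->
  (forall x y, \rank (swsub Q A x y) = \rank (swsub Q (pm k w) x y)) ->
  schubert_variety Q w A.
Proof.
move=> zw uA rA; split=> // F Fc Fw.
have [b [b' [u [bu ub bu' ub' E]]]] := bruhat uA.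
have euw : forall x y, blkcount u x y = blkcount w x y.
  apply: (@blkcount_rank k) => x y; rewrite -rA E rank_swsub_mul //.
    exact: uptrig_rowupper.
  exact: uptrig_colupper.
have [_ _ Fp] := Fc; rewrite E; apply: (Fp (b *m pm k u)).
  by exists b' => //; apply/colupperP; split=> //; exact: uptrig_colupper.
exact: (flag_closed_pm zw Fc Fw euw).
Qed.

End Schubert.

(** * From the orbit to the quiver locus *)

Section Naturality.
Variables (n : nat) (Q : quiverA n) (d : 'I_n.+1 -> nat) (R S : comNzRingType).
Variables (f : {rmorphism R -> S}) (V : rep Q d R) (U : rep Q d S).
Hypothesis VU : forall i, map_mx f (V i) = U i.

Lemma map_arrow_mx x y : map_mx f (arrow_mx V x y) = arrow_mx U x y.
Proof.
by rewrite map_mx_sum; apply: eq_bigr => i _; rewrite map_conform_mx VU map_mx0.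
Qed.

Lemma map_walk_mx m x y : map_mx f (walk_mx V m x y) = walk_mx U m x y.
Proof.
elim: m x => [|m IH] x /=; first by case: ifP; rewrite ?map_pid_mx ?map_mx0.
by rewrite map_mx_sum; apply: eq_bigr => z _; rewrite map_mxM map_arrow_mx IH.
Qed.

Lemma map_zeta p q : f (zeta V p q) = zeta U p q.
Proof.
have e x y : map_mx f (zeta_block V x y) = zeta_block U x y.
  rewrite /zeta_block /path_mx -map_walk_mx -map_arrow_mx !(fun_if (map_mx f)).
  by rewrite map_pid_mx map_mx0.
by rewrite [RHS]mxE -e [RHS]mxE [in LHS]mxE.
Qed.
End Naturality.

Section Comorphism.
Variables (k : closedFieldType) (n : nat) (d : 'I_n.+1 -> nat) (Q : quiverA n).
Implicit Types V U : rep Q d k.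

Lemma evalat_zeta_comorphism (f : {mpoly k[#|mx_index d|]}) U :
  evalat (@rep_coord k n Q d) (zeta_comorphism Q f) U = evalat (@mx_coord k n d) f (zeta U).
Proof.
rewrite /evalat comp_mpoly_meval; apply: meval_eq => j.
rewrite tnth_mktuple (map_zeta (U := U)) // => i.
apply/matrixP => a b; rewrite !mxE /= mevalXU enum_rankK //.
Qed.

(** A closed condition on flags pulls back to a closed condition on
    representations. *)
Lemma quiver_locus_schubert w V : (forall U, orbit_of V U -> schubert_variety Q w (zeta U)) ->
  forall U, quiver_locus V U -> schubert_variety Q w (zeta U).
Proof.
move=> ov U lU; split=> [|F Fc Fw]; first exact: zeta_unit.
have [_ Fz _] := Fc; apply: Fz; first exact: zeta_unit.
move=> p p0; rewrite -evalat_zeta_comorphism; apply: lU => U' oU'.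
rewrite evalat_zeta_comorphism; apply: p0.
by case: (ov _ oU') => _; apply.
Qed.
End Comorphism.

Section OrbitSchubert.
Variables (k : closedFieldType) (n : nat) (d : 'I_n.+1 -> nat) (Q : quiverA n).
Local Notation N := (dimtot d).
Local Notation colv := (@colv n d Q).
Local Notation ev := (ev k colv).
Local Notation v := (rowperm_mx k Q d).
Implicit Types V U : rep Q d k.

Lemma orbit_zetaop V U : orbit_of V U -> exists f : 'M[k]_N,
  [/\ f \in unitmx, supp n ev f eq_op, supp n ev (invmx f) eq_op & zetaop U *m f = f *m zetaop V].
Proof.
move=> /orbit_intertwiner[f [fu sf sfi fR fL]]; exists f; split=> //.
rewrite !zetaopE.
have fR' : (1 - rightop U) *m f = f *m (1 - rightop V) by rewrite mulmxBl mulmxBr mul1mx mulmx1 fR.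
have fL' : (1 + leftop U) *m f = f *m (1 + leftop V) by rewrite mulmxDl mulmxDr mul1mx mulmx1 fL.
have e : right_sum U *m f = f *m right_sum V.
  have h1 : right_sum U *m (1 - rightop U) = 1 := right_sumKl U.
  have h2 : (1 - rightop V) *m right_sum V = 1 := right_sumK V.
  rewrite -[LHS]mulmx1 -[X in _ *m X]h2 -!mulmxA (mulmxA f) -fR' !mulmxA h1.
  by rewrite -mulmxA mul1mx.
rewrite -[LHS]/(right_sum U *m (1 + leftop U) *m f) -[RHS]/(f *m (right_sum V *m (1 + leftop V))).
by rewrite -mulmxA fL' !mulmxA e.
Qed.

Lemma v_supp_rowupper (f : 'M[k]_N) (r : rel nat) : supp n ev f r ->
  (forall i j, (i <= n)%N -> (j <= n)%N -> r i j -> (rkey Q i <= rkey Q j)%N) ->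
  @rowupper k n d Q (v *m f *m v^T).
Proof.
move=> sf ri p q lt; have vt (A : 'M[k]_N) : (A *m v^T) p q = A p (row2col Q q).
  transitivity ((v *m A^T) q p); first by rewrite -{1}[A]trmxK -trmx_mul mxE.
  by rewrite mul_vE mxE.
rewrite vt mul_vE; apply: (supp_entry sf).
rewrite !colv_row2col; apply/negP => rij.
by have := ri _ _ (leq_ord _) (leq_ord _) rij; rewrite leqNgt lt.
Qed.

Lemma orbit_rank_swsub V U : orbit_of V U ->
  forall x y, \rank (swsub Q (zeta U) x y) = \rank (swsub Q (zeta V) x y).
Proof.
move=> /orbit_zetaop[f [fu sf sfi e]] x y.
have tv := mulmx1C (v_tr k d Q).
have [v1 v2] := mulmx1_unit tv.
have -> : zeta U = (v *m f *m v^T) *m zeta V *m invmx f.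
  by rewrite !zeta_zetaop -(mulmxK fu (zetaop U)) e !mulmxA -[v *m f *m v^T *m v]mulmxA tv mulmx1.
apply: rank_swsub_mul.
- by rewrite !unitmx_mul v1 v2 fu.
- by apply: (v_supp_rowupper sf) => i j _ _ /eqP->.
- by rewrite unitmx_inv.
move=> p q lt; apply: (supp_entry sfi); apply: contraTN lt => /eqP e'.
by rewrite (val_inj e') ltnn.
Qed.

End OrbitSchubert.

(** * Block elimination *)

Section Neumann.
Variables (A : pzRingType) (n : nat) (e : nat -> A).
Hypothesis ge : graded n e.
Variable (key : nat -> nat).
Hypothesis key_bound : forall i, (i <= n)%N -> (key i <= n.*2)%N.

Definition unilower (X : A) :=
  supp n e X (fun i j => (i == j) || (key j < key i)%N) /\
  forall i, (i <= n)%N -> e i * X * e i = e i.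

(** The inverse of a unipotent operator as a polynomial in its entries. *)
Definition neumann (X : A) : A := \sum_(m < n.*2.+1) (1 - X) ^+ m.

Lemma unilower_supp X : unilower X -> supp n e (1 - X) (fun i j => (key j < key i)%N).
Proof.
have [ee eo _ _] := ge.
case=> sX dX i j li lj nr; rewrite mulrBr mulrBl mulr1.
have [->|ne] := eqVneq i j; first by rewrite ee dX // subrr.
by rewrite eo // sX ?subr0 // (negPf ne).
Qed.

Lemma neumann_supp X : unilower X -> supp n e (neumann X) (fun i j => (i == j) || (key j < key i)%N).
Proof.
move=> /unilower_supp sT.
suff sm m : supp n e ((1 - X) ^+ m) (fun i j => (i == j) || (key j < key i)%N).
  move=> i j li lj nr; rewrite /neumann mulr_sumr mulr_suml big1 // => m _; exact: sm.
elim: m => [|m IH]; first by apply: (supp1 ge) => i; rewrite eqxx.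
rewrite exprS; apply: (suppM ge sT IH) => i l j _ _ _ h1 /orP[/eqP<-|h2]; first by rewrite h1 orbT.
by rewrite (ltn_trans h2 h1) orbT.
Qed.

Lemma neumannK X : unilower X -> X * neumann X = 1 /\ neumann X * X = 1.
Proof.
move=> /unilower_supp sT; have [T TE] : exists T, T = 1 - X by exists (1 - X).
have XE : X = 1 - T by rewrite TE subKr.
have sm m : supp n e (T ^+ m) (fun i j => (key j + m <= key i)%N).
  elim: m => [|m IH]; first by apply: (supp1 ge) => i; rewrite addn0.
  rewrite exprS -TE in sT *; apply: (suppM ge sT IH) => i l j _ _ _ h1 h2.
  by rewrite addnS; apply: leq_ltn_trans h1.
have T0 : T ^+ n.*2.+1 = 0.
  apply: (supp0 ge (r := fun _ _ => false)) => // i j li lj _.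
  by apply: sm => //; have := key_bound li; lia.
have TK : (T - 1) * \sum_(m < n.*2.+1) T ^+ m = - 1 by rewrite -subrX1 T0 sub0r.
rewrite /neumann -TE XE; split; first by rewrite -opprB mulNr TK opprK.
have cm : GRing.comm (\sum_(m < n.*2.+1) T ^+ m) (T - 1).
  apply: commr_sym; apply: commr_sum => m _; apply: commr_sym.
  by apply: commrB; [exact/commr_sym/commrX|exact: commr1].
by rewrite -opprB mulrN cm TK opprK.
Qed.

End Neumann.

Section Corner.
Variable A : pzRingType.
Implicit Types E X Z : A.

(** Invertible exactly when the corner of [X] cut out by [E] is. *)
Definition corner E X := E * X * E + (1 - E).

Lemma cornerP E X Z : E * E = E -> corner E X * Z = 1 -> Z * corner E X = 1 ->
  [/\ (1 - E) * Z = 1 - E, Z * (1 - E) = 1 - E, E * X * Z * E = E & E * Z * X * E = E].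
Proof.
move=> EE CZ ZC; have E0 : E * (1 - E) = 0 by rewrite mulrBr mulr1 EE subrr.
have E0' : (1 - E) * E = 0 by rewrite mulrBl mul1r EE subrr.
have FF : (1 - E) * (1 - E) = 1 - E by rewrite mulrBr mulr1 E0' subr0.
have FC : (1 - E) * corner E X = 1 - E by rewrite mulrDr !mulrA E0' !mul0r add0r FF.
have CF : corner E X * (1 - E) = 1 - E by rewrite mulrDl -!mulrA E0 !mulr0 add0r FF.
have FZ : (1 - E) * Z = 1 - E by rewrite -{1}FC -mulrA CZ mulr1.
have ZF : Z * (1 - E) = 1 - E by rewrite -{1}CF mulrA ZC mul1r.
have ZE : Z * E = E * Z.
  have h1 : Z - Z * E = 1 - E by rewrite -[RHS]ZF mulrBr mulr1.
  have h2 : Z - E * Z = 1 - E by rewrite -[RHS]FZ mulrBl mul1r.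
  by apply: oppr_inj; apply: (addrI Z); rewrite h1 h2.
have EC : E * corner E X = E * X * E by rewrite mulrDr E0 addr0 !mulrA EE.
have CE : corner E X * E = E * X * E by rewrite mulrDl E0' addr0 -!mulrA EE.
split=> //; first by rewrite -(mulrA _ Z) ZE mulrA -EC -mulrA CZ mulr1.
by rewrite -ZE -!mulrA (mulrA E) -CE mulrA ZC mul1r.
Qed.
End Corner.

Section Elimination.
Variables (k : closedFieldType) (n : nat) (d : 'I_n.+1 -> nat) (Q : quiverA n).
Local Notation N := (dimtot d).
Local Notation colv := (@colv n d Q).
Local Notation rowv := (@rowv n d Q).
Local Notation ev := (ev k colv).
Let ge : graded n ev := graded_ev k colv.
Implicit Types (X L h p : 'M[k]_N).

Lemma ckey_bound i : (i <= n)%N -> (ckey Q i <= n.*2)%N.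
Proof. by rewrite /ckey; case: ifP => _; lia. Qed.

Lemma rkey_bound i : (i <= n)%N -> (rkey Q i <= n.*2)%N.
Proof. by rewrite /rkey; case: ifP => _; lia. Qed.

Definition low (y : nat) : 'M[k]_N := pr k colv (fun m => ckey Q m <= ckey Q y)%N.
Definition up (x : nat) : 'M[k]_N := pr k colv (fun m => rkey Q x <= rkey Q m)%N.

(** Column operations: to the column [y] multiples of the columns that precede
    it are added, and its own block is normalized, so that in the rows up to
    [y] it becomes a column of the identity. *)
Definition elimcol X : 'M[k]_N :=
  \sum_(y < n.+1) X *m invmx (corner (low y) X) *m ev y.

(** Row operations: to the row [x] multiples of the rows that follow it are
    added, so that in the columns from [x] on it becomes a row of the
    identity. The corners are unipotent here, hence no denominators appear. *)
Definition elimrow L : 'M[k]_N :=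
  \sum_(x < n.+1) ev x *m neumann n (corner (up x) L) *m L.

Lemma ev_sumr (F : nat -> 'M[k]_N) (y : nat) : (y <= n)%N ->
  (\sum_(z < n.+1) F z *m ev z) *m ev y = F y *m ev y.
Proof.
move=> ly; have [ee eo _ _] := ge.
rewrite mulmx_suml (bigD1 (Ordinal (ly : (y < n.+1)%N))) //= -mulmxA [ev y *m _]ee.
rewrite big1 ?addr0 // => z zy; rewrite -mulmxA [ev z *m _](eo z y) ?mulmx0 //.
Qed.

Lemma ev_suml (F : nat -> 'M[k]_N) (y : nat) : (y <= n)%N ->
  ev y *m (\sum_(z < n.+1) ev z *m F z) = ev y *m F y.
Proof.
move=> ly; have [ee eo _ _] := ge.
rewrite mulmx_sumr (bigD1 (Ordinal (ly : (y < n.+1)%N))) //= mulmxA [ev y *m _]ee.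
rewrite big1 ?addr0 // => z zy; rewrite mulmxA [ev y *m _](eo y z) ?mul0mx //.
by rewrite eq_sym; apply: contra zy => /eqP e; apply/eqP/val_inj.
Qed.

Lemma elimcolP X : (forall y, (y <= n)%N -> corner (low y) X \in unitmx) ->
  unilower n ev (ckey Q) (elimcol X) /\
  exists2 h, supp n ev h (upper (ckey Q)) & elimcol X = X *m h.
Proof.
move=> cu; have [ee eo _ _] := ge.
pose Z y : 'M[k]_N := invmx (corner (low y) X).
have CZ y : (y <= n)%N -> [/\ (1%:M - low y) *m Z y = 1%:M - low y & low y *m X *m Z y *m low y = low y].
  move=> ly; have [] := @cornerP _ (low y) X (Z y) (pr_id _ _ _) (mulmxV (cu y ly)) (mulVmx (cu y ly)).
  by move=> h1 _ h3 _; split.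
have el y : low y *m ev y = ev y by rewrite pr_ev leqnn.
have le z y : ev z *m low y = if (ckey Q z <= ckey Q y)%N then ev z else 0 by rewrite ev_pr.
have Ly y : (y <= n)%N -> low y *m elimcol X *m ev y = ev y.
  move=> ly; rewrite -mulmxA (ev_sumr (fun y => X *m Z y)) // -el.
  by rewrite !mulmxA; have [_ ->] := CZ y ly.
have main i j : (j <= n)%N -> (ckey Q i <= ckey Q j)%N -> ev i *m elimcol X *m ev j = ev i *m ev j.
  by move=> lj kij; rewrite -{2}(Ly j lj) !mulmxA le kij.
split.
  split=> [i j li lj|i li]; last by rewrite -[LHS]/(ev i *m elimcol X *m ev i) main // [LHS]ee.
  rewrite negb_or -leqNgt => /andP[ne kij].
  by rewrite -[LHS]/(ev i *m elimcol X *m ev j) main // [LHS]eo.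
exists (\sum_(y < n.+1) Z y *m ev y); last first.
  by rewrite mulmx_sumr; apply: eq_bigr => y _; rewrite mulmxA.
move=> i j li lj; rewrite /upper -ltnNge => kij.
rewrite -[LHS]/(ev i *m (\sum_(y < n.+1) Z y *m ev y) *m ev j) -mulmxA ev_sumr // mulmxA.
have ei : ev i *m (1%:M - low j) = ev i by rewrite mulmxBr mulmx1 le leqNgt kij subr0.
have [h _] := CZ j lj; rewrite -ei -(mulmxA (ev i)) h mulmxBr mulmx1 le leqNgt kij subr0.
by rewrite [LHS]eo //; apply: contraTneq kij => ->; rewrite ltnn.
Qed.

Lemma elimrowP L : unilower n ev (ckey Q) L ->
  [/\ forall i, (i <= n)%N -> ev i *m elimrow L *m ev i = ev i,
     supp n ev (elimrow L) (lowrel Q) &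
     exists2 p, supp n ev p (upper (rkey Q)) & elimrow L = p *m L].
Proof.
move=> uL; have [ee eo _ _] := ge; have [sL dL] := uL.
have eup z x : ev z *m up x = if (rkey Q x <= rkey Q z)%N then ev z else 0 by rewrite ev_pr.
have upe z x : up x *m ev z = if (rkey Q x <= rkey Q z)%N then ev z else 0 by rewrite pr_ev.
have uC x : unilower n ev (ckey Q) (corner (up x) L).
  have E i j : ev i *m corner (up x) L *m ev j =
      (if (rkey Q x <= rkey Q i)%N && (rkey Q x <= rkey Q j)%N then ev i *m L *m ev j else 0) +
      (if (rkey Q x <= rkey Q i)%N then 0 else ev i *m ev j).
    rewrite [corner _ _]/(up x *m L *m up x + (1%:M - up x)) mulmxDr mulmxDl mulmxBr mulmx1 !mulmxA eup.
    rewrite -!(mulmxA _ (up x) (ev j)) upe; case: ifP => _; case: ifP => _; rewrite /= ?mul0mx ?mulmx0 ?subrr ?subr0 ?mul0mx //.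
  split=> [i j li lj nr|i li].
    rewrite -[LHS]/(ev i *m _ *m ev j) E [ev i *m L *m ev j]sL // if_same add0r.
    by case: ifP => // _; rewrite [LHS]eo //; move: nr; rewrite negb_or => /andP[].
  by rewrite -[LHS]/(ev i *m _ *m ev i) E andbb [ev i *m L *m ev i]dL // [ev i *m ev i]ee; case: ifP; rewrite ?addr0 ?add0r.
pose Z x : 'M[k]_N := neumann n (corner (up x) L).
have sZ x : supp n ev (Z x) (fun i j => (i == j) || (ckey Q j < ckey Q i)%N).
  exact: (neumann_supp ge (uC x)).
have CZ x : Z x *m (1%:M - up x) = 1%:M - up x /\ up x *m Z x *m L *m up x = up x.
  have [h1 h2] := neumannK ge ckey_bound (uC x).
  by have [_ h _ h'] := @cornerP _ (up x) L (Z x) (pr_id _ _ _) h1 h2; split.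
have eZ x : (x <= n)%N -> ev x *m elimrow L = ev x *m (Z x *m L).
  by move=> lx; rewrite -(ev_suml (fun x => Z x *m L)) //; congr (_ *m _); apply: eq_bigr => z _; rewrite mulmxA.
have main i j : (i <= n)%N -> (rkey Q i <= rkey Q j)%N -> ev i *m elimrow L *m ev j = ev i *m ev j.
  move=> li kij; have ui : ev i *m up i = ev i by rewrite eup leqnn.
  have uj : up i *m ev j = ev j by rewrite upe kij.
  rewrite eZ //; have [_ h] := CZ i.
  have -> : ev i *m (Z i *m L) *m ev j = ev i *m (up i *m Z i *m L *m up i) *m ev j.
    by rewrite !mulmxA ui -(mulmxA _ (up i)) uj.
  by rewrite h ui.
have sZL x : supp n ev (Z x *m L) (fun i j => (i == j) || (ckey Q j < ckey Q i)%N).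
  apply: (suppM ge (sZ x) sL) => i l j _ _ _ /orP[/eqP->//|h1] /orP[/eqP<-|h2].
    by rewrite h1 orbT.
  by rewrite (ltn_trans h2 h1) orbT.
split=> [i li||].
- by rewrite main // [LHS]ee.
- move=> i j li lj; rewrite negb_or negb_and -!leqNgt => /andP[ne /orP[kij|kij]].
    by rewrite -[LHS]/(ev i *m elimrow L *m ev j) main // [LHS]eo.
  rewrite -[LHS]/(ev i *m elimrow L *m ev j) eZ // [LHS]sZL // negb_or ne -leqNgt.
  exact: kij.
exists (\sum_(x < n.+1) ev x *m Z x); last by rewrite mulmx_suml.
move=> i j li lj; rewrite /upper -ltnNge => kij.
rewrite -[LHS]/(ev i *m (\sum_(y < n.+1) ev y *m Z y) *m ev j) ev_suml //.
have uj : (1%:M - up i) *m ev j = ev j by rewrite mulmxBl mul1mx upe leqNgt kij subr0.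
have [h _] := CZ i; rewrite -uj -!mulmxA (mulmxA (Z i)) h uj [LHS]eo //.
by apply: contraTneq kij => ->; rewrite ltnn.
Qed.

(** On the cell the corners fix the block columns, resp. the block rows, to
    which the elimination applies their inverses. *)
Lemma elim_cell X : (forall i, (i <= n)%N -> ev i *m X *m ev i = ev i) -> supp n ev X (lowrel Q) ->
  (forall y, (y <= n)%N -> corner (low y) X \in unitmx) ->
  elimrow (elimcol X) = X.
Proof.
move=> dX sX cu; have [ee eo _ _] := ge.
have sum_ev (Y : 'M[k]_N) : Y = \sum_(y < n.+1) Y *m ev y by exact: (e_sumr ge).
have sum_ev' (Y : 'M[k]_N) : Y = \sum_(y < n.+1) ev y *m Y by exact: (e_suml ge).
have -> : elimcol X = X.
  rewrite [RHS]sum_ev; apply: eq_bigr => -[y ly] _ /=; rewrite -mulmxA; congr (_ *m _).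
  have e : corner (low y) X *m ev y = ev y.
    rewrite [corner _ _]/(low y *m X *m low y + (1%:M - low y)) mulmxDl mulmxBl mul1mx -!mulmxA.
    rewrite !pr_ev leqnn subrr addr0 [LHS]sum_ev'.
    rewrite (bigD1 (Ordinal ly)) //= big1 ?addr0.
      by rewrite !mulmxA ev_pr leqnn dX.
    move=> z zy; rewrite !mulmxA ev_pr; case: ifP => kz; last by rewrite !mul0mx.
    rewrite [LHS]sX //; first by rewrite -ltnS.
    by rewrite negb_or zy negb_and -!leqNgt kz orbT.
  by rewrite -{1}e mulKmx // cu.
rewrite [RHS]sum_ev'; apply: eq_bigr => -[x lx] _ /=; congr (_ *m _).
have e : ev x *m corner (up x) X = ev x.
  rewrite [corner _ _]/(up x *m X *m up x + (1%:M - up x)) mulmxDr mulmxBr mulmx1 !mulmxA.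
  rewrite !ev_pr leqnn subrr addr0 [LHS]sum_ev.
  rewrite (bigD1 (Ordinal lx)) //= big1 ?addr0.
    by rewrite -!mulmxA pr_ev leqnn mulmxA dX.
  move=> z zx; rewrite -!mulmxA pr_ev; case: ifP => kz; last by rewrite !mulmx0.
  rewrite mulmxA [LHS]sX //; first by rewrite -ltnS.
  rewrite negb_or negb_and -!leqNgt kz andbT eq_sym.
  by apply: contra zx => /eqP e; apply/eqP/val_inj.
rewrite /neumann big_ord_recl expr0.
rewrite mulmxDr mulmx1 mulmx_sumr big1 ?addr0 // => m _.
rewrite exprS; have e0 : ev x *m (1%:M - corner (up x) X) = 0 by rewrite mulmxBr mulmx1 e subrr.
by apply: etrans (mulmxA _ _ _) _; rewrite e0 mul0mx.
Qed.

Local Notation v := (rowperm_mx k Q d).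

Lemma unilower_unit X : unilower n ev (ckey Q) X -> X \in unitmx.
Proof. by case/(neumannK ge ckey_bound) => h _; case: (mulmx1_unit (h : X *m _ = 1%:M)). Qed.

(** Passing to the row labels, the corners of a lower triangular matrix stay lower
    triangular. *)
Lemma det_corner b y : is_trig_mx b ->
  \det (corner (low y) (v^T *m b *m v)) =
  \prod_(i < N) (if (ckey Q (rowv i) <= ckey Q y)%N then b i i else 1).
Proof.
move=> tb; have tv := mulmx1C (v_tr k d Q); have vt := v_tr k d Q.
pose R : 'M[k]_N := pr k rowv (fun m => ckey Q m <= ckey Q y)%N.
have e : v *m corner (low y) (v^T *m b *m v) *m v^T = R *m b *m R + (1%:M - R).
  have h : v *m low y = R *m v by exact: v_pr.
  have conj (x xt F : 'M[k]_N) : x *m xt = 1%:M -> x *m F = R *m x ->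
      x *m (F *m (xt *m b *m x) *m F + (1%:M - F)) *m xt = R *m b *m R + (1%:M - R).
    move=> xx xF; rewrite mulmxDr mulmxDl mulmxBr mulmxBl mulmx1 xx xF -(mulmxA R x) xx mulmx1.
    congr (_ + _); rewrite !mulmxA xF -(mulmxA R x) xx mulmx1 -!mulmxA (mulmxA x) xF.
    by rewrite -mulmxA xx mulmx1.
  exact: conj.
have -> : \det (corner (low y) (v^T *m b *m v)) = \det (R *m b *m R + (1%:M - R)).
  by rewrite -e !det_mulmx mulrAC -det_mulmx vt det1 mul1r.
have E (p q : 'I_N) : (R *m b *m R + (1%:M - R)) p q =
    (ckey Q (rowv p) <= ckey Q y)%:R * b p q * (ckey Q (rowv q) <= ckey Q y)%:R +
    (if (ckey Q (rowv p) <= ckey Q y)%N then 0 else (p == q)%:R).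
  rewrite [LHS]mxE mulmx_prE mul_prE; congr (_ + _).
  have -> : (1%:M - R) p q = (p == q)%:R - R p q by rewrite !mxE.
  by rewrite prE; case: ifP => _; rewrite ?andbT ?andbF ?subrr ?subr0.
rewrite det_trig; last first.
  apply/is_trig_mxP => p q pq; rewrite E (is_trig_mxP tb) // mulr0 mul0r add0r.
  by case: ifP => //; rewrite -val_eqE (ltn_eqF pq).
apply: eq_bigr => p _; rewrite E eqxx; case: ifP => _; rewrite ?mul1r ?mulr1 ?addr0 //.
by rewrite mul0r mul0r add0r.
Qed.

End Elimination.

(** * The opposite cell *)

Section OppositeCell.
Variables (k : closedFieldType) (n : nat) (d : 'I_n.+1 -> nat) (Q : quiverA n).
Local Notation N := (dimtot d).
Local Notation colv := (@colv n d Q).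
Local Notation rowv := (@rowv n d Q).
Local Notation ev := (ev k colv).
Local Notation v := (rowperm_mx k Q d).
Let ge : graded n ev := graded_ev k colv.
Implicit Types (A X b h : 'M[k]_N).

Let vt : v *m v^T = 1%:M := v_tr k d Q.
Let tv : v^T *m v = 1%:M := mulmx1C vt.

Lemma mul_vtE A p q : (A *m v^T) p q = A p (row2col Q q).
Proof.
transitivity ((v *m A^T) q p); first by rewrite -{1}[A]trmxK -trmx_mul mxE.
by rewrite mul_vE mxE.
Qed.

Lemma cell_v A : cell_space Q A -> cell_space Q (v *m (v^T *m A)).
Proof. by rewrite mulmxA vt mul1mx. Qed.

Lemma cell_trig A : cell_space Q A -> is_trig_mx (A *m v^T) /\ forall p, (A *m v^T) p p = 1.
Proof.
move=> cA; have /cell_spaceP[_ sX] := cell_v cA; have [c1 c2] := cA.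
split=> [|p]; last by rewrite mul_vtE c1 ?colv_row2col // coloff_row2col eqxx.
apply/is_trig_mxP => p q pq; rewrite mul_vtE.
have [e|ne] := eqVneq (rowv p) (rowv q).
  rewrite c1 ?colv_row2col // coloff_row2col; move: pq; rewrite (row_lt_off e).
  by move=> lt; rewrite ltn_eqF.
apply: c2; right; rewrite colv_row2col prec_rowseq ltn_neqAle.
rewrite (contra_neq (@rkey_inj _ _ _ _) ne) leqNgt; apply/negP => /row_lt_key.
by rewrite ltnNge ltnW.
Qed.

(** For a point [A] of the cell, [A v_Q^-1] is lower unitriangular. *)
Lemma cell_opp A : cell_space Q A -> opp_cell Q A.
Proof.
move=> cA; have [tA dA] := cell_trig cA; exists (A *m v^T), 1%:M; split.
- split=> //; rewrite unitmxE det_trig // big1 ?unitr1 // => p _; exact: dA.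
- apply/colupperP; split; first exact: unitmx1.
  by move=> p q; rewrite mxE; case: eqP => // ->; rewrite ltnn.
by rewrite mulmx1 -[v_mx k Q d]/v -mulmxA tv mulmx1.
Qed.

Lemma parabolic_inv h : parabolic Q h -> parabolic Q (invmx h).
Proof.
move=> /colupperP[hu hh]; apply/colupperP; split; first by rewrite unitmx_inv.
by move=> p q; apply: (key_upper_inv (key := fun p => ckey Q (colv p)) hh hu).
Qed.

Lemma parabolicM h h' : parabolic Q h -> parabolic Q h' -> parabolic Q (h *m h').
Proof.
move=> /colupperP[hu hh] /colupperP[hu' hh']; apply/colupperP; split.
  by rewrite unitmx_mul hu.
exact: colupperM.
Qed.

Lemma supp_colupper h : supp n ev h (upper (ckey Q)) -> @colupper k n d Q h.
Proof. by move=> sh p q lt; apply: (supp_entry sh); rewrite /upper -ltnNge. Qed.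

(** Column operations suffice: they keep the matrix lower triangular with
    respect to the order of the rows. *)
Lemma opp_cell_normal A : opp_cell Q A -> exists2 a, cell_space Q a & same_point Q A a.
Proof.
case=> b [h0 [[bu tb] ph0 AE]].
pose X := v^T *m b *m v.
have cu y : corner (low k d Q y) X \in unitmx.
  rewrite unitmxE /X det_corner //; apply: unitr_prod => i _.
  case: ifP => _; last exact: unitr1.
  by move: bu; rewrite unitmxE det_trig // !unitfE => /prodf_neq0 ->.
have [uL [h sh LE]] := elimcolP (fun y _ => cu y).
have sX : supp n ev X (fun i j => rkey Q j <= rkey Q i)%N.
  apply/supp_evP => p q; have [p' <-] := row2col_surj Q p; have [q' <-] := row2col_surj Q q.
  rewrite !colv_row2col -ltnNge => lt.
  have -> : X (row2col Q p') (row2col Q q') = (v *m X *m v^T) p' q' by rewrite mul_vtE mul_vE.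
  rewrite /X !mulmxA vt mul1mx -mulmxA vt mulmx1; apply: (is_trig_mxP tb).
  exact: row_lt_key lt.
have sZ y : supp n ev (invmx (corner (low k d Q y) X)) (fun i j => rkey Q j <= rkey Q i)%N.
  apply/supp_evP => p q; rewrite -ltnNge => lt.
  apply: (@key_upper_inv k N (fun p => n.*2 - rkey Q (colv p))%N (corner (low k d Q y) X) _ (cu y)).
    move=> p' q' lt'; rewrite [corner _ _]/(low k d Q y *m X *m low k d Q y + (1%:M - low k d Q y)) mxE mulmx_prE mul_prE.
    rewrite (supp_entry sX) ?mulr0 ?mul0r ?add0r; last by rewrite -ltnNge; lia.
    rewrite mxE [1%:M _ _]mxE mxE prE; case: eqP => [e|_]; last by rewrite subrr.
    by rewrite e ltnn in lt'.
  by have := rkey_bound Q (leq_ord (colv q)); lia.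
exists (v *m elimcol Q X).
  apply/cell_spaceP; have [sL dL] := uL; split=> // i j li lj.
  rewrite negb_or negb_and -!leqNgt => /andP[ne /orP[kij|kij]]; last first.
    by apply: sL => //; rewrite negb_or ne -leqNgt.
  have sXZ : supp n ev (X *m invmx (corner (low k d Q j) X)) (fun i j => rkey Q j <= rkey Q i)%N.
    by apply: (suppM ge sX (sZ j)) => a c e _ _ _ h1 h2; exact: leq_trans h2 h1.
  rewrite -[LHS]/(ev i *m elimcol Q X *m ev j) -mulmxA.
  rewrite (ev_sumr Q (fun y => X *m invmx (corner (low k d Q y) X))) // mulmxA.
  rewrite [LHS]sXZ // -ltnNge ltn_neqAle kij andbT; apply: contra ne => /eqP e.
  have li' : (i < n.+1)%N by []; have lj' : (j < n.+1)%N by [].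
  by have /(congr1 val)/= -> := @rkey_inj n Q (Ordinal li') (Ordinal lj') e.
exists (invmx h0 *m h).
  apply: parabolicM; first exact: parabolic_inv.
  apply/colupperP; split; last exact: supp_colupper.
  by have := unilower_unit uL; rewrite LE unitmx_mul => /andP[].
rewrite AE LE /X -[v_mx k Q d]/v -!mulmxA (mulmxA v v^T) vt mul1mx mulKVmx //.
by case: ph0.
Qed.
End OppositeCell.

(** * Functions with denominators *)

Section RationalFunctions.
Variables (k : closedFieldType) (n : nat) (d : 'I_n.+1 -> nat).
Local Notation N := (dimtot d).
Local Notation eval := (evalat (@mx_coord k n d)).
Implicit Types (A : 'M[k]_N) (phi psi : 'M[k]_N -> k).

Definition polyfun phi := exists p, forall A, phi A = eval p A.

Variable D : 'M[k]_N -> k.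
Hypothesis pD : polyfun D.

(** Regular functions on the locus where [D] does not vanish. *)
Definition ratfun phi := exists m p, forall A, D A != 0 -> D A ^+ m * phi A = eval p A.

Lemma evalM p q A : eval (p * q) A = eval p A * eval q A. Proof. exact: rmorphM. Qed.
Lemma evalD p q A : eval (p + q) A = eval p A + eval q A. Proof. exact: rmorphD. Qed.
Lemma evalX p m A : eval (p ^+ m) A = eval p A ^+ m. Proof. exact: rmorphXn. Qed.

Lemma eq_ratfun phi psi : (forall A, D A != 0 -> phi A = psi A) -> ratfun phi -> ratfun psi.
Proof. by move=> e [m [p h]]; exists m, p => A DA; rewrite -e // h. Qed.

Lemma rat_poly phi : polyfun phi -> ratfun phi.
Proof. by case=> p h; exists 0%N, p => A _; rewrite mul1r h. Qed.

Lemma poly_const c : polyfun (fun=> c).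
Proof. by exists c%:MP => A; rewrite /evalat mevalC. Qed.

Lemma poly_coord i j : polyfun (fun A => A i j).
Proof.
exists 'X_(enum_rank (i, j) : 'I_#|mx_index d|) => A.
by rewrite /evalat mevalXU enum_rankK.
Qed.

Lemma rat_const c : ratfun (fun=> c). Proof. exact/rat_poly/poly_const. Qed.

Lemma rat_add phi psi : ratfun phi -> ratfun psi -> ratfun (fun A => phi A + psi A).
Proof.
case=> m [p h] [m' [p' h']]; have [q qE] := pD.
exists (m + m')%N, (q ^+ m' * p + q ^+ m * p') => A DA.
by rewrite evalD !evalM !evalX -qE -h // -h' // mulrDr exprD !mulrA [D A ^+ m' * _]mulrC.
Qed.

Lemma rat_mul phi psi : ratfun phi -> ratfun psi -> ratfun (fun A => phi A * psi A).
Proof.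
case=> m [p h] [m' [p' h']]; exists (m + m')%N, (p * p') => A DA.
by rewrite evalM -h // -h' // exprD mulrACA.
Qed.

Lemma rat_sum (I : Type) (s : seq I) (P : pred I) (F : I -> 'M[k]_N -> k) :
  (forall i, ratfun (F i)) -> ratfun (fun A => \sum_(i <- s | P i) F i A).
Proof.
move=> rF; elim: s => [|i s IH].
  by apply: eq_ratfun (rat_const 0) => A _; rewrite big_nil.
case Pi: (P i); last by apply: eq_ratfun IH => A _; rewrite big_cons Pi.
by apply: eq_ratfun (rat_add (rF i) IH) => A _; rewrite big_cons Pi.
Qed.

Lemma rat_prod (I : Type) (s : seq I) (P : pred I) (F : I -> 'M[k]_N -> k) :
  (forall i, ratfun (F i)) -> ratfun (fun A => \prod_(i <- s | P i) F i A).
Proof.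
move=> rF; elim: s => [|i s IH].
  by apply: eq_ratfun (rat_const 1) => A _; rewrite big_nil.
case Pi: (P i); last by apply: eq_ratfun IH => A _; rewrite big_cons Pi.
by apply: eq_ratfun (rat_mul (rF i) IH) => A _; rewrite big_cons Pi.
Qed.

Lemma rat_exp phi m : ratfun phi -> ratfun (fun A => phi A ^+ m).
Proof.
move=> rp; elim: m => [|m IH]; first exact: rat_const.
by apply: eq_ratfun (rat_mul rp IH) => A _; rewrite exprS.
Qed.

Definition ratmx m l (F : 'M[k]_N -> 'M[k]_(m, l)) := forall i j, ratfun (fun A => F A i j).

Lemma ratmx_const m l (B : 'M[k]_(m, l)) : ratmx (fun=> B).
Proof. by move=> i j; exact: rat_const. Qed.

Lemma ratmx_id : ratmx id.
Proof. by move=> i j; exact/rat_poly/poly_coord. Qed.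

Lemma ratmx_add m l (F G : 'M[k]_N -> 'M[k]_(m, l)) :
  ratmx F -> ratmx G -> ratmx (fun A => F A + G A).
Proof. by move=> rF rG i j; apply: eq_ratfun (rat_add (rF i j) (rG i j)) => A _; rewrite mxE. Qed.

Lemma ratmx_mul m l r (F : 'M[k]_N -> 'M[k]_(m, l)) (G : 'M[k]_N -> 'M[k]_(l, r)) :
  ratmx F -> ratmx G -> ratmx (fun A => F A *m G A).
Proof.
move=> rF rG i j; have h : ratfun (fun A => \sum_l F A i l * G A l j).
  by apply: rat_sum => x; apply: rat_mul.
by apply: eq_ratfun h => A _; rewrite mxE.
Qed.

Lemma ratmx_opp m l (F : 'M[k]_N -> 'M[k]_(m, l)) : ratmx F -> ratmx (fun A => - F A).
Proof.
move=> rF i j; apply: eq_ratfun (rat_mul (rat_const (-1)) (rF i j)) => A _.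
by rewrite mulN1r mxE.
Qed.

Lemma ratmx_sum m l (I : Type) (s : seq I) (F : I -> 'M[k]_N -> 'M[k]_(m, l)) :
  (forall i, ratmx (F i)) -> ratmx (fun A => \sum_(i <- s) F i A).
Proof.
move=> rF i j; have h : ratfun (fun A => \sum_(x <- s) F x A i j).
  by apply: rat_sum => x; apply: rF.
by apply: eq_ratfun h => A _; rewrite summxE.
Qed.

Lemma rat_det m (F : 'M[k]_N -> 'M[k]_m) : ratmx F -> ratfun (fun A => \det (F A)).
Proof.
move=> rF; apply: rat_sum => s; apply: rat_mul; first exact: rat_const.
by apply: rat_prod => i; apply: rF.
Qed.

Lemma ratmx_adj m (F : 'M[k]_N -> 'M[k]_m) : ratmx F -> ratmx (fun A => \adj (F A)).
Proof.
move=> rF i j; have h : ratfun (fun A => cofactor (F A) j i).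
  apply: rat_mul; first exact: rat_const.
  by apply: rat_det => a b; apply: eq_ratfun (rF (lift j a) (lift i b)) => A _; rewrite !mxE.
by apply: eq_ratfun h => A _; rewrite mxE.
Qed.

Lemma ratmx_inv m (F : 'M[k]_N -> 'M[k]_m) : ratmx F ->
  ratfun (fun A => (\det (F A))^-1) -> (forall A, D A != 0 -> F A \in unitmx) ->
  ratmx (fun A => invmx (F A)).
Proof.
move=> rF rd uF i j; apply: eq_ratfun (rat_mul rd (ratmx_adj rF i j)) => A DA.
by rewrite /invmx uF // [RHS]mxE.
Qed.

Lemma rat_eval (F : 'M[k]_N -> 'M[k]_N) f : ratmx F -> ratfun (fun A => eval f (F A)).
Proof.
move=> rF; rewrite /evalat /meval /mmap; apply: rat_sum => m.
apply: rat_mul; first exact: rat_const.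
by apply: rat_prod => i; apply: rat_exp; exact: rF.
Qed.

Lemma ratfun_clear phi : ratfun phi -> exists F, forall A,
  (D A = 0 -> eval F A = 0) /\ (D A != 0 -> exists m, eval F A = D A ^+ m * phi A).
Proof.
case=> m [p h]; have [q qE] := pD; exists (q * p) => A.
rewrite evalM -qE; split=> [->|DA]; first by rewrite mul0r.
by exists m.+1; rewrite exprS -mulrA h.
Qed.
End RationalFunctions.

(** * The normal form *)

Section NormalForm.
Variables (k : closedFieldType) (n : nat) (d : 'I_n.+1 -> nat) (Q : quiverA n).
Local Notation N := (dimtot d).
Local Notation colv := (@colv n d Q).
Local Notation ev := (ev k colv).
Local Notation v := (rowperm_mx k Q d).
Local Notation low := (low k d Q).
Local Notation rowupper := (@rowupper k n d Q).
Local Notation colupper := (@colupper k n d Q).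
Let ge : graded n ev := graded_ev k colv.
Implicit Types (A X b h : 'M[k]_N).

Let vt : v *m v^T = 1%:M := v_tr k d Q.
Let tv : v^T *m v = 1%:M := mulmx1C vt.

(** The elimination of columns is possible where this function does not
    vanish. *)
Definition cellminor A : k := \prod_(y < n.+1) \det (corner (low y) (v^T *m A)).

(** The elimination uses row operations too, so this is not a representative
    of the same flag; it only stays in the double coset. *)
Definition normal_form A : 'M[k]_N := v *m elimrow Q (elimcol Q (v^T *m A)).

Lemma ratmx_corner D (E : 'M[k]_N) (F : 'M[k]_N -> 'M[k]_N) : polyfun D -> ratmx D F ->
  ratmx D (fun A => corner E (F A)).
Proof.
move=> pD rF; apply: (ratmx_add pD (F := fun A => E *m F A *m E)); last exact: ratmx_const.
by apply: ratmx_mul; [exact: pD|apply: ratmx_mul; [exact: pD|exact: ratmx_const|]|exact: ratmx_const].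
Qed.

Lemma poly_cellminor : polyfun cellminor.
Proof.
have p1 : polyfun (fun _ : 'M[k]_N => 1 : k) by exact: poly_const.
have [m [p h]] : ratfun (fun=> 1) cellminor.
  apply: rat_prod => // y; apply: rat_det => //; apply: ratmx_corner => //.
  by apply: ratmx_mul => //; [exact: ratmx_const|exact: ratmx_id].
by exists p => A; rewrite -h ?oner_eq0 // expr1n mul1r.
Qed.

Lemma cellminor_unit A y : cellminor A != 0 -> (y <= n)%N -> corner (low y) (v^T *m A) \in unitmx.
Proof.
move=> /prodf_neq0 h ly; have := h (Ordinal (ly : (y < n.+1)%N)) isT.
by rewrite unitmxE unitfE.
Qed.

Lemma rat_normal_form : ratmx cellminor normal_form.
Proof.
have pD := poly_cellminor.
have rX : ratmx cellminor (fun A => v^T *m A).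
  by apply: ratmx_mul => //; [exact: ratmx_const|exact: ratmx_id].
have rI y : (y <= n)%N -> ratmx cellminor (fun A => invmx (corner (low y) (v^T *m A))).
  move=> ly; apply: ratmx_inv => //; last by move=> A DA; exact: cellminor_unit.
    exact: ratmx_corner.
  have rD : ratfun cellminor (fun A => (cellminor A)^-1).
    by exists 1%N, 1 => A DA; rewrite expr1 divff // /evalat meval1.
  pose P A := \prod_(z < n.+1 | z != Ordinal (ly : (y < n.+1)%N)) \det (corner (low z) (v^T *m A)).
  have rP : ratfun cellminor P.
    by apply: rat_prod => // z; apply: rat_det => //; apply: ratmx_corner.
  apply: eq_ratfun (rat_mul rD rP) => A DA.
  have e : cellminor A = \det (corner (low y) (v^T *m A)) * P A.
    by rewrite /cellminor (bigD1 (Ordinal (ly : (y < n.+1)%N))).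
  move: DA; rewrite e mulf_eq0 negb_or => /andP[d0 P0].
  by rewrite invfM -mulrA mulVf // mulr1.
have rS (I : finType) (F : I -> 'M[k]_N -> 'M[k]_N) : (forall i, ratmx cellminor (F i)) ->
    ratmx cellminor (fun A => \sum_i F i A).
  by move=> rF; exact: (@ratmx_sum k n d cellminor pD N N _ _ F).
have rL : ratmx cellminor (fun A => elimcol Q (v^T *m A)).
  apply: (rS _ (fun (y : 'I_n.+1) A => v^T *m A *m invmx (corner (low y) (v^T *m A)) *m ev y)) => y.
  apply: ratmx_mul => //; last exact: ratmx_const.
  by apply: ratmx_mul => //; apply: rI; rewrite -ltnS.
apply: ratmx_mul => //; first exact: ratmx_const.
apply: (rS _ (fun (x : 'I_n.+1) A => ev x *m neumann n (corner (up k d Q x) (elimcol Q (v^T *m A))) *m elimcol Q (v^T *m A))) => x.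
apply: ratmx_mul => //; apply: ratmx_mul => //; first exact: ratmx_const.
apply: (rS _ (fun (m : 'I_n.*2.+1) A => (1 - corner (up k d Q x) (elimcol Q (v^T *m A))) ^+ m)) => -[m _] /=.
elim: m => [|m IH]; first exact: ratmx_const.
have rC : ratmx cellminor (fun A => 1 - corner (up k d Q x) (elimcol Q (v^T *m A))).
  apply: ratmx_add => //; first exact: ratmx_const.
  by apply: ratmx_opp => //; apply: ratmx_corner.
by move=> i j; apply: eq_ratfun (ratmx_mul pD rC IH i j) => A _; rewrite exprS.
Qed.

Lemma cell_supp A : cell_space Q A ->
  (forall i, (i <= n)%N -> ev i *m (v^T *m A) *m ev i = ev i) /\ supp n ev (v^T *m A) (lowrel Q).
Proof. by move=> /cell_v/cell_spaceP. Qed.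

Lemma cell_cellminor A : cell_space Q A -> cellminor A = 1.
Proof.
move=> /cell_trig[tA dA]; rewrite /cellminor big1 // => y _.
have -> : v^T *m A = v^T *m (A *m v^T) *m v by rewrite -!mulmxA tv mulmx1.
by rewrite det_corner // big1 // => i _; rewrite dA if_same.
Qed.

Lemma cell_normal_form A : cell_space Q A -> normal_form A = A.
Proof.
move=> cA; have [dX sX] := cell_supp cA.
rewrite /normal_form elim_cell ?mulmxA ?vt ?mul1mx // => y ly.
by apply: cellminor_unit => //; rewrite cell_cellminor ?oner_eq0.
Qed.

Lemma supp_upper_inv (key : nat -> nat) (p : 'M[k]_N) : p \in unitmx -> supp n ev p (upper key) ->
  supp n ev (invmx p) (upper key).
Proof.
move=> pu sp; apply/supp_evP => i j; rewrite /upper -ltnNge.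
apply: (@key_upper_inv k N (fun p => key (colv p)) p _ pu).
by move=> i' j' lt; apply: (supp_entry sp); rewrite /upper -ltnNge.
Qed.

(** The normal form lies in the cell and in the double coset of [zeta V], so
    that [cell_recognition] applies. *)
Lemma normal_form_orbit (V : rep Q d k) b h A : cellminor A != 0 ->
  b \in unitmx -> rowupper b -> h \in unitmx -> colupper h -> A = b *m zeta V *m h ->
  exists2 U, orbit_of V U & zeta U = normal_form A.
Proof.
move=> mA bu rb hu ch AE.
have Au : A \in unitmx by rewrite AE !unitmx_mul bu zeta_unit hu.
have [uL [h' sh' LE]] := elimcolP (fun y => cellminor_unit mA (y := y)).
have [dA sA [p sp PE]] := elimrowP uL.
have lu := unilower_unit uL; have h'u : h' \in unitmx by move: lu; rewrite LE unitmx_mul => /andP[].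
have cu : elimrow Q (elimcol Q (v^T *m A)) \in unitmx.
  apply: (@unilower_unit k n d Q); split=> //; apply: (supp_sub sA) => i j _ _.
  by case/orP => [->|/andP[_ ->]]; rewrite ?orbT.
have pu : p \in unitmx by move: cu; rewrite PE unitmx_mul => /andP[].
have [v1 v2] := mulmx1_unit vt.
have sb : supp n ev (v^T *m b *m v) (upper (rkey Q)).
  apply/supp_evP => i j; have [i' <-] := row2col_surj Q i; have [j' <-] := row2col_surj Q j.
  rewrite !colv_row2col /upper -ltnNge => lt.
  have -> : (v^T *m b *m v) (row2col Q i') (row2col Q j') = (v *m (v^T *m b *m v) *m v^T) i' j'.
    by rewrite mul_vtE mul_vE.
  by rewrite !mulmxA vt mul1mx -mulmxA vt mulmx1; apply: rb.
have sP : supp n ev (p *m (v^T *m b *m v)) (upper (rkey Q)).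
  by apply: (suppM ge sp sb) => i j l _ _ _; exact: leq_trans.
have sH : supp n ev (h *m h') (upper (ckey Q)).
  have sh : supp n ev h (upper (ckey Q)).
    by apply/supp_evP => i j; rewrite /upper -ltnNge; apply: ch.
  by apply: (suppM ge sh sh') => i j l _ _ _; exact: leq_trans.
have Pu : p *m (v^T *m b *m v) \in unitmx by rewrite !unitmx_mul pu v1 v2 bu.
have Hu : h *m h' \in unitmx by rewrite unitmx_mul hu.
have [U UE oU] : exists2 U, zetaop U = elimrow Q (elimcol Q (v^T *m A)) & orbit_of V U.
  apply: (@cell_recognition k n d Q _ (p *m (v^T *m b *m v)) (h *m h') V) => //.
  - by apply/cell_spaceP.
  - exact: supp_upper_inv.
  - exact: supp_upper_inv.
  by rewrite PE LE AE zeta_zetaop !mulmxA.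
by exists U => //; rewrite zeta_zetaop UE.
Qed.

End NormalForm.

(** * Extension of equations to the Schubert variety *)

Section Extension.
Variables (k : closedFieldType) (n : nat) (d : 'I_n.+1 -> nat) (Q : quiverA n).
Local Notation N := (dimtot d).
Local Notation blkcount := (@blkcount n d Q).
Local Notation zorder := (@zorder n d Q).
Local Notation eval := (evalat (@mx_coord k n d)).
Variables (V : rep Q d k) (w u : 'S_N) (b b' : 'M[k]_N).
Hypotheses (zw : zorder w) (euw : forall x y, blkcount u x y = blkcount w x y).
Hypotheses (bu : b \in unitmx) (ub : uptrig b) (bu' : b' \in unitmx) (ub' : uptrig b').
Hypothesis VE : zeta V = b *m pm k u *m b'.

Lemma schubert_cell_zeta A : schubert_cell Q w A -> exists l r,
  [/\ l \in unitmx, rowupper Q l, r \in unitmx, colupper Q r & A = l *m zeta V *m r].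
Proof.
case=> b1 [h1 [[bu1 /uptrigP ub1] /colupperP[hu1 ch1] AE]].
have [s [t [[su sr] [tu tc] E]]] := pm_block_coset k zw euw.
have bV : pm k u = invmx b *m zeta V *m invmx b'.
  by rewrite VE -!mulmxA mulKmx // mulmxV // mulmx1.
have wE : pm k w = invmx s *m pm k u *m invmx t by rewrite E -!mulmxA mulKmx // mulmxV // mulmx1.
exists (b1 *m (invmx s *m invmx b)), (invmx b' *m invmx t *m h1).
have rinv l : l \in unitmx -> rowupper Q l -> rowupper Q (invmx l).
  by move=> lu lr p q; apply: (key_upper_inv (key := fun p => rkey Q (rowv Q p)) lr lu).
have cinv l : l \in unitmx -> colupper Q l -> colupper Q (invmx l).
  by move=> lu lr p q; apply: (key_upper_inv (key := fun p => ckey Q (colv Q p)) lr lu).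
split.
- by rewrite !unitmx_mul bu1 !unitmx_inv su bu.
- apply: rowupperM; first exact: uptrig_rowupper.
  by apply: rowupperM; apply: rinv => //; exact: uptrig_rowupper.
- by rewrite !unitmx_mul hu1 !unitmx_inv tu bu'.
- apply: colupperM => //; apply: colupperM; apply: cinv => //; exact: uptrig_colupper.
by rewrite AE -[perm_matrix k w]/(pm k w) wE bV !mulmxA.
Qed.

(** Clear the denominators of the composition of [f] with the normal form: the
    result vanishes on BwP, hence on its closure. *)
Lemma kl_extension f : (forall U, orbit_of V U -> eval f (zeta U) = 0) -> exists F,
  vanishing_ideal (@mx_coord k n d) (schubert_variety Q w) F /\
  forall A, cell_space Q A -> eval F A = eval f A.
Proof.
move=> f0; have rf := rat_eval (@poly_cellminor k n d Q) f (@rat_normal_form k n d Q).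
have [F FE] := ratfun_clear (@poly_cellminor k n d Q) rf.
exists F; split=> [A|A cA]; last first.
  have [_ h] := FE A; have [|m ->] := h _; first by rewrite cell_cellminor // oner_eq0.
  by rewrite cell_cellminor // expr1n mul1r cell_normal_form.
have F0 A' : schubert_cell Q w A' -> eval F A' = 0.
  move=> sA; have [h1 h2] := FE A'; have [/h1//|m0] := eqVneq (cellminor Q A') 0.
  have [m ->] := h2 m0; have [l [r [lu lr ru rr E]]] := schubert_cell_zeta sA.
  have [U oU <-] := normal_form_orbit m0 lu lr ru rr E.
  by rewrite f0 ?mulr0.
move=> [Au sA]; pose G B := B \in unitmx /\ forall h, parabolic Q h -> eval F (B *m h) = 0.
have p1 : parabolic Q (1%:M : 'M[k]_N).
  by apply/colupperP; split; [exact: unitmx1|move=> p q; rewrite mxE; case: eqP => // ->; rewrite ltnn].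
suff [_ h] : G A by rewrite -[A]mulmx1 h.
apply: sA; last first.
  move=> B sB; split.
    by case: sB => c [h [[cu _] [hu _] ->]]; rewrite !unitmx_mul cu hu (pm_unit k w).
  move=> h ph; apply: F0; case: sB => c [h' [bc ph' ->]].
  by exists c, (h' *m h); split=> //; [exact: parabolicM|rewrite mulmxA].
split=> [B []//|B Bu cB|B B' [h ph ->] [Bu hB]].
  split=> // h ph.
  have p1' : polyfun (fun _ : 'M[k]_N => 1 : k) by exact: poly_const.
  have [m [p pE]] : ratfun (fun=> 1) (fun A => eval F (A *m h)).
    by apply: rat_eval => //; apply: ratmx_mul => //; [exact: ratmx_id|exact: ratmx_const].
  have pE' C : eval F (C *m h) = eval p C by rewrite -pE ?oner_eq0 // expr1n mul1r.
  by rewrite pE'; apply: cB => C [_ hC]; rewrite -pE' hC.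
split=> [|h' ph']; first by rewrite unitmx_mul Bu; case: ph.
by rewrite -mulmxA hB //; exact: parabolicM.
Qed.
End Extension.

(** * The inverse of zeta *)

Section Recover.
Variables (k : closedFieldType) (n : nat) (d : 'I_n.+1 -> nat) (Q : quiverA n).
Local Notation N := (dimtot d).
Local Notation colv := (@colv n d Q).
Local Notation ev := (ev k colv).
Local Notation v := (rowperm_mx k Q d).
Let ge : graded n ev := graded_ev k colv.
Implicit Types (A X h : 'M[k]_N) (U V : rep Q d k).

Let vt : v *m v^T = 1%:M := v_tr k d Q.
Let tv : v^T *m v = 1%:M := mulmx1C vt.

(** A polynomial left inverse of [zeta]: the arrows of a representation are
    blocks of its image. *)
Definition recover A : rep Q d k := fun i => opblk Q (v^T *m A) (tgt Q i) (src Q i).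

Lemma zeta_block_arrow V i : zeta_block V (tgt Q i) (src Q i) = V i.
Proof.
have ar : arrow Q (src Q i) (tgt Q i) by apply/existsP; exists i; rewrite !eqxx.
rewrite /zeta_block /dpath (connect1 ar) /= -[RHS]arrow_mxE.
have [x [y [ex ey]]] : exists x y, x = tgt Q i /\ y = src Q i by exists (tgt Q i), (src Q i).
rewrite -ex -ey in ar *; have /orP[/andP[/eqP e _]|/andP[/eqP e _]] := arrow_adj ar.
  have -> : (x == y) = false by apply/negbTE/eqP => e'; rewrite e' in e; lia.
  have -> : (y == x.+1 :> nat) = false by apply/eqP; lia.
  have -> : (x.+1 < y)%N = false by lia.
  rewrite /path_mx (_ : (x - y + (y - x))%N = 1%N) /=; last by lia.
  rewrite (bigD1 y) //= eqxx big1 ?addr0 => [|z /negPf->]; last by rewrite mulmx0.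
  by rewrite pid_mx_1 mulmx1.
have -> : (x == y) = false by apply/negbTE/eqP => e'; rewrite e' in e; lia.
by rewrite e eqxx.
Qed.

Lemma recover_zeta U i : recover (zeta U) i = U i.
Proof. by rewrite /recover zeta_zetaop mulmxA tv mul1mx opmK zeta_block_arrow. Qed.

Lemma eval_recover (g : {mpoly k[#|rep_index Q d|]}) : exists f, forall A,
  evalat (@mx_coord k n d) f A = evalat (@rep_coord k n Q d) g (recover A).
Proof.
have p1 : polyfun (fun _ : 'M[k]_N => 1 : k) by exact: poly_const.
suff [m [f h]] : ratfun (fun=> 1) (fun A => evalat (@rep_coord k n Q d) g (recover A)).
  by exists f => A; rewrite -h ?oner_eq0 // expr1n mul1r.
rewrite /evalat /meval /mmap; apply: rat_sum => // m.
apply: rat_mul => //; first exact: rat_const.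
apply: rat_prod => // j; apply: rat_exp => //.
have rX : ratmx (fun=> 1) (fun A => v^T *m A).
  by apply: ratmx_mul => //; [exact: ratmx_const|exact: ratmx_id].
apply: eq_ratfun (rX (colpos Q (tagged (enum_val j : rep_index Q d)).1) (colpos Q (tagged (enum_val j : rep_index Q d)).2)) => A _.
by rewrite /rep_coord /recover [RHS]mxE.
Qed.

(** These polynomials are equations for the image of [zeta] in the space of
    all matrices. *)
Lemma eval_zeta_recover p q : exists f, forall A,
  evalat (@mx_coord k n d) f A = A p q - zeta (recover A) p q.
Proof.
have [f fE] := eval_recover (zeta_comorphism Q ('X_(enum_rank (p, q)))).
exists ('X_(enum_rank ((p, q) : mx_index d)) - f) => A.
rewrite {1}/evalat mevalB -!/(evalat _ _ _) fE evalat_zeta_comorphism /evalat !mevalXU enum_rankK //.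
Qed.

Lemma cell_unilower X : cell_space Q (v *m X) -> unilower n ev (ckey Q) X.
Proof.
case/cell_spaceP => dX sX; split=> //; apply: (supp_sub sX) => i j _ _.
by case/orP => [->|/andP[_ ->]]; rewrite ?orbT.
Qed.

(** The factor [h = X^-1 (X h)] is lower as well as upper triangular. *)
Lemma unilower_upper1 X h : unilower n ev (ckey Q) X -> unilower n ev (ckey Q) (X *m h) ->
  supp n ev h (upper (ckey Q)) -> h = 1%:M.
Proof.
move=> uX uXh sh; have [_ ZX] := neumannK ge (@ckey_bound n Q) uX.
have hE : h = neumann n X * (X * h) by rewrite mulrA ZX mul1r.
have sZ := neumann_supp ge uX; have [sXh dXh] := uXh.
have sh' : supp n ev h (fun i j => (i == j) || (ckey Q j < ckey Q i)%N).
  rewrite hE; apply: (suppM ge sZ sXh) => i l j _ _ _ /orP[/eqP->//|h1] /orP[/eqP<-|h2].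
    by rewrite h1 orbT.
  by rewrite (ltn_trans h2 h1) orbT.
have dh : supp n ev h eq_op.
  move=> i j li lj ne; case: (leqP (ckey Q i) (ckey Q j)) => kij.
    by apply: sh' => //; rewrite negb_or ne -leqNgt.
  by apply: sh => //; rewrite /upper -ltnNge.
have [_ dX] := uX; have [ee eo _ _] := ge.
apply: (graded_eq ge) => i j li lj; rewrite mulr1.
have [<-|ne] := eqVneq i j; last by rewrite eo // dh.
rewrite ee -[RHS](dXh i li) -[X *m h]/(X * h).
have he : h * ev i = ev i * h * ev i by rewrite (supp_diagC ge i dh) -mulrA ee.
by rewrite -!mulrA he !mulrA dX // ee.
Qed.

Lemma zeta_ext U U' : (forall i, U i = U' i) -> zeta U = zeta U'.
Proof.
move=> e; apply/matrixP => p q.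
by apply: (map_zeta (f := idfun)) => i; rewrite map_mx_id ?e.
Qed.

Lemma rep_eval_ext g U U' : (forall i, U i = U' i) ->
  evalat (@rep_coord k n Q d) g U = evalat (@rep_coord k n Q d) g U'.
Proof. by move=> e; apply: meval_eq => j; rewrite /rep_coord e. Qed.

Lemma zeta_inj U U' : same_point Q (zeta U) (zeta U') -> forall i, U i = U' i.
Proof.
case=> h /colupperP[_ ch] e i; suff h1 : h = 1%:M.
  by rewrite -[LHS]recover_zeta -[RHS]recover_zeta e h1 mulmx1.
have e' : zetaop U' = zetaop U *m h.
  by rewrite -[LHS]mul1mx -tv -mulmxA -zeta_zetaop e zeta_zetaop !mulmxA tv mul1mx.
have uz U0 : unilower n ev (ckey Q) (zetaop U0).
  by apply: cell_unilower; rewrite -zeta_zetaop; exact: zeta_cell.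
apply: (unilower_upper1 (uz U)); first by rewrite -e'.
by apply/supp_evP => p q; rewrite /upper -ltnNge; exact: ch.
Qed.

End Recover.

Theorem theorem1p1 (k : closedFieldType) (n : nat) (Q : quiverA n)
    (d : 'I_n.+1 -> nat) (hd : forall x, (0 < d x)%N) :
  (forall U : rep Q d k, cell_space Q (zeta U) /\ opp_cell Q (zeta U)) /\
  (forall (V : rep Q d k) (r : 'I_n.+1 -> 'I_n.+1 -> nat),
    rank_parameter V r ->
    exists w : 'S_(dimtot d),
      [/\ unique (zelevinsky_perm k Q r) w,
          (* zeta maps the quiver locus bijectively onto the points of the
             Kazhdan-Lusztig variety *)
          forall U, quiver_locus V U -> kl_variety Q w (zeta U),
          forall U U', quiver_locus V U -> quiver_locus V U' ->
            same_point Q (zeta U) (zeta U') -> forall i, U i = U' i,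
          forall A, kl_variety Q w A ->
            exists2 U, quiver_locus V U & same_point Q (zeta U) A &
          (* and is an isomorphism of affine schemes *)
          induces_quotient_iso (@zeta_comorphism k n Q d)
            (kl_ideal Q w) (quiver_locus_ideal V)]).
Proof.
have zcell U : cell_space Q (zeta U) := zeta_cell U.
split=> [U|V r rV]; first by split=> //; exact: cell_opp.
have [w [u [b [b' [uw [zw euw] [bu ub] [bu' ub'] VE]]]]] := zelevinsky_perm_exists rV.
have [[_ rw] _] := uw.
have orbX U : orbit_of V U -> schubert_variety Q w (zeta U).
  move=> oU; apply: schubert_rank => //; first exact: zeta_unit.
  by move=> x y; rewrite (orbit_rank_swsub oU) -(rw V rV).
have locX := quiver_locus_schubert orbX.
have ext f := kl_extension (f := f) zw euw bu ub bu' ub' VE.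
have spoint (A A' : 'M[k]_(dimtot d)) : same_point Q A A' -> same_point Q A' A.
  case=> h ph ->; exists (invmx h); first exact: parabolic_inv.
  by rewrite mulmxK //; case: ph.
have onto A : cell_space Q A -> schubert_variety Q w A ->
    quiver_locus V (recover Q A) /\ zeta (recover Q A) = A.
  (* The points of the Schubert variety in the cell satisfy the equations of
     zeta (orbit of V). *)
  move=> cA sA; have vanish f : (forall U, orbit_of V U -> evalat (@mx_coord k n d) f (zeta U) = 0) ->
      evalat (@mx_coord k n d) f A = 0.
    by move=> /ext[F [F0 FE]]; rewrite -FE // F0.
  have recE (U : rep Q d k) : zeta (recover Q (zeta U)) = zeta U.
    by apply: zeta_ext; exact: recover_zeta.
  split.
    move=> g g0; have [f fE] := eval_recover g; rewrite -fE; apply: vanish => U oU.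
    by rewrite fE (rep_eval_ext _ (recover_zeta U)); exact: g0.
  apply/matrixP => p q; have [f fE] := eval_zeta_recover k Q p q.
  apply/eqP; rewrite eq_sym -subr_eq0 -fE vanish // => U _.
  by rewrite fE recE subrr.
exists w; split=> //.
- by move=> U lU; split; [exact: locX|exact: cell_opp].
- by move=> U U' _ _; exact: zeta_inj.
- move=> A [sA oA]; have [a ca sa] := opp_cell_normal oA.
  have sa' : schubert_variety Q w a.
    split; first by case: sA sa => Au _ [h [hu _] ->]; rewrite unitmx_mul Au.
    by move=> F Fc Fw; have [_ _ Fp] := Fc; apply: Fp sa _; case: sA => _; apply.
  have [lU zU] := onto a ca sa'; exists (recover Q a) => //.
  by rewrite zU; exact: spoint.
split=> [f|g].
  split=> [[g [h [g0 h0 ->]]] U lU|f0].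
    rewrite evalat_zeta_comorphism /evalat mevalD -!/(evalat _ _ _).
    by rewrite g0 ?h0 ?addr0 //; exact: locX.
  have [|F [F0 FE]] := ext f.
    move=> U oU; rewrite -evalat_zeta_comorphism; apply: f0 => g g0; exact: g0.
  exists F, (f - F); split=> //; last by rewrite addrC subrK.
  by move=> A cA; rewrite /evalat mevalB -!/(evalat _ _ _) FE ?subrr.
have [f fE] := eval_recover g; exists f => U lU.
rewrite /evalat mevalB -!/(evalat _ _ _) evalat_zeta_comorphism fE.
by rewrite (rep_eval_ext _ (recover_zeta U)) subrr.
Qed.
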